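(* Let $1<p<\infty$. There is a constant $C(p)>0$, depending only on $p$, such that the following holds. Let $\mu$ be a finite measure on $\mathbb{C}$ with compact support, and let $M_\mu$ be the operator on $L^p(\mu)$ given by $(M_\mu f)(z)=zf(z)$. Then for every $\epsilon>0$ there exist a compact operator $K$ on $L^p(\mu)$ with $\|K\|<\epsilon$ and an operator $D$ on $L^p(\mu)$ that is diagonal with respect to an unconditional basis $(u_n)_{n\ge 1}$ for $L^p(\mu)$ such that \[M_\mu = D+K,\] and the unconditional basis constant of $(u_n)_{n\ge1}$ is at most $C(p)$.
   Context: Measures are (positive) Borel measures; $L^p(\mu)$ is the complex $L^p$ space; operators are bounded and linear. A basis $(u_n)_{n\ge1}$ for a Banach space $X$ is a $C$-unconditional basis (has unconditional basis constant at most $C$) if \[\frac1C\Big\|\sum_{n=1}^m |a_n|u_n\Big\|\le\Big\|\sum_{n=1}^m a_nu_n\Big\|\le C\Big\|\sum_{n=1}^m |a_n|u_n\Big\|\] for all $m\ge1$ and $a_1,\dots,a_m\in\mathbb{C}$. If $L^p(\mu)$ is finite dimensional, the basis is understood to be a finite sequence. An operator $D$ is diagonal with respect to $(u_n)$ if for each $n$ there is $\lambda_n\in\mathbb{C}$ with $Du_n=\lambda_nu_n$. The basis $(u_n)$ is allowed to depend on $\epsilon$ (and $\mu$). *)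

(* Defs.v *)
From HB Require Import structures.
From mathcomp Require Import all_boot all_order all_algebra.
From mathcomp Require Import complex.
From mathcomp Require Import lra.
From mathcomp Require Import all_classical all_reals all_analysis.
From mathcomp Require Import measurable_realfun.

Set Implicit Arguments.
Unset Strict Implicit.
Unset Printing Implicit Defensive.

Import Order.TTheory GRing.Theory Num.Theory.
Import numFieldNormedType.Exports.
Import ComplexField.Normc.

Local Open Scope classical_set_scope.
Local Open Scope ring_scope.
Local Open Scope complex_scope.

HB.instance Definition _ (R : realType) := NormedModule.copy R[i] R[i]^o.

(* measurable on R[i] is the Borel sigma-algebra <<s open >>; it agrees with
   measurability of the real and imaginary parts, see measurable_complexP. *)
HB.instance Definition _ (R : realType) :=
  Measurable.copy R[i] (g_sigma_algebraType (@open R[i])).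

Section complex_borel.
Variable R : realType.
Implicit Types (z w : R[i]) (U : set R[i]).

Lemma normcEC z : `|z| = (normc z)%:C.
Proof. by case: z => a b; rewrite normc_def. Qed.

Lemma normc_ge0 z : 0 <= normc z.
Proof. by case: z => a b; exact: Num.Theory.sqrtr_ge0. Qed.

Lemma normc_Re z : `|complex.Re z| <= normc z.
Proof. by rewrite -lecR -normcEC; exact: normc_ge_Re. Qed.

Lemma normc_Im z : `|complex.Im z| <= normc z.
Proof.
case: z => a b /=; rewrite -sqrtr_sqr ler_wsqrtr// lerDr sqr_ge0//.
Qed.

Lemma normc_leD z : normc z <= `|complex.Re z| + `|complex.Im z|.
Proof.
case: z => a b /=.
rewrite -[leRHS]ger0_norm ?addr_ge0// -sqrtr_sqr ler_wsqrtr//.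
by rewrite sqrrD !real_normK ?num_real// -addrA lerD2l lerDr mulrn_wge0// mulr_ge0.
Qed.

Lemma openC_measurable U : open U -> measurable U.
Proof. by move=> oU; exact: sub_sigma_algebra. Qed.

Lemma nbhsCP z U : nbhs z U <->
  exists2 r : R, 0 < r & forall w, normc (z - w) < r -> U w.
Proof.
split.
- move=> /nbhs_ballP[e /= e0 zeU].
  have eE : e = (complex.Re e)%:C.
    case: e e0 {zeU} => a b; rewrite ltcE /= => /andP[/eqP -> _] //.
  exists (complex.Re e).
    by move: e0; rewrite ltcE => /andP[].
  by move=> w zw; apply: zeU; rewrite /ball/= normcEC eE ltcR.
- move=> [r r0 H]; apply/nbhs_ballP; exists r%:C => /=; first by rewrite ltcR.
  by move=> w; rewrite /ball/= normcEC ltcR => /H.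
Qed.

Lemma continuous_measurableC d (T : measurableType d) (f : R[i] -> R) (g : T -> R[i]) :
  continuous f -> measurable_fun setT g -> measurable_fun setT (f \o g).
Proof.
move=> cf mg; apply: measurableT_comp => //.
apply: (measurability _ (RGenOInfty.measurableE R)) => _ [_ [a ->] <-].
rewrite setTI; apply: openC_measurable.
by apply: open_comp; [move=> x _; exact: cf|exact: interval_open].
Qed.

Lemma continuous_lipC (f : R[i] -> R) :
  (forall z w, `|f z - f w| <= normc (z - w)) -> continuous f.
Proof.
move=> H z; apply/(@cvgrPdist_lt _ _ _ _ (nbhs_filter z)) => e e0.
suff : nbhs z [set w | `|f z - f w| < e] by [].
by apply/nbhsCP; exists e => // w; exact: le_lt_trans.
Qed.

Lemma continuous_Re : continuous (@complex.Re R).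
Proof.
apply: continuous_lipC => z w; apply: le_trans (normc_Re _).
by case: z; case: w.
Qed.

Lemma continuous_Im : continuous (@complex.Im R).
Proof.
apply: continuous_lipC => z w; apply: le_trans (normc_Im _).
by case: z; case: w.
Qed.

Lemma continuous_normc : continuous (@normc R).
Proof.
apply: continuous_lipC => z w; rewrite -lecR.
have := ler_dist_dist z w; rewrite !normcEC.
rewrite -(rmorphB (real_complex R)) !lecR; congr (_ <= _).
by rewrite /= expr0n addr0 sqrtr_sqr.
Qed.

Definition cbox (q : rat * rat * nat) : set R[i] :=
  [set w | `|complex.Re w - ratr q.1.1| < q.2.+1%:R^-1 /\
           `|complex.Im w - ratr q.1.2| < q.2.+1%:R^-1].

Lemma open_bigcup_box U : open U ->
  U = \bigcup_q (if `[< cbox q `<=` U >] then cbox q else set0).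
Proof.
move=> oU; apply/seteqP; split; last first.
  by move=> z [q _]; case: asboolP => // + qz; exact.
move=> z Uz.
have /nbhsCP[r r0 rU] : nbhs z U by exact: open_nbhs_nbhs.
have r40 : 0 < r / 4 by rewrite divr_gt0.
have [n nr] : exists n, n.+1%:R^-1 < r / 4 :> R.
  exists (Num.truncn (4 / r)).
  by rewrite -[ltRHS]invrK ltf_pV2 ?posrE ?invr_gt0// invf_div truncnS_gt.
set e : R := n.+1%:R^-1 in nr.
have n0 : 0 < e by rewrite invr_gt0.
have rat_near (x : R) : exists q : rat, `|x - ratr q| < e.
  have /rat_in_itvoo[q] : x - e < x + e.
    by rewrite ltrD2l (lt_trans _ n0)// oppr_lt0.
  rewrite inE/= => /itvP qP; exists q.
  have q1 : x - e < ratr q by rewrite qP.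
  have q2 : ratr q < x + e by rewrite qP.
  by rewrite ltr_norml; apply/andP; split; lra.
have [a za] := rat_near (complex.Re z).
have [b zb] := rat_near (complex.Im z).
exists (a, b, n) => //; case: asboolP => // -[] w; rewrite /cbox/= -/e => -[wa wb]; apply: rU.
apply: (le_lt_trans (normc_leD _)).
case: z za zb {Uz} => z1 z2 /= za zb; case: w wa wb => w1 w2 /= wa wb.
move: za zb wa wb; rewrite !ltr_norml => /andP[? ?] /andP[? ?] /andP[? ?] /andP[? ?].
have : `|z1 - w1| < r / 2 by rewrite ltr_norml; apply/andP; split; lra.
have : `|z2 - w2| < r / 2 by rewrite ltr_norml; apply/andP; split; lra.
move: `|z1 - w1| `|z2 - w2| => x1 x2 h2 h1; lra.
Qed.

Lemma measurable_dist_lt d (T : measurableType d) (f : T -> R) (c e : R) :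
  measurable_fun setT f -> measurable [set t | `|f t - c| < e].
Proof.
move=> mf; rewrite -[X in measurable X]setTI.
have : measurable_fun setT (fun t => `|f t - c|).
  by apply: measurableT_comp => //; exact: measurable_funB.
move=> /(_ measurableT _ (measurable_itv `]-oo, e[)).
by rewrite set_itvE.
Qed.

Lemma measurable_cbox q : measurable (cbox q).
Proof.
apply: measurableI; apply: measurable_dist_lt.
- exact: (continuous_measurableC (@continuous_Re) (@measurable_id _ _ _)).
- exact: (continuous_measurableC (@continuous_Im) (@measurable_id _ _ _)).
Qed.

Lemma measurable_complexP d (T : measurableType d) (g : T -> R[i]) :
  measurable_fun setT g <->
  measurable_fun setT (@complex.Re R \o g) /\ measurable_fun setT (@complex.Im R \o g).
Proof.
split=> [mg|[mRe mIm]].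
  by split; apply: continuous_measurableC mg;
    [exact: continuous_Re|exact: continuous_Im].
apply: (@measurability _ _ _ _ _ _ (@open R[i])) => // _ [U oU <-].
rewrite setTI (open_bigcup_box oU) preimage_bigcup.
apply: countable_bigcupT_measurable => // q.
case: asboolP => _; last by rewrite preimage_set0.
exact: measurableI (measurable_dist_lt _ _ mRe) (measurable_dist_lt _ _ mIm).
Qed.

Lemma measurable_normcT d (T : measurableType d) (g : T -> R[i]) :
  measurable_fun setT g -> measurable_fun setT (@normc R \o g).
Proof. by apply: continuous_measurableC; exact: continuous_normc. Qed.

Lemma measurable_complexD d (T : measurableType d) (f g : T -> R[i]) :
  measurable_fun setT f -> measurable_fun setT g -> measurable_fun setT (f + g).
Proof.
move=> /measurable_complexP[f1 f2] /measurable_complexP[g1 g2].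
apply/measurable_complexP; split.
  rewrite [X in measurable_fun _ X](_ : _ = (@complex.Re R \o f) \+ (@complex.Re R \o g)).
    exact: measurable_funD.
  by apply/funext => t /=; rewrite fctE; case: (f t) (g t) => ? ? [? ?].
rewrite [X in measurable_fun _ X](_ : _ = (@complex.Im R \o f) \+ (@complex.Im R \o g)).
  exact: measurable_funD.
by apply/funext => t /=; rewrite fctE; case: (f t) (g t) => ? ? [? ?].
Qed.

Lemma measurable_complexM d (T : measurableType d) (f g : T -> R[i]) :
  measurable_fun setT f -> measurable_fun setT g ->
  measurable_fun setT (fun t => f t * g t).
Proof.
move=> /measurable_complexP[f1 f2] /measurable_complexP[g1 g2].
apply/measurable_complexP; split.
  rewrite [X in measurable_fun _ X](_ : _ =
      ((@complex.Re R \o f) \* (@complex.Re R \o g)) \- ((@complex.Im R \o f) \* (@complex.Im R \o g))).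
    by apply: measurable_funB; exact: measurable_funM.
  by apply/funext => t /=; case: (f t) (g t) => ? ? [? ?].
rewrite [X in measurable_fun _ X](_ : _ =
    ((@complex.Re R \o f) \* (@complex.Im R \o g)) \+ ((@complex.Im R \o f) \* (@complex.Re R \o g))).
  by apply: measurable_funD; exact: measurable_funM.
by apply/funext => t /=; case: (f t) (g t) => ? ? [? ?].
Qed.

End complex_borel.

Section complex_Lfun.
Context d (T : measurableType d) (R : realType).
Variables (mu : {measure set T -> \bar R}) (p : R).
Implicit Types f g : T -> R[i].

Definition LnormC f : \bar R := 'N[mu]_p%:E [EFin \o @normc R \o f].

Definition LfunC : {pred T -> R[i]} :=
  fun f => `[< measurable_fun setT f /\ (LnormC f < +oo)%E >].

Lemma LfunCP f : reflect (measurable_fun setT f /\ (LnormC f < +oo)%E)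
  (f \in LfunC).
Proof. exact: asboolP. Qed.

Lemma LnormC_ge0 f : (0 <= LnormC f)%E.
Proof. exact: Lnorm_ge0. Qed.

Lemma LnormC_fin f : f \in LfunC -> LnormC f \is a fin_num.
Proof. by move=> /LfunCP[_ h]; rewrite ge0_fin_numE// LnormC_ge0. Qed.

Lemma LnormC_ae_eq f g : measurable_fun setT f -> measurable_fun setT g ->
  {ae mu, forall x, f x = g x} -> LnormC f = LnormC g.
Proof.
move=> mf mg fg; rewrite /LnormC unlock; congr (_ `^ _)%E.
have mn (h : T -> R[i]) : measurable_fun setT h ->
    measurable_fun setT (fun x => (`|(EFin \o @normc R \o h) x| `^ p)%E).
  move=> mh; apply: (measurableT_comp (measurable_poweR p)).
  apply: measurableT_comp => //; apply/measurable_EFinP.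
  exact: measurable_normcT.
apply: ae_eq_integral => //; [exact: mn|exact: mn|].
by apply: filterS fg => x /= ->.
Qed.

Hypothesis p1 : 1 <= p.

Lemma LnormC0 : LnormC 0 = 0%E.
Proof.
rewrite /LnormC (_ : _ \o 0 = cst 0%E); last first.
  by apply/funext => x /=; rewrite expr0n addr0 sqrtr0.
by rewrite Lnorm0// eqe gt_eqF// (lt_le_trans _ p1).
Qed.

Lemma Lnorm_ae_le (g h : T -> R) :
  measurable_fun setT g -> measurable_fun setT h ->
  {ae mu, forall x, `|g x| <= `|h x|} ->
  ('N[mu]_p%:E [EFin \o g] <= 'N[mu]_p%:E [EFin \o h])%E.
Proof.
move=> mg mh gh; have p0 : 0 < p by exact: lt_le_trans p1.
have mp (k : T -> R) : measurable_fun setT k ->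
    measurable_fun setT (fun x => (`|(EFin \o k) x| `^ p)%E).
  move=> mk; apply: (measurableT_comp (measurable_poweR p)).
  by apply: measurableT_comp => //; exact/measurable_EFinP.
rewrite unlock gt0_ler_poweR ?invr_ge0 ?(ltW p0)//.
- by rewrite in_itv/= leey andbT integral_ge0// => x _; exact: poweR_ge0.
- by rewrite in_itv/= leey andbT integral_ge0// => x _; exact: poweR_ge0.
apply: ae_ge0_le_integral => //.
all: try by move=> ? _; exact: poweR_ge0.
- exact: (mp _ mg).
- exact: (mp _ mh).
apply: filterS gh => x gh _ /=.
by rewrite lee_fin ge0_ler_powR ?(ltW p0) ?nnegrE ?normr_ge0.
Qed.

Lemma LnormC_ae_le f g : measurable_fun setT f -> measurable_fun setT g ->
  {ae mu, forall x, normc (f x) <= normc (g x)} -> (LnormC f <= LnormC g)%E.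
Proof.
move=> mf mg fg; apply: Lnorm_ae_le; [exact: measurable_normcT..|].
by apply: filterS fg => x; rewrite !ger0_norm ?normc_ge0.
Qed.

Lemma LnormCD f g : measurable_fun setT f -> measurable_fun setT g ->
  (LnormC (f + g)%R <= LnormC f + LnormC g)%E.
Proof.
move=> mf mg.
have mnf := measurable_normcT mf; have mng := measurable_normcT mg.
have mnfg := measurable_normcT (measurable_complexD mf mg).
apply: le_trans (eminkowski mu mnf mng _); last by rewrite lee_fin.
apply: Lnorm_ae_le => //; first exact: measurable_funD.
apply: aeW => x /=.
rewrite ger0_norm ?normc_ge0// ger0_norm ?addr_ge0 ?normc_ge0//.
exact: le_normcD.
Qed.

Lemma LnormCZ (a : R[i]) f : f \in LfunC ->
  LnormC (a *: f) = ((normc a)%:E * LnormC f)%E.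
Proof.
move=> /LfunCP[mf ff].
have fL : @normc R \o f \in Lfun mu p%:E.
  by apply/andP; rewrite !inE; split => //; exact: measurable_normcT.
have p1e : (1 <= p%:E)%E by rewrite lee_fin.
have := LnormZ (Lfun_Sub p1e fL) (normc a).
rewrite ger0_norm ?normc_ge0// => <-; rewrite /LnormC; apply: eq_Lnorm => x /=.
by rewrite fctE normcM.
Qed.

Lemma LfunC_submod_closed : submod_closed LfunC.
Proof.
split; first by apply/LfunCP; rewrite LnormC0; split => //; exact: measurable_cst.
move=> a f g fL gL; have [mf ff] := LfunCP _ fL; have [mg fg] := LfunCP _ gL.
have maf : measurable_fun setT (a *: f).
  by apply: (measurable_complexM (f := cst a)).
apply/LfunCP; split; first exact: measurable_complexD.
apply: (le_lt_trans (LnormCD maf mg)).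
rewrite lte_add_pinfty// LnormCZ// lte_mul_pinfty ?lee_fin ?normc_ge0//.
Qed.

End complex_Lfun.

Section complex_LfunType.
Context d (T : measurableType d) (R : realType).
Variables (mu : {measure set T -> \bar R}) (p : R) (p1 : 1 <= p).

(* The proof p1 is a phantom argument: it lets canonical structure inference
   find the submodule structure, which needs Minkowski's inequality. *)
Definition LfunC_of (_ : 1 <= p) : {pred T -> R[i]} := LfunC mu p.

HB.instance Definition _ :=
  GRing.isSubmodClosed.Build _ _ (LfunC_of p1) (LfunC_submod_closed mu p1).

Record LfunCType := MkLfunC { LfunC_val :> T -> R[i]; _ : LfunC_val \in LfunC_of p1 }.

HB.instance Definition _ := [isSub for LfunC_val].
HB.instance Definition _ := gen_eqMixin LfunCType.
HB.instance Definition _ := [Choice of LfunCType by <:].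
HB.instance Definition _ := [SubChoice_isSubLmodule of LfunCType by <:].

End complex_LfunType.

Section LpC.
Context d (T : measurableType d) (R : realType).
Variables (mu : {measure set T -> \bar R}) (p : R) (p1 : 1 <= p).
Local Notation Lfun := (LfunCType mu p1).
Implicit Types (f g : Lfun) (a : R[i]).

Lemma LfunCDE f g x : (f + g) x = f x + g x. Proof. by []. Qed.

Lemma LfunCBE f g x : (f - g) x = f x - g x. Proof. by []. Qed.

Lemma LfunCZE a f x : (a *: f) x = a * f x. Proof. by []. Qed.

Lemma LfunC_measurable f : measurable_fun setT f.
Proof. by case: f => /= f /LfunCP[]. Qed.

Lemma LfunC_finite f : LnormC mu p f \is a fin_num.
Proof. by case: f => /= f; exact: LnormC_fin. Qed.

Definition ae_null : {pred Lfun} := fun f => `[< {ae mu, forall x, f x = 0} >].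

Lemma ae_nullP f : reflect {ae mu, forall x, f x = 0} (f \in ae_null).
Proof. exact: asboolP. Qed.

Lemma ae_null_zmod_closed : zmod_closed ae_null.
Proof.
split; first by apply/ae_nullP; exact: aeW.
move=> f g /ae_nullP f0 /ae_nullP g0; apply/ae_nullP.
by apply: filterS2 f0 g0 => x fx gx; rewrite LfunCBE fx gx subrr.
Qed.

HB.instance Definition _ := GRing.isZmodClosed.Build Lfun ae_null ae_null_zmod_closed.

(* The complex L^p(mu): classes of p-integrable functions T -> R[i] modulo
   mu-a.e. equality, with an R[i]-valued norm (as in normedModType R[i]). *)
Definition LpC : Type := {ideal_quot ae_null}.

HB.instance Definition _ := Choice.on LpC.
HB.instance Definition _ := EqQuotient.on LpC.
HB.instance Definition _ := GRing.Zmodule.on LpC.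

Local Open Scope quotient_scope.

Definition LpC_fun (x : LpC) : T -> R[i] := repr x.
Coercion LpC_fun : LpC >-> Funclass.

Lemma piLpC_eq f g : \pi_LpC f = \pi_LpC g <-> {ae mu, forall x, f x = g x}.
Proof.
have -> : (\pi_LpC f = \pi_LpC g) <-> f - g \in ae_null.
  by rewrite Quotient.idealrBE; split => [->//|/eqP].
split=> [/ae_nullP h|h]; last apply/ae_nullP; apply: filterS h => x.
  by rewrite LfunCBE => /eqP; rewrite subr_eq0 => /eqP.
by rewrite LfunCBE => ->; rewrite subrr.
Qed.

Lemma piLpC_ae f : {ae mu, forall x, (\pi_LpC f : LpC) x = f x}.
Proof. by apply/piLpC_eq; rewrite reprK. Qed.

Lemma piLpCD f g : \pi_LpC (f + g) = \pi_LpC f + \pi_LpC g.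
Proof. exact: pi_addr. Qed.

Definition LpC_scale a (x : LpC) : LpC := \pi_LpC (a *: repr x).

Lemma piLpCZ a f : \pi_LpC (a *: f) = LpC_scale a (\pi_LpC f).
Proof.
apply/piLpC_eq; apply: filterS (piLpC_ae f) => x fx.
by rewrite !LfunCZE -fx.
Qed.

Lemma LpC_scaleA a b x : LpC_scale a (LpC_scale b x) = LpC_scale (a * b) x.
Proof.
rewrite -[x]reprK; move: (repr x) => f.
by rewrite -(piLpCZ b f) -(piLpCZ a (b *: f)) -(piLpCZ (a * b) f) scalerA.
Qed.

Lemma LpC_scale1 : left_id 1 LpC_scale.
Proof.
move=> x; rewrite -[x]reprK; move: (repr x) => f.
by rewrite -(piLpCZ 1 f) scale1r.
Qed.

Lemma LpC_scaleDr : right_distributive LpC_scale +%R.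
Proof.
move=> a x y; rewrite -[x]reprK -[y]reprK; move: (repr x) (repr y) => f g.
rewrite -(piLpCD f g) -(piLpCZ a f) -(piLpCZ a g) -(piLpCZ a (f + g)).
by rewrite scalerDr piLpCD.
Qed.

Lemma LpC_scaleDl x : {morph LpC_scale^~ x : a b / a + b}.
Proof.
move=> a b; rewrite -[x]reprK; move: (repr x) => f.
by rewrite -(piLpCZ a f) -(piLpCZ b f) -(piLpCZ (a + b) f) scalerDl piLpCD.
Qed.

HB.instance Definition _ := GRing.Zmodule_isLmodule.Build R[i] LpC
  LpC_scaleA LpC_scale1 LpC_scaleDr LpC_scaleDl.

Definition LpC_norm (x : LpC) : R[i] := (fine (LnormC mu p x))%:C.

Lemma LpC_norm_pi f : LpC_norm (\pi_LpC f) = (fine (LnormC mu p f))%:C.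
Proof.
congr (fine _)%:C; apply: LnormC_ae_eq; [exact: LfunC_measurable..|].
exact: piLpC_ae.
Qed.

Lemma LpC_ler_normD x y : LpC_norm (x + y) <= LpC_norm x + LpC_norm y.
Proof.
rewrite -[x]reprK -[y]reprK; move: (repr x) (repr y) => f g.
rewrite -piLpCD !LpC_norm_pi -(rmorphD (real_complex R)) lecR.
rewrite -lee_fin EFinD !fineK ?LfunC_finite//.
exact: (LnormCD _ p1 (LfunC_measurable _) (LfunC_measurable _)).
Qed.

Lemma LpC_normrZ a x : LpC_norm (a *: x) = `|a| * LpC_norm x.
Proof.
rewrite -[x]reprK; move: (repr x) => f.
rewrite -[_ *: _]/(LpC_scale _ _) -(piLpCZ a f) !LpC_norm_pi normcEC.
rewrite -(rmorphM (real_complex R)); congr (_ %:C).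
rewrite [X in fine X](LnormCZ p1)//; last by case: f.
by rewrite fineM// LfunC_finite.
Qed.

Lemma LpC_normr0_eq0 x : LpC_norm x = 0 -> x = 0.
Proof.
rewrite -[x]reprK; move: (repr x) => f; rewrite LpC_norm_pi.
move=> /complexI/eqP; rewrite fine_eq0 ?LfunC_finite// => /eqP h.
have -> : 0 = \pi_LpC 0 by symmetry; exact: pi_zeror.
apply/piLpC_eq.
have m : measurable_fun setT (EFin \o (@normc R \o f)).
  by apply/measurable_EFinP; exact/measurable_normcT/LfunC_measurable.
have p0 : (0 < p%:E)%E by rewrite lte_fin (lt_le_trans _ p1).
apply: filterS (Lnorm_eq0_eq0 m p0 h) => z /(_ I)[/eq0_normc ->].
by [].
Qed.

HB.instance Definition _ := Lmodule_isNormed.Build R[i] LpC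
  LpC_ler_normD LpC_normrZ LpC_normr0_eq0.

End LpC.

Section bounded_operators.
Context (R : realType) (X : normedModType R[i]).
Implicit Types (T : X -> X) (u : nat -> X) (N : option nat).

Definition compact_operator T := precompact (T @` [set x | `|x| <= 1]).

(* A genuine supremum for bounded T; sup of an unbounded set is 0. *)
Definition opnorm T : R := sup [set complex.Re `|T x| | x in [set x | `|x| <= 1]].

(* A possibly finite sequence is a pair of N : option nat and u : nat -> X:
   Some k stands for u 0, ..., u (k - 1) and None for the whole of u. *)
Definition in_range N (n : nat) : bool := if N is Some k then (n < k)%N else true.

Definition schauder_basis N u : Prop :=
  if N is Some k then
    forall x : X, exists! a : {ffun 'I_k -> R[i]}, x = \sum_(n < k) a n *: u n
  else
    forall x : X, exists! a : nat -> R[i],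
      [series a n *: u n]_n @ \oo --> x.

Definition unconditional_basis (C : R) N u : Prop :=
  schauder_basis N u /\
  forall m : nat, (forall n, (n < m)%N -> in_range N n) ->
  forall a : nat -> R[i],
    (C^-1)%:C * `|\sum_(n < m) `|a n| *: u n| <= `|\sum_(n < m) a n *: u n| /\
    `|\sum_(n < m) a n *: u n| <= C%:C * `|\sum_(n < m) `|a n| *: u n|.

Definition diagonal_operator N u T : Prop :=
  forall n, in_range N n -> exists lambda : R[i], T (u n) = lambda *: u n.

End bounded_operators.

Section multiplication_operator.
Context (R : realType).
Variables (mu : {measure set R[i] -> \bar R}) (p : R) (p1 : 1 <= p).

Definition msupport : set R[i] :=
  [set z | forall U : set R[i], open U -> U z -> (0 < mu U)%E].

Lemma msupport_ae : {ae mu, forall z, msupport z}.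
Proof.
pose F (n : nat) : set R[i] :=
  if unpickle n is Some q then if mu (cbox q) == 0 then cbox q else set0
  else set0.
have F0 n : mu.-negligible (F n).
  rewrite /F; case: unpickle => [q|]; last exact: negligible_set0.
  case: eqP => [q0|_]; last exact: negligible_set0.
  by exists (cbox q); split => //; exact: measurable_cbox.
apply: negligibleS (negligible_bigcup F0) => z /existsNP[U /not_implyP[oU]].
move=> /not_implyP[Uz /negP]; rewrite lt0e measure_ge0 andbT negbK => /eqP U0.
move: Uz; rewrite [X in X z](open_bigcup_box oU) => -[q _].
case: asboolP => // qU qz.
have [n nq] : exists n, unpickle n = Some q by exists (pickle q); exact: pickleK.
exists n => //; rewrite /F nq ifT//.
rewrite eq_le measure_ge0 andbT -U0 le_measure ?inE//.
- exact: measurable_cbox.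
- exact: openC_measurable.
Qed.

Local Open Scope quotient_scope.

(* insubd falls back to 0 when z * f z is not in L^p, which does not happen
   for compactly supported mu, see mulop_ae. *)
Definition mulop (f : LpC mu p1) : LpC mu p1 :=
  \pi_(LpC mu p1) (insubd (0 : LfunCType mu p1) (fun z => z * f z)).

Lemma mulop_ae (f : LpC mu p1) : compact msupport ->
  {ae mu, forall z, mulop f z = z * f z}.
Proof.
move=> cS.
have [r r0 rb] : exists2 r : R, 0 < r & forall z, msupport z -> normc z <= r.
  have cn : {within msupport, continuous (@normc R)}.
    by apply: continuous_subspaceT; exact: continuous_normc.
  have [M [_ Mb]] := compact_bounded (continuous_compact cn cS).
  exists (`|M| + 1) => [|z Sz]; first by rewrite ltr_wpDl.
  rewrite -[leLHS]ger0_norm ?normc_ge0//.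
  apply: (Mb (`|M| + 1)); last by exists z.
  by rewrite ltr_pwDr// ler_norm.
have mf : measurable_fun setT f by exact: LfunC_measurable.
have mzf : measurable_fun [set: R[i]] (fun z : R[i] => z * f z).
  exact: measurable_complexM.
suff zfL : (fun z : R[i] => z * f z) \in LfunC_of mu p1.
  pose g : LfunCType mu p1 := insubd 0 (fun z : R[i] => z * f z).
  have gE : g = (fun z => z * f z) :> (R[i] -> R[i]).
    by rewrite -[LHS]/(val g) val_insubd zfL.
  by apply: filterS (piLpC_ae g) => z; rewrite gE.
have fL : (f : R[i] -> R[i]) \in LfunC mu p by rewrite /LpC_fun; case: (repr f).
apply/LfunCP; split => //.
have mrf : measurable_fun setT (r%:C *: (f : R[i] -> R[i])).
  by apply: (measurable_complexM (f := cst r%:C)).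
have /le_lt_trans : (LnormC mu p (fun z : R[i] => z * f z)%R
    <= LnormC mu p (r%:C *: (f : R[i] -> R[i]))%R)%E.
  apply: LnormC_ae_le => //; apply: filterS msupport_ae => z /rb zr.
  rewrite fctE !normcM ler_wpM2r ?normc_ge0//.
  by rewrite (le_trans zr)//= expr0n addr0 sqrtr_sqr ler_norm.
apply; rewrite (LnormCZ p1)// lte_mul_pinfty ?lee_fin ?normc_ge0//.
by case/LfunCP : fL.
Qed.

End multiplication_operator.

(* Main.v *)
(** The square containing the support of mu is halved repeatedly, alternately in
    each coordinate, giving a binary tree of cells whose diameters at depth k
    are of order 2^(-k/2).  The basis consists of the indicators of the cells of
    a large depth k0 followed by the Haar functions of the cells of depth at
    least k0, with the zero vectors of both kinds dropped.  Its sums are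
    dyadic martingales, so sign changes are martingale transforms, which are
    bounded on L^p by a constant depending only on p: Burkholder's function is
    separately convex in x + y and x - y, where a transform step moves only one
    of the two.  Convexity and splitting into real and imaginary parts extend
    this to complex multipliers of modulus at most 1.

    D multiplies each basis vector by a point of its cell.  On the difference
    of two consecutive conditional expectations, M - D acts as a multiplication
    of size at most the cell diameter.  So K = M - D is the sum over the depths
    of finite-rank operators whose norms are bounded by a constant times the
    diameter at that depth; it is compact, and small when k0 is large. *)

Require Import Defs.
From HB Require Import structures.
From mathcomp Require Import all_boot all_order all_algebra.
From mathcomp Require Import complex finmap.
From mathcomp Require Import lra ring zify.
From mathcomp Require Import all_classical all_reals all_analysis.
From mathcomp Require Import measurable_realfun.

Set Implicit Arguments.
Unset Strict Implicit.
Unset Printing Implicit Defensive.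

Import Order.TTheory GRing.Theory Num.Theory.
Import numFieldNormedType.Exports.
Import ComplexField.Normc.

Local Open Scope classical_set_scope.
Local Open Scope ring_scope.
Local Open Scope complex_scope.

(** * Burkholder's inequality for dyadic martingale transforms *)

Section mean_value.
Context {R : realType}.

(** Replacing z by a function constant on small cells already makes M - D small, but that difference
    is again a multiplication operator and in general not compact. Letting the eigenvalue follow the
    scale of the basis vector repairs this: on the Haar functions of depth k the defect has the size
    of the cells of depth k, and these sizes decrease geometrically. The tail from k0 on gives
    smallness, the finite rank of each level gives compactness. The basis constant must then not
    deteriorate as k0 grows. Since k0 only determines the number of roots of a forest, it suffices
    to have the transform inequality for weights on an arbitrary number of roots. Halving one
    coordinate at a time keeps the tree binary: each node then carries one Haar function, and a
    multiplier indexed by the basis is a predictable transform. Losses outside the basis constant,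
    such as the factor 2 in the bound for conditional expectations, are absorbed by the choice of
    k0. *)

Lemma derive_ge0_homo (F F' : R -> R) (l : R) :
  (forall x, l <= x -> is_derive x 1 F (F' x)) -> (forall x, l <= x -> 0 <= F' x) ->
  forall a b, l <= a -> a <= b -> F a <= F b.
Proof.
move=> dF F0 a b la; rewrite le_eqVlt => /predU1P[->//|ab].
have [c] : exists2 c, c \in `]a, b[%R & F b - F a = F' c * (b - a).
  apply: MVT => // [x|]; first by rewrite in_itv => /andP[/ltW/(le_trans la)/dF].
  apply: derivable_within_continuous => x; rewrite in_itv => /andP[/(le_trans la)/dF dx _].
  exact: ex_derive.
rewrite in_itv => /andP[/ltW/(le_trans la)/F0 h _] e.
by rewrite -subr_ge0 e mulr_ge0 // subr_ge0 ltW.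
Qed.

(** By the mean value theorem a nondecreasing derivative supplies supporting lines. Convexity is
    kept in this form because it can be glued across branches ([subgrad_glue]) and integrates to
    Jensen's inequality. *)
Lemma derive_homo_subgrad (F F' : R -> R) (l : R) :
  (forall x, l <= x -> is_derive x 1 F (F' x)) ->
  (forall x y, l <= x -> x <= y -> F' x <= F' y) ->
  forall a b, l <= a -> l <= b -> F a + F' a * (b - a) <= F b.
Proof.
move=> dF homo a b la lb.
have mvt x y : l <= x -> x < y ->
    exists2 c, x <= c <= y & F y - F x = F' c * (y - x).
  move=> lx xy; have [c] : exists2 c, c \in `]x, y[%R & F y - F x = F' c * (y - x).
    apply: MVT => // [z|]; first by rewrite in_itv => /andP[/ltW/(le_trans lx)/dF].
    apply: derivable_within_continuous => z; rewrite in_itv => /andP[/(le_trans lx)/dF dx _].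
    exact: ex_derive.
  by rewrite in_itv => /andP[/ltW xc /ltW cy]; exists c => //; rewrite xc cy.
case: (ltgtP a b) => [ab|ba|->]; last by rewrite subrr mulr0 addr0.
- have [c /andP[ac _] e] := mvt _ _ la ab.
  have := homo _ _ la ac; nra.
- have [c /andP[bc ca] e] := mvt _ _ lb ba.
  have := homo _ _ (le_trans lb bc) ca; nra.
Qed.

(** Points on opposite sides of [j] are compared through [j]: the two support inequalities add up
    because the slope is at most [g j] on the left and at least [g j] on the right. *)
Lemma subgrad_glue (D : R -> Prop) (f g : R -> R) (j : R) : D j ->
  (forall a b, D a -> D b -> a <= j -> b <= j -> f a + g a * (b - a) <= f b) ->
  (forall a b, D a -> D b -> j <= a -> j <= b -> f a + g a * (b - a) <= f b) ->
  (forall a, D a -> a <= j -> g a <= g j) ->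
  (forall a, D a -> j <= a -> g j <= g a) ->
  forall a b, D a -> D b -> f a + g a * (b - a) <= f b.
Proof.
move=> Dj L Rt gl gr a b Da Db.
case: (leP a j) => [aj|/ltW ja]; case: (leP b j) => [bj|/ltW jb].
- exact: L.
- have := L _ _ Da Dj aj (lexx _); have := Rt _ _ Dj Db (lexx _) jb.
  by have := gl _ Da aj; nra.
- have := L _ _ Dj Db (lexx _) bj; have := Rt _ _ Da Dj ja (lexx _).
  by have := gr _ Da ja; nra.
- exact: Rt.
Qed.

End mean_value.

(** * Burkholder's function: convexity and majorant *)

Section burkholder_function.
Context {R : realType} (p : R).
Hypothesis p1 : 1 < p.

(** Convexity of [burk] in each variable rests on |p - 2| <= A, the majorant on A < p; the
    inequality 2 - p < p is exactly p > 1. *)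
Definition burkA : R := Num.max (p - 1) (2 - p).
Local Notation A := burkA.

(* Burkholder's function, up to a constant and the sign, in the variables
   s = x + y and t = x - y, for which max |s| |t| = |x| + |y|. *)
Definition burk (s t : R) : R :=
  let M := Num.max `|s| `|t| in M `^ (p - 2) * (A * M ^+ 2 + p * s * t).

Lemma burkA_bounds : [/\ 0 < A, A < p, p - 1 <= A & 2 - p <= A].
Proof.
have := p1 => p1'; rewrite /A; case: (leP (p - 1) (2 - p)) => h; split; lra.
Qed.

Lemma burkC s t : burk s t = burk t s.
Proof. by rewrite /burk maxC; congr (_ * (_ + _)); ring. Qed.

Lemma burkN s t : burk (- s) (- t) = burk s t.
Proof. by rewrite /burk !normrN; congr (_ * (_ + _)); ring. Qed.

Lemma powRB_mul (t q : R) : 0 < t -> t `^ q = t `^ (q - 1) * t.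
Proof.
move=> t0; rewrite -{3}[t]powRr1 ?ltW// -powRD ?subrK//.
by apply/implyP => _; rewrite gt_eqF.
Qed.

(** Tangent line inequality of the convex function t^p, serving both [burk] at s = 0 and Jensen's
    inequality. The point b = 0 is treated apart, derivatives being taken at positive points
    only. *)
Lemma powR_subgrad (a b : R) : 0 < a -> 0 <= b ->
  a `^ p + p * a `^ (p - 1) * (b - a) <= b `^ p.
Proof.
have pgt1 := p1; have p0 : 0 < p by exact: lt_trans p1.
move=> a_gt0; rewrite le_eqVlt => /predU1P[<-|b_gt0].
  rewrite powR0 ?gt_eqF// (powRB_mul p a_gt0); have := powR_gt0 (p - 1) a_gt0.
  move=> w0; have : 0 <= (p - 1) * (a `^ (p - 1) * a) by rewrite !mulr_ge0//; lra.
  by nra.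
apply: (@derive_homo_subgrad R (fun t => t `^ p) (fun t => p * t `^ (p - 1)) (Num.min a b)).
- by move=> x mx; apply: is_derive1_powR; apply: lt_le_trans mx; rewrite lt_min a_gt0.
- move=> x y mx xy; rewrite ler_pM2l// ge0_ler_powR// ?subr_ge0 ?(ltW p1)// nnegrE.
    by apply: le_trans mx; rewrite le_min !ltW.
  by apply: le_trans xy; apply: le_trans mx; rewrite le_min !ltW.
- by rewrite ge_min lexx.
- by rewrite ge_min lexx orbT.
Qed.

(** The two outer branches of [burk s] for s > 0: c = p on t >= s and, after the reflection of t, c
    = - p on t <= - s. *)
Let F (c s t : R) := A * t `^ p + c * s * t `^ (p - 1).
Let F' (c s t : R) := p * A * t `^ (p - 1) + (p - 1) * c * s * t `^ (p - 2).

Let is_derive_F (c s t : R) : 0 < t -> is_derive t 1 (F c s) (F' c s t).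
Proof.
move=> t0; rewrite /F.
have d1 := is_derive1_powR p t0; have d2 := is_derive1_powR (p - 1) t0.
apply: is_derive_eq (is_deriveD (is_deriveZ A d1) (is_deriveZ (c * s) d2)) _.
by rewrite /F' /GRing.scale/= (_ : p - 1 - 1 = p - 2); ring.
Qed.

(** The second derivative is (p - 1) t^(p-3) (p A t + (p - 2) c s), and |(p - 2) c s| <= p A t for t
    >= s because |p - 2| <= A. *)
Let F'_homo (c s : R) : 0 < s -> `|c| = p ->
  forall t u, s <= t -> t <= u -> F' c s t <= F' c s u.
Proof.
move=> s0 cp; apply: (@derive_ge0_homo R _
  (fun t => (p - 1) * t `^ (p - 3) * (p * A * t + (p - 2) * c * s))) => t st.
- have t0 : 0 < t by exact: lt_le_trans st.
  have d1 := is_derive1_powR (p - 1) t0; have d2 := is_derive1_powR (p - 2) t0.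
  rewrite /F'.
  apply: is_derive_eq (is_deriveD (is_deriveZ (p * A) d1) (is_deriveZ ((p - 1) * c * s) d2)) _.
  rewrite /GRing.scale/= (_ : p - 2 - 1 = p - 3); last by ring.
  rewrite (powRB_mul (p - 1 - 1) t0) (_ : p - 1 - 1 - 1 = p - 3); last by ring.
  by ring.
- have [A0 Ap A1 A2] := burkA_bounds.
  rewrite mulr_ge0 ?mulr_ge0 ?powR_ge0 ?subr_ge0 ?(ltW p1)//.
  have h : `|(p - 2) * c * s| <= p * A * t.
    rewrite !normrM cp (gtr0_norm s0) -mulrA mulrCA -mulrA.
    apply: ler_pM => //; rewrite ?mulr_ge0 ?(ltW s0)//; first by rewrite (le_trans _ (ltW p1)).
    apply: ler_pM => //; rewrite ?(ltW s0)// ler_norml; apply/andP; split; lra.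
  by have := le_trans (ler_norm (- ((p - 2) * c * s))) ; rewrite normrN => /(_ _ h); lra.
Qed.

Let F_subgrad (c s : R) : 0 < s -> `|c| = p ->
  forall a b, s <= a -> s <= b -> F c s a + F' c s a * (b - a) <= F c s b.
Proof.
move=> s0 cp; apply: derive_homo_subgrad.
- by move=> x sx; apply: is_derive_F; exact: lt_le_trans sx.
- exact: F'_homo.
Qed.

Let burkF (s t : R) : 0 < s -> s <= t -> burk s t = F p s t.
Proof.
move=> s0 st; have t0 : 0 < t by exact: lt_le_trans st.
rewrite /burk !gtr0_norm// (max_idPr st) /F (powRB_mul p t0) (powRB_mul (p - 1) t0).
by rewrite (_ : p - 1 - 1 = p - 2); ring.
Qed.

Let burkFN (s t : R) : 0 < s -> s <= t -> burk s (- t) = F (- p) s t.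
Proof.
move=> s0 st; have t0 : 0 < t by exact: lt_le_trans st.
rewrite /burk normrN !gtr0_norm// (max_idPr st) /F (powRB_mul p t0) (powRB_mul (p - 1) t0).
by rewrite (_ : p - 1 - 1 = p - 2); ring.
Qed.

Let burk_mid (s t : R) : 0 < s -> `|t| <= s -> burk s t = A * s `^ p + p * s `^ (p - 1) * t.
Proof.
move=> s0 ts; rewrite /burk gtr0_norm// (max_idPl ts).
rewrite (powRB_mul p s0) (powRB_mul (p - 1) s0).
by rewrite (_ : p - 1 - 1 = p - 2); ring.
Qed.

(** For s > 0 the function is affine on [-s, s] and follows a branch [F] on either side. At the two
    junctions the slope must not drop: at s this amounts to A >= 2 - p, at -s to A >= p - 2. *)
Lemma burk_subgrad_gt0 s : 0 < s ->
  exists g : R -> R, forall a b, burk s a + g a * (b - a) <= burk s b.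
Proof.
move=> s0; have [A0 Ap A1 A2] := burkA_bounds.
have p0 : 0 < p by lra.
have np : `|- p| = p by rewrite normrN gtr0_norm.
have pp : `|p| = p by rewrite gtr0_norm.
pose gm := p * s `^ (p - 1).
pose g t := if t < - s then - F' (- p) s (- t) else if t <= s then gm else F' p s t.
have Fs c : F' c s s = s `^ (p - 1) * (p * A + (p - 1) * c).
  rewrite /F' (powRB_mul (p - 1) s0) (_ : p - 1 - 1 = p - 2); ring.
have sp : 0 < s `^ (p - 1) by exact: powR_gt0.
have gms : gm <= F' p s s.
  by rewrite Fs /gm mulrC ler_wpM2l ?(ltW sp)//; nra.
have gmNs : - F' (- p) s s <= gm.
  have : 0 <= s `^ (p - 1) * (p * (A - (p - 1)) + p) by apply: mulr_ge0; nra.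
  rewrite Fs /gm; nra.
have g_mid t : - s <= t -> t <= s -> g t = gm.
  by move=> h1 h2; rewrite /g ltNge h1/= h2.
have g_pos t : s < t -> g t = F' p s t.
  move=> h1; rewrite /g ltNge (_ : - s <= t)/=; last lra.
  by rewrite leNgt h1.
have gs : g s = gm by apply: g_mid; lra.
have gNs : g (- s) = gm by apply: g_mid; lra.
exists g => a b.
apply: (@subgrad_glue R (fun=> True) _ _ (- s)) => // {a b}.
- move=> a b _ _ aS bS.
  have [eb ea] : burk s b = F (- p) s (- b) /\ burk s a = F (- p) s (- a).
    by split; rewrite -burkFN ?opprK//; lra.
  have h1 : s <= - a by lra.
  have h2 : s <= - b by lra.
  have H := F_subgrad s0 np h1 h2.
  rewrite eb ea; apply: le_trans H; rewrite lerD2l.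
  have -> : - b - - a = - (b - a) by ring.
  rewrite mulrN -mulNr.
  have [aE|aN] : a = - s \/ a < - s by move: aS; rewrite le_eqVlt => /predU1P; tauto.
    subst a; rewrite gNs opprK; have : b - - s <= 0 by lra.
    by nra.
  by rewrite /g aN.
- have H : forall a b, - s <= a -> - s <= b -> burk s a + g a * (b - a) <= burk s b.
    2: by move=> a b _ _; exact: H.
  apply: (@subgrad_glue R (fun a => - s <= a) _ _ s).
  + lra.
  + move=> a b ha hb hsa hsb; rewrite !burk_mid ?ler_norml ?ha ?hb ?hsa ?hsb//.
    by rewrite g_mid// /gm; nra.
  + move=> a b _ _ sa sb; rewrite !burkF//.
    apply: le_trans (F_subgrad s0 pp sa sb); rewrite lerD2l.
    have [aE|aN] : s = a \/ s < a by move: sa; rewrite le_eqVlt => /predU1P; tauto.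
      by subst a; rewrite gs; nra.
    by rewrite g_pos.
  + by move=> a ha hs; rewrite gs g_mid.
  + move=> a _ sa; rewrite gs.
    have [aE|aN] : s = a \/ s < a by move: sa; rewrite le_eqVlt => /predU1P; tauto.
      by subst a; rewrite gs.
    rewrite g_pos//; apply: le_trans gms _; exact: (F'_homo s0 pp).
- move=> a _ aS; rewrite gNs.
  have [aE|aN] : a = - s \/ a < - s by move: aS; rewrite le_eqVlt => /predU1P; tauto.
    by subst a; rewrite gNs.
  rewrite /g aN; apply: le_trans gmNs; rewrite lerN2.
  by apply: (F'_homo s0 np) => //; lra.
- move=> a _ sa; rewrite gNs.
  case: (leP a s) => h; first by rewrite g_mid.
  by rewrite g_pos//; apply: le_trans gms _; apply: (F'_homo s0 pp) => //; lra.
Qed.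

Lemma burk_subgrad0 :
  exists g : R -> R, forall a b, burk 0 a + g a * (b - a) <= burk 0 b.
Proof.
have [A0 Ap A1 A2] := burkA_bounds.
have p0 : 0 < p by lra.
have b0 t : burk 0 t = A * `|t| `^ p.
  rewrite /burk normr0 (max_idPr (normr_ge0 t)) mulr0 mul0r addr0.
  have [->|t0] := eqVneq t 0; first by rewrite normr0 expr0n !mulr0 powR0 ?mulr0// gt_eqF.
  rewrite -normr_gt0 in t0; rewrite (powRB_mul p t0) (powRB_mul (p - 1) t0).
  by rewrite (_ : p - 1 - 1 = p - 2); ring.
exists (fun a => A * (p * `|a| `^ (p - 1) * Num.sg a)) => a b; rewrite !b0.
rewrite -mulrA -mulrDr ler_wpM2l ?(ltW A0)//.
have [->|a0] := eqVneq a 0.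
  by rewrite normr0 sgr0 mulr0 mul0r addr0 powR0 ?gt_eqF// powR_ge0.
have na : 0 < `|a| by rewrite normr_gt0.
apply: le_trans (powR_subgrad na (normr_ge0 b)); rewrite lerD2l -mulrA.
rewrite ler_wpM2l ?mulr_ge0 ?powR_ge0 ?(ltW p0)//.
rewrite mulrBr -normrEsg lerB//.
by rewrite (le_trans (ler_norm _))// normrM normr_sg a0 mul1r.
Qed.

Lemma burk_subgrad s :
  exists g : R -> R, forall a b, burk s a + g a * (b - a) <= burk s b.
Proof.
case: (ltgtP s 0) => [s0|/burk_subgrad_gt0//|->]; last exact: burk_subgrad0.
have [g hg] := @burk_subgrad_gt0 (- s) ltac:(lra).
exists (fun a => - g (- a)) => a b.
rewrite -[burk s a]burkN -[burk s b]burkN; apply: le_trans (hg (- a) (- b)).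
by rewrite (_ : - b - - a = - (b - a)) ?mulrN ?mulNr//; ring.
Qed.

(** Jensen's inequality for a two-point increment of mean zero. The weights are not normalised, so
    null cells cause no division by 0. *)
Lemma burk_convex s t (m0 m1 h0 h1 : R) : 0 <= m0 -> 0 <= m1 ->
  m0 * h0 + m1 * h1 = 0 ->
  (m0 + m1) * burk s t <= m0 * burk s (t + h0) + m1 * burk s (t + h1).
Proof.
move=> m00 m10 e; have [g hg] := burk_subgrad s.
have := ler_wpM2l m00 (hg t (t + h0)); have := ler_wpM2l m10 (hg t (t + h1)).
have E h : t + h - t = h by ring.
have : g t * (m0 * h0 + m1 * h1) = 0 by rewrite e mulr0.
rewrite !E; nra.
Qed.

Lemma burk_martingale_step x y e (m0 m1 h0 h1 : R) : 0 <= m0 -> 0 <= m1 ->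
  `|e| = 1 -> m0 * h0 + m1 * h1 = 0 ->
  (m0 + m1) * burk (x + y) (x - y) <=
  m0 * burk (x + h0 + (y + e * h0)) (x + h0 - (y + e * h0)) +
  m1 * burk (x + h1 + (y + e * h1)) (x + h1 - (y + e * h1)).
Proof.
move=> m00 m10 e1 eh.
have [->|->] : e = 1 \/ e = -1.
  by move/eqP: e1; rewrite eqr_norml => /andP[/orP[]/eqP-> _]; [left|right].
- have E (h : R) : (x + h + (y + 1 * h) = x + y + 2 * h) *
                   (x + h - (y + 1 * h) = x - y) by split; ring.
  rewrite !E burkC ![burk (_ + _ * _) _]burkC; apply: burk_convex => //.
  by rewrite mulrCA [m1 * _]mulrCA -mulrDr eh mulr0.
- have E (h : R) : (x + h + (y + -1 * h) = x + y) *
                   (x + h - (y + -1 * h) = x - y + 2 * h) by split; ring.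
  rewrite !E; apply: burk_convex => //.
  by rewrite mulrCA [m1 * _]mulrCA -mulrDr eh mulr0.
Qed.

(** Base of the induction on the depth: at a root the transform only changes the sign, and the
    product (x + y)(x - y) vanishes. *)
Lemma burk_diag_ge0 x y : `|y| = `|x| -> 0 <= burk (x + y) (x - y).
Proof.
move=> xy; have [A0 _ _ _] := burkA_bounds.
rewrite /burk -mulrA (_ : (x + y) * (x - y) = `|x| ^+ 2 - `|y| ^+ 2).
  by rewrite xy subrr mulr0 addr0 mulr_ge0 ?powR_ge0 ?mulr_ge0 ?sqr_ge0// ltW.
by rewrite !real_normK ?num_real//; ring.
Qed.

Lemma max_normDB (x y : R) : Num.max `|x + y| `|x - y| = `|x| + `|y|.
Proof.
case: (lerP `|x + y| `|x - y|);
case: (ger0P x) => ?; case: (ger0P y) => ?; case: (ger0P (x + y)) => ?; case: (ger0P (x - y)) => ?; lra.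
Qed.

(** In terms of |x| and |y| the function is (|x| + |y|)^(p-1) ((A + p) |x| - (p - A) |y|). Half of
    the negative term beats the positive one unless |y| <= L |x|, and then everything is controlled
    by |x|^p. *)
Lemma burk_majorant : exists2 C, 0 < C & exists2 k, 0 < k &
  forall x y, burk (x + y) (x - y) <= C * `|x| `^ p - k * `|y| `^ p.
Proof.
have [A0 Ap A1 A2] := burkA_bounds.
have p0 : 0 < p by lra.
pose k := (p - A) / 2; have k0 : 0 < k by rewrite /k; lra.
pose L := (A + p) / k; have L0 : 0 < L by rewrite divr_gt0//; lra.
exists ((A + p) * (1 + L) `^ (p - 1) + k * L `^ p).
  by rewrite addr_gt0// mulr_gt0// ?powR_gt0//; lra.
exists k => // x y.
have bE : burk (x + y) (x - y) =
    (`|x| + `|y|) `^ (p - 1) * ((A + p) * `|x| - 2 * k * `|y|).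
  rewrite /burk max_normDB; set M := `|x| + `|y|.
  have : 0 <= M by rewrite addr_ge0.
  rewrite le_eqVlt => /predU1P[M0|M0].
    have [x0 y0] : x = 0 /\ y = 0.
      move: M0; rewrite /M => /esym/eqP; rewrite paddr_eq0// !normr_eq0.
      by move=> /andP[/eqP-> /eqP->].
    by rewrite -M0 x0 y0 normr0 expr0n /= !(addr0, subr0, mulr0, mul0r).
  rewrite (powRB_mul (p - 1) M0) -!mulrA (_ : p - 1 - 1 = p - 2); last by ring.
  congr (_ * _).
  rewrite (_ : (x + y) * (x - y) = `|x| ^+ 2 - `|y| ^+ 2); last first.
    by rewrite !real_normK ?num_real//; ring.
  by rewrite /M /k; field.
rewrite bE.
have [h|h] := leP ((A + p) * `|x|) (k * `|y|).
  have h1 : `|y| `^ (p - 1) <= (`|x| + `|y|) `^ (p - 1).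
    have pm : 0 <= p - 1 by lra.
    by rewrite ge0_ler_powR// ?nnegrE ?addr_ge0// lerDr.
  have y1 : `|y| `^ p = `|y| `^ (p - 1) * `|y|.
    have : 0 <= `|y| by []; rewrite le_eqVlt => /predU1P[<-|/powRB_mul//].
    by rewrite mulr0 powR0 // gt_eqF.
  have : 0 <= ((A + p) * (1 + L) `^ (p - 1) + k * L `^ p) * `|x| `^ p.
    rewrite mulr_ge0 ?powR_ge0// addr_ge0// mulr_ge0// ?powR_ge0//; lra.
  suff : (`|x| + `|y|) `^ (p - 1) * ((A + p) * `|x| - 2 * k * `|y|) <= - (k * `|y| `^ p) by lra.
  apply: (@le_trans _ _ ((`|x| + `|y|) `^ (p - 1) * (- (k * `|y|)))).
    by rewrite ler_wpM2l ?powR_ge0//; lra.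
  have yk : 0 <= k * `|y| by rewrite mulr_ge0// ltW.
  by rewrite y1; have := ler_wpM2l yk h1; lra.
have yx : `|y| <= L * `|x|.
  by rewrite /L mulrAC ler_pdivlMr// mulrC ltW.
have x0 : 0 < `|x|.
  rewrite normr_gt0; apply/eqP => x0; move: h; rewrite x0 normr0 mulr0.
  by rewrite ltNge mulr_ge0// ltW.
have h1 : (`|x| + `|y|) `^ (p - 1) <= (1 + L) `^ (p - 1) * `|x| `^ (p - 1).
  have pm : 0 <= p - 1 by lra.
  have L1 : 0 <= 1 + L by rewrite addr_ge0// ltW.
  by rewrite -powRM// ge0_ler_powR// ?nnegrE ?addr_ge0 ?mulr_ge0//; lra.
have h2 : `|y| `^ p <= L `^ p * `|x| `^ p.
  have [p0' L0'] := (ltW p0, ltW L0).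
  rewrite -powRM//; apply: ge0_ler_powR => //; rewrite ?nnegrE//.
  by rewrite mulr_ge0.
have x1 := powRB_mul p x0.
apply: (@le_trans _ _ ((`|x| + `|y|) `^ (p - 1) * ((A + p) * `|x|))).
  rewrite ler_wpM2l ?powR_ge0//; have : 0 <= `|y| by []; nra.
have h3 : (`|x| + `|y|) `^ (p - 1) * ((A + p) * `|x|) <=
          (1 + L) `^ (p - 1) * `|x| `^ (p - 1) * ((A + p) * `|x|).
  by rewrite ler_wpM2r// mulr_ge0//; lra.
apply: (le_trans h3); rewrite x1 mulrDl.
have := ler_wpM2l (ltW k0) h2; rewrite x1; lra.
Qed.

End burkholder_function.

Lemma big_nat_double (V : nmodType) (G : nat -> V) (m n : nat) :
  \sum_(m.*2 <= i < n.*2) G i = \sum_(m <= i < n) (G i.*2 + G i.*2.+1).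
Proof.
have [nm|/ltnW mn] := leqP n m; first by rewrite !big_geq ?leq_double.
elim: n mn => [|n IH]; first by rewrite leqn0 => /eqP->; rewrite !big_geq.
rewrite leq_eqVlt => /predU1P[->|]; first by rewrite !big_geq.
rewrite ltnS => mn; have h : (m.*2 <= n.*2)%N by rewrite leq_double.
by rewrite doubleS !big_nat_recr//= ?leqW// IH// addrA.
Qed.

(** * Transforms on weighted binary forests *)

Section discrete_burkholder.
Context {R : realType} (p : R).
Hypothesis p1 : 1 < p.
Variables (mu : nat -> R) (M : nat).
Hypothesis mu_ge0 : forall i, 0 <= mu i.
Hypothesis M0 : (0 < M)%N.
Hypothesis mu_split : forall i, (0 < i)%N -> mu i = mu i.*2 + mu i.*2.+1.

(* The value on the child i of the Haar function of the node i./2; it is 0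
   when one of the two children is null. *)
Definition haar_coef (i : nat) : R :=
  if (mu i./2.*2 == 0) || (mu i./2.*2.+1 == 0) then 0 else (-1) ^+ odd i / mu i.

Lemma haar_coef_mean0 i :
  mu i.*2 * haar_coef i.*2 + mu i.*2.+1 * haar_coef i.*2.+1 = 0.
Proof.
have e : (i.*2.+1)./2 = i by rewrite /= uphalf_double.
rewrite /haar_coef e doubleK /= odd_double /=.
case: eqVneq => [->|h0]; first by rewrite !mulr0 addr0.
case: eqVneq => [->|h1] /=; first by rewrite !mulr0 addr0.
by rewrite expr0 expr1; field; rewrite h0 h1.
Qed.

(* The value at the node i, of depth d below the roots M, ..., 2M - 1, of the
   combination with coefficients a of the root indicators and Haar functions. *)
Fixpoint node_val (a : nat -> R) (d i : nat) : R :=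
  if d is d'.+1 then node_val a d' i./2 + a i./2 * haar_coef i
  else a (i - M)%N.

(** The weighted sum of [burk] over a level does not decrease with the depth, by
    [burk_martingale_step] on each pair of children, and its terms are nonnegative at the roots. The
    nodes d levels below the roots M, ..., 2M - 1 are those in [M 2^d, M 2^(d+1)[. *)
Lemma discrete_burkholder_sign_aux (a e : nat -> R) (d : nat) :
  (forall n, `|e n| = 1) ->
  let x := node_val a d in let y := node_val (fun n => e n * a n) d in
  0 <= \sum_(M * 2 ^ d <= i < M * 2 ^ d.+1) mu i * burk p (x i + y i) (x i - y i).
Proof.
move=> e1 /=; elim: d => [|d IH].
  apply: sumr_ge0 => i _; rewrite mulr_ge0// burk_diag_ge0//=.
  by rewrite normrM e1 mul1r.
apply: (le_trans IH).
have E n : (M * 2 ^ n.+1 = (M * 2 ^ n).*2)%N by rewrite expnS mulnCA mul2n.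
rewrite (E d.+1) {2}(E d) big_nat_double !big_nat; apply: ler_sum => i /andP[iM _].
have i0 : (0 < i)%N by apply: leq_trans iM; rewrite muln_gt0 M0 expn_gt0.
rewrite mu_split //= doubleK uphalf_double -!mulrA.
by apply: burk_martingale_step => //; rewrite mulrCA [X in _ + X]mulrCA -mulrDr haar_coef_mean0 mulr0.
Qed.

End discrete_burkholder.

Lemma discrete_burkholder_sign {R : realType} (p : R) (p1 : 1 < p) :
  exists2 C, 0 < C & forall (mu : nat -> R) (M : nat), (0 < M)%N ->
  (forall i, 0 <= mu i) -> (forall i, (0 < i)%N -> mu i = mu i.*2 + mu i.*2.+1) ->
  forall (a e : nat -> R) (d : nat), (forall n, `|e n| = 1) ->
  \sum_(M * 2 ^ d <= i < M * 2 ^ d.+1)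
     mu i * `|node_val mu M (fun n => e n * a n) d i| `^ p <=
  C * \sum_(M * 2 ^ d <= i < M * 2 ^ d.+1) mu i * `|node_val mu M a d i| `^ p.
Proof.
have [C C0 [k k0 H]] := burk_majorant p1.
exists (C / k); first by rewrite divr_gt0.
move=> mu M M0 mu0 mus a e d e1.
have := discrete_burkholder_sign_aux p1 mu0 M0 mus a d e1 => /=.
move=> /le_trans h.
rewrite mulrAC ler_pdivlMr// -subr_ge0 [X in _ - X]mulrC !mulr_sumr -sumrB.
apply: h; apply: ler_sum => i _.
apply: le_trans (ler_wpM2l (mu0 i) (H _ _)) _.
by rewrite mulrBr ![mu i * (_ * _)]mulrCA.
Qed.

(** * Norm and representatives in complex L^p spaces *)

Section LpC_norm.
Context d (T : measurableType d) (R : realType).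
Variables (mu : {finite_measure set T -> \bar R}) (p : R) (p1 : 1 <= p).
Local Notation Lp := (LpC mu p1).
Local Notation L := (LfunC mu p).
Local Open Scope quotient_scope.

(** The norm of [LpC] takes values in R[i]; all estimates are made with this real number instead. *)
Definition nrm (x : Lp) : R := fine (LnormC mu p x).

Lemma normE (x : Lp) : `|x| = (nrm x)%:C.
Proof. by []. Qed.

Lemma nrm_ge0 x : 0 <= nrm x.
Proof. by rewrite /nrm fine_ge0// LnormC_ge0. Qed.

Lemma nrmD x y : nrm (x + y) <= nrm x + nrm y.
Proof. by rewrite -lecR rmorphD/= -!normE ler_normD. Qed.

Lemma nrmZ (a : R[i]) x : nrm (a *: x) = normc a * nrm x.
Proof. by apply: (@complexI R); rewrite rmorphM/= -!normE normrZ normcEC. Qed.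

Lemma nrm0 : nrm 0 = 0.
Proof. by apply: (@complexI R); rewrite -normE normr0. Qed.

Lemma nrm0_eq0 x : nrm x = 0 -> x = 0.
Proof. by move=> x0; apply/normr0_eq0; rewrite normE x0. Qed.

Lemma nrmN x : nrm (- x) = nrm x.
Proof. by apply: (@complexI R); rewrite -!normE normrN. Qed.

Lemma nrmB x y : nrm (x - y) <= nrm x + nrm y.
Proof. by rewrite -(nrmN y) nrmD. Qed.

Lemma nrm_sum (I : Type) (r : seq I) (P : pred I) (F : I -> Lp) :
  nrm (\sum_(i <- r | P i) F i) <= \sum_(i <- r | P i) nrm (F i).
Proof.
elim/big_ind2 : _ => [|x1 x2 y1 y2 h1 h2|//]; first by rewrite nrm0.
by rewrite (le_trans (nrmD _ _))// lerD.
Qed.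

(** The class of [f], with default value 0 when [f] is not in [L]; hence the membership hypotheses
    in the lemmas about it. *)
Definition toLp (f : T -> R[i]) : Lp := \pi_Lp (insubd (0 : LfunCType mu p1) f).

Lemma toLp_ae f : f \in L -> {ae mu, forall z, toLp f z = f z}.
Proof.
move=> fL; have := piLpC_ae (insubd (0 : LfunCType mu p1) f).
apply: filterS => z ->.
by rewrite -[LfunC_val _]/(val _) val_insubd /LfunC_of fL.
Qed.

Lemma LpC_funL (x : Lp) : (x : T -> R[i]) \in L.
Proof. by rewrite /LpC_fun; case: (repr x). Qed.

Lemma LpC_fun_measurable (x : Lp) : measurable_fun setT (x : T -> R[i]).
Proof. by have /LfunCP[] := LpC_funL x. Qed.

Lemma LpC_ext (x y : Lp) : {ae mu, forall z, x z = y z} -> x = y.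
Proof.
move=> h; rewrite -[x]reprK -[y]reprK; exact/piLpC_eq.
Qed.

Lemma toLp_eq f g : f \in L -> g \in L -> {ae mu, forall z, f z = g z} ->
  toLp f = toLp g.
Proof.
move=> fL gL fg; apply: LpC_ext.
by apply: filterS3 fg (toLp_ae fL) (toLp_ae gL) => z + -> ->.
Qed.

Lemma toLpK (x : Lp) : toLp x = x.
Proof. by apply: LpC_ext; apply: toLp_ae; exact: LpC_funL. Qed.

Lemma LpC_addE (x y : Lp) : {ae mu, forall z, (x + y : Lp) z = x z + y z}.
Proof.
have := piLpC_ae (repr x + repr y); apply: filterS => z.
by rewrite piLpCD !reprK LfunCDE.
Qed.

Lemma LpC_scaleE (a : R[i]) (x : Lp) : {ae mu, forall z, (a *: x : Lp) z = a * x z}.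
Proof.
by have := piLpC_ae (a *: repr x); apply: filterS => z; rewrite LfunCZE.
Qed.

Lemma LfunCD f g : f \in L -> g \in L -> (fun z => f z + g z) \in L.
Proof.
move=> fL gL; have [_ /(_ 1 _ _ fL gL)] := LfunC_submod_closed mu p1.
by rewrite scale1r.
Qed.

Lemma LfunCZ (a : R[i]) f : f \in L -> (fun z => a * f z) \in L.
Proof.
move=> fL; have [h0 /(_ a _ _ fL h0)] := LfunC_submod_closed mu p1.
by rewrite addr0.
Qed.

Lemma toLpD f g : f \in L -> g \in L -> toLp (fun z => f z + g z) = toLp f + toLp g.
Proof.
move=> fL gL; apply: LpC_ext.
have h : {ae mu, forall z, (toLp f + toLp g : Lp) z = f z + g z}.
  by apply: filterS3 (toLp_ae fL) (toLp_ae gL) (LpC_addE (toLp f) (toLp g)) => z -> -> ->.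
by apply: filterS2 h (toLp_ae (LfunCD fL gL)) => z -> ->.
Qed.

Lemma toLpZ a f : f \in L -> toLp (fun z => a * f z) = a *: toLp f.
Proof.
move=> fL; apply: LpC_ext.
apply: filterS3 (toLp_ae fL) (LpC_scaleE a (toLp f)) (toLp_ae (LfunCZ a fL)).
by move=> z -> -> ->.
Qed.

Lemma LfunC0 : (fun=> 0) \in L.
Proof. by have [] := LfunC_submod_closed mu p1. Qed.

Lemma toLp0 : toLp (fun=> 0) = 0.
Proof.
rewrite -[RHS](scale0r (toLp (fun=> 0))) -toLpZ ?LfunC0//.
by congr toLp; apply/funext => z; rewrite mul0r.
Qed.

Lemma LfunC_sum (I : Type) (r : seq I) (F : I -> T -> R[i]) :
  (forall i, F i \in L) -> (fun z => \sum_(i <- r) F i z) \in L.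
Proof.
move=> FL; elim: r => [|i r IH].
  by rewrite (_ : (fun _ => _) = fun=> 0) ?LfunC0//; apply/funext => z; rewrite big_nil.
rewrite (_ : (fun _ => _) = fun z => F i z + \sum_(j <- r) F j z) ?LfunCD//.
by apply/funext => z; rewrite big_cons.
Qed.

Lemma toLp_sum (I : Type) (r : seq I) (F : I -> T -> R[i]) :
  (forall i, F i \in L) -> toLp (fun z => \sum_(i <- r) F i z) = \sum_(i <- r) toLp (F i).
Proof.
move=> FL; elim: r => [|i r IH].
  rewrite big_nil (_ : (fun _ => _) = fun=> 0) ?toLp0//.
  by apply/funext => z; rewrite big_nil.
rewrite big_cons -IH -toLpD//; last exact: LfunC_sum.
by congr toLp; apply/funext => z; rewrite big_cons.
Qed.

Lemma LfunC_bounded (f : T -> R[i]) (c : R) : measurable_fun setT f ->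
  (forall z, normc (f z) <= c) -> f \in L.
Proof.
move=> mf fc; apply/LfunCP; split => //.
have : (cst c : T -> R) \in Lfun mu p%:E by exact: Lfun_cst.
move=> /andP[_]; rewrite inE /finite_norm; apply: le_lt_trans.
apply: Lnorm_ae_le => //; first exact: measurable_normcT.
apply: aeW => z /=; rewrite ger0_norm ?normc_ge0//.
by rewrite (le_trans (fc z))// ler_norm.
Qed.

Lemma nrm_ae_le (x y : Lp) : {ae mu, forall z, normc (x z) <= normc (y z)} ->
  nrm x <= nrm y.
Proof.
move=> h; rewrite /nrm fine_le ?LfunC_finite// ?LnormC_fin ?LpC_funL//.
by apply: LnormC_ae_le => //; exact: LpC_fun_measurable.
Qed.

Lemma nrm_powR (x : Lp) : (((nrm x) `^ p)%:E = \int[mu]_z ((normc (x z)) `^ p)%:E)%E.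
Proof.
have p0 : p != 0 by rewrite gt_eqF// (lt_le_trans _ p1).
rewrite -poweR_EFin /nrm fineK; last exact: LnormC_fin (LpC_funL x).
rewrite /LnormC (powR_Lnorm mu _ p0); apply: eq_integral => z _ /=.
by rewrite ger0_norm// normc_ge0.
Qed.

Lemma measurable_powR_normc (f : T -> R[i]) : measurable_fun setT f ->
  measurable_fun setT (fun z => ((normc (f z)) `^ p)%:E).
Proof.
move=> mf; apply/measurable_EFinP; apply: (measurableT_comp (measurable_powR p)).
exact: measurable_normcT.
Qed.

Lemma nrm_toLp_powR f : f \in L ->
  (((nrm (toLp f)) `^ p)%:E = \int[mu]_z ((normc (f z)) `^ p)%:E)%E.
Proof.
move=> fL; rewrite nrm_powR; apply: ae_eq_integral => //.
- exact/measurable_powR_normc/LpC_fun_measurable.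
- by apply: measurable_powR_normc; have /LfunCP[] := fL.
- by apply: filterS (toLp_ae fL) => z /= ->.
Qed.

Lemma nrm_le_powR (x : Lp) (c : R) : 0 <= c -> nrm x `^ p <= c `^ p -> nrm x <= c.
Proof.
move=> c0; apply: contraTT; rewrite -!ltNge => cx.
by rewrite gt0_ltr_powR ?nnegrE ?nrm_ge0// (lt_le_trans _ p1).
Qed.

End LpC_norm.

(** * Functions of a map with finitely many values *)

Section step_functions.
Context d (T : measurableType d) (R : realType).
Variables (mu : {finite_measure set T -> \bar R}) (p : R) (p1 : 1 <= p).
Variables (l : T -> nat) (a b : nat).
Hypothesis ml : measurable_fun setT l.
Hypothesis l_itv : forall z, (a <= l z < b)%N.

Lemma measurable_fiber i : measurable (l @^-1` [set i]).
Proof. by rewrite -[X in measurable X]setTI; apply: ml. Qed.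

Lemma sum_fiber (V : pzSemiRingType) (c : nat -> V) z :
  \sum_(a <= i < b) c i * (l z == i)%:R = c (l z).
Proof.
rewrite (bigD1_seq (l z)) ?mem_index_iota ?l_itv ?iota_uniq//= eqxx mulr1 big1 ?addr0//.
by move=> i; rewrite eq_sym => /negbTE->; rewrite mulr0.
Qed.

Lemma sum_integral_fiber (g : T -> \bar R) : measurable_fun setT g -> (forall z, 0 <= g z)%E ->
  (\sum_(a <= i < b) \int[mu]_(z in l @^-1` [set i]) g z = \int[mu]_z g z)%E.
Proof.
move=> mg g0.
have mf i := measurable_fiber i.
under eq_bigr => i _ do rewrite integral_mkcond.
rewrite -ge0_integral_sum//.
- apply: eq_integral => z _.
  rewrite (bigD1_seq (l z)) ?mem_index_iota ?l_itv ?iota_uniq//= big1 => [|i il].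
    by rewrite adde0 patchE mem_set.
  by rewrite patchE memNset//= => e; move: il; rewrite e eqxx.
- by move=> i; apply/(measurable_restrictT _ (mf i)); exact: measurable_funTS.
- by move=> i z _; rewrite patchE; case: ifP.
Qed.

Lemma step_fun_measurable d' (T' : measurableType d') (c : nat -> T') :
  measurable_fun setT (c \o l).
Proof. exact: measurableT_comp. Qed.

Lemma step_fun_LfunC (c : nat -> R[i]) : c \o l \in LfunC mu p.
Proof.
apply: (@LfunC_bounded _ _ _ _ _ p1 _ (\sum_(a <= i < b) normc (c i))).
  exact: step_fun_measurable.
move=> z; rewrite (bigD1_seq (l z)) ?mem_index_iota ?l_itv ?iota_uniq//= lerDl.
by apply: sumr_ge0 => i _; exact: normc_ge0.
Qed.

Definition fiber_mass i : R := fine (mu (l @^-1` [set i])).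

Lemma fiber_massE i : ((fiber_mass i)%:E = mu (l @^-1` [set i]))%E.
Proof. by rewrite fineK// fin_num_measure//; exact: measurable_fiber. Qed.

Lemma nrm_step_powR (c : nat -> R[i]) :
  nrm (toLp mu p1 (c \o l)) `^ p = \sum_(a <= i < b) fiber_mass i * normc (c i) `^ p.
Proof.
apply: EFin_inj; rewrite nrm_toLp_powR ?step_fun_LfunC// -sum_integral_fiber//.
- rewrite -sumEFin; apply: eq_bigr => i _.
  rewrite (eq_integral (fun=> ((normc (c i)) `^ p)%:E)).
    rewrite integral_cst; last exact: measurable_fiber.
    by rewrite EFinM fiber_massE muleC.
  by move=> z; rewrite inE/= => ->.
- by apply: measurable_powR_normc; exact: step_fun_measurable.
- by move=> z; rewrite lee_fin powR_ge0.
Qed.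

Lemma fiber_LfunC i : (fun z => (l z == i)%:R : R[i]) \in LfunC mu p.
Proof. exact: (step_fun_LfunC (fun j => (j == i)%:R)). Qed.

Definition fiber_ind i : LpC mu p1 := toLp mu p1 (fun z => (l z == i)%:R).

Lemma step_sum_fiber (c : nat -> R[i]) :
  toLp mu p1 (c \o l) = \sum_(a <= i < b) c i *: fiber_ind i.
Proof.
rewrite (eq_bigr (fun i => toLp mu p1 (fun z => c i * (l z == i)%:R))) => [|i _]; last first.
  by rewrite toLpZ//; exact: fiber_LfunC.
rewrite -toLp_sum => [|i]; last by apply: LfunCZ p1 _ _ _; exact: fiber_LfunC.
by congr toLp; apply/funext => z; rewrite sum_fiber.
Qed.

End step_functions.

(** * Complex integrals and means *)

Section complex_integral.
Context d (T : measurableType d) (R : realType).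
Variables (mu : {finite_measure set T -> \bar R}) (p : R) (p1 : 1 <= p).
Local Notation Lp := (LpC mu p1).
Implicit Types (x y : Lp) (Q : set T).
Local Notation Re := (@complex.Re R).
Local Notation Im := (@complex.Im R).

Lemma LpC_normc_integrable x Q : measurable Q ->
  mu.-integrable Q (EFin \o (fun z => normc (x z))).
Proof.
move=> mQ; apply: (integrableS measurableT) => //.
apply/Lfun1_integrable.
apply: (@Lfun_subset _ _ _ _ 1%E p%:E) => //; rewrite ?lee_fin//.
  exact: fin_num_measure.
have /LfunCP[mx fx] := LpC_funL x.
by apply/andP; rewrite !inE; split => //; exact: measurable_normcT.
Qed.

Lemma LpC_powR_integrable x Q : measurable Q ->
  mu.-integrable Q (fun z => ((normc (x z)) `^ p)%:E).
Proof.
move=> mQ; apply: (integrableS measurableT) => //; apply/integrableP; split.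
  by apply: measurable_powR_normc; exact: LpC_fun_measurable.
under eq_integral do rewrite gee0_abs ?lee_fin ?powR_ge0//.
by rewrite -nrm_powR ltry.
Qed.

Lemma LpC_Re_integrable x Q : measurable Q -> mu.-integrable Q (EFin \o (fun z => Re (x z))).
Proof.
move=> mQ; apply: le_integrable (LpC_normc_integrable x mQ) => //.
- apply/measurable_EFinP; apply: measurable_funTS.
  by have /measurable_complexP[] := LpC_fun_measurable x.
- by move=> z _; rewrite /= lee_fin (ger0_norm (normc_ge0 _)) normc_Re.
Qed.

Lemma LpC_Im_integrable x Q : measurable Q -> mu.-integrable Q (EFin \o (fun z => Im (x z))).
Proof.
move=> mQ; apply: le_integrable (LpC_normc_integrable x mQ) => //.
- apply/measurable_EFinP; apply: measurable_funTS.
  by have /measurable_complexP[] := LpC_fun_measurable x.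
- by move=> z _; rewrite /= lee_fin (ger0_norm (normc_ge0 _)) normc_Im.
Qed.

Definition cint Q (f : T -> R[i]) : R[i] :=
  (\int[mu]_(z in Q) Re (f z))%R +i* (\int[mu]_(z in Q) Im (f z))%R.

Lemma cint_ae_eq Q f g : measurable Q -> measurable_fun setT f -> measurable_fun setT g ->
  {ae mu, forall z, f z = g z} -> cint Q f = cint Q g.
Proof.
move=> mQ /measurable_complexP[f1 f2] /measurable_complexP[g1 g2] fg.
congr (_ +i* _); congr fine; apply: ae_eq_integral => //.
- exact/measurable_EFinP/measurable_funTS.
- exact/measurable_EFinP/measurable_funTS.
- by apply: filterS fg => z -> _.
- exact/measurable_EFinP/measurable_funTS.
- exact/measurable_EFinP/measurable_funTS.
- by apply: filterS fg => z -> _.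
Qed.

Lemma cintD Q x y : measurable Q -> cint Q (x + y : Lp) = cint Q x + cint Q y.
Proof.
move=> mQ; rewrite (@cint_ae_eq Q _ (fun z => x z + y z)) //.
- have E1 z : Re (x z + y z) = Re (x z) + Re (y z) by case: (x z); case: (y z).
  have E2 z : Im (x z + y z) = Im (x z) + Im (y z) by case: (x z); case: (y z).
  rewrite /cint; under eq_Rintegral do rewrite E1.
  under [X in _ +i* X]eq_Rintegral do rewrite E2.
  have [iRx iIx] := (LpC_Re_integrable x mQ, LpC_Im_integrable x mQ).
  have [iRy iIy] := (LpC_Re_integrable y mQ, LpC_Im_integrable y mQ).
  by rewrite !RintegralD.
- exact: LpC_fun_measurable.
- by apply: measurable_complexD; exact: LpC_fun_measurable.
- exact: LpC_addE.
Qed.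

Lemma cintZ Q (a : R[i]) x : measurable Q -> cint Q (a *: x : Lp) = a * cint Q x.
Proof.
move=> mQ; rewrite (@cint_ae_eq Q _ (fun z => a * x z)) //.
- case: a => a1 a2.
  have E1 z : Re ((a1 +i* a2) * x z) = a1 * Re (x z) - a2 * Im (x z) by case: (x z).
  have E2 z : Im ((a1 +i* a2) * x z) = a1 * Im (x z) + a2 * Re (x z) by case: (x z).
  rewrite /cint; under eq_Rintegral do rewrite E1.
  under [X in _ +i* X]eq_Rintegral do rewrite E2.
  have iR := LpC_Re_integrable x mQ; have iI := LpC_Im_integrable x mQ.
  have iZ (b : R) (f : T -> R) : mu.-integrable Q (EFin \o f) ->
      mu.-integrable Q (EFin \o (fun z => b * f z)).
    by move=> fi; apply: (integrableZl mQ b fi).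
  by rewrite RintegralB ?RintegralD ?RintegralZl//; exact: iZ.
- exact: LpC_fun_measurable.
- by apply: (measurable_complexM (f := cst a)) => //; exact: LpC_fun_measurable.
- exact: LpC_scaleE.
Qed.

(** Splitting into real and imaginary parts costs the factor 2, which passes to the bound for
    conditional expectations but does not touch the basis constant. *)
Lemma normc_cint_le Q x : measurable Q ->
  normc (cint Q x) <= 2 * (\int[mu]_(z in Q) normc (x z))%R.
Proof.
move=> mQ; apply: (le_trans (normc_leD _)); rewrite mulr_natl mulr2n; apply: lerD => /=.
- apply: (le_trans (le_normr_Rintegral mQ (LpC_Re_integrable x mQ))).
  apply: le_Rintegral => //; [|exact: LpC_normc_integrable|by move=> z _; exact: normc_Re].
  exact: (integrable_abse (LpC_Re_integrable x mQ)).
- apply: (le_trans (le_normr_Rintegral mQ (LpC_Im_integrable x mQ))).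
  apply: le_Rintegral => //; [|exact: LpC_normc_integrable|by move=> z _; exact: normc_Im].
  exact: (integrable_abse (LpC_Im_integrable x mQ)).
Qed.

(** On a null set the mean is 0, since the inverse of 0 is 0. *)
Definition mean Q (f : T -> R[i]) : R[i] := (fine (mu Q))^-1%:C * cint Q f.

Lemma meanD Q x y : measurable Q -> mean Q (x + y : Lp) = mean Q x + mean Q y.
Proof. by move=> mQ; rewrite /mean cintD// mulrDr. Qed.

Lemma meanZ Q (a : R[i]) x : measurable Q -> mean Q (a *: x : Lp) = a * mean Q x.
Proof. by move=> mQ; rewrite /mean cintZ// mulrCA. Qed.

(* Jensen's inequality, up to the factor 2^p lost in normc_cint_le. *)
Lemma mean_powR Q x : 1 < p -> measurable Q ->
  ((fine (mu Q) * normc (mean Q x) `^ p)%:E <=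
   (2 `^ p)%:E * \int[mu]_(z in Q) ((normc (x z)) `^ p)%:E)%E.
Proof.
move=> pgt1 mQ; set m := fine (mu Q).
have p0 : 0 < p by exact: lt_trans pgt1.
have iy : (0 <= \int[mu]_(z in Q) ((normc (x z)) `^ p)%:E)%E.
  by apply: integral_ge0 => z _; rewrite lee_fin powR_ge0.
have : 0 <= m by rewrite fine_ge0.
rewrite le_eqVlt => /predU1P[<-|m0].
  by rewrite mul0r mule_ge0// lee_fin powR_ge0.
pose J := (\int[mu]_(z in Q) normc (x z))%R; pose c := m^-1 * J.
have J0 : 0 <= J by apply: Rintegral_ge0 => z _; exact: normc_ge0.
have c0 : 0 <= c by rewrite mulr_ge0// invr_ge0 ltW.
have mc : normc (mean Q x) <= 2 * c.
  rewrite /mean normcM -/m [normc _](_ : _ = m^-1); last first.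
    by rewrite /= expr0n addr0 sqrtr_sqr ger0_norm// invr_ge0 ltW.
  rewrite /c mulrCA ler_wpM2l ?invr_ge0 ?(ltW m0)//; exact: normc_cint_le.
have ip := LpC_powR_integrable x mQ.
have i1 := LpC_normc_integrable x mQ.
(* Here [c] is the mean of |x| over Q. For c > 0, integrate the tangent line of t^p at [c], whose
   linear term has integral 0. *)
have key : m * c `^ p <= (\int[mu]_(z in Q) (normc (x z) `^ p))%R.
  have : 0 <= c by []; rewrite le_eqVlt => /predU1P[<-|cgt0].
    by rewrite powR0 ?gt_eqF// mulr0; apply: Rintegral_ge0 => z _; exact: powR_ge0.
  have imu (r : R) : mu.-integrable Q (EFin \o (fun=> r)).
    by apply: (integrableS measurableT) => //; apply: finite_measure_integrable_cst.
  have iZ : mu.-integrable Q (EFin \o (fun z => p * c `^ (p - 1) * (normc (x z) - c))).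
    by apply: (integrableZl mQ _ (integrableB mQ i1 (imu c))).
  apply: (@le_trans _ _ (\int[mu]_(z in Q) (c `^ p + p * c `^ (p - 1) * (normc (x z) - c)))%R).
    rewrite RintegralD// RintegralZl//; last exact: (integrableB mQ i1 (imu c)).
    rewrite RintegralB// !Rintegral_cst// -/J -/m (_ : J - c * m = 0) ?mulr0 ?addr0 1?mulrC//.
    by rewrite /c mulrA mulfV ?gt_eqF// mul1r subrr.
  apply: le_Rintegral => //; first exact: (integrableD mQ (imu _) iZ).
  by move=> z _; apply: powR_subgrad => //; exact: normc_ge0.
have -> : (\int[mu]_(z in Q) ((normc (x z)) `^ p)%:E =
   (\int[mu]_(z in Q) (normc (x z) `^ p))%R%:E)%E.
  by rewrite /Rintegral fineK//; apply: integrable_fin_num.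
rewrite -EFinM lee_fin; apply: (@le_trans _ _ (m * (2 * c) `^ p)).
  have [m0' p0'] := (ltW m0, ltW p0).
  by rewrite ler_wpM2l//; apply: ge0_ler_powR => //; rewrite ?nnegrE ?normc_ge0// mulr_ge0.
by rewrite powRM// mulrCA ler_wpM2l// powR_ge0.
Qed.

End complex_integral.

(** * Haar systems of binary trees of partitions *)

(* An infinite binary tree of measurable partitions: node k z is the node of
   depth k whose cell contains z, where the children of i are 2i and 2i + 1 and
   the nodes of depth k are those in [2^k, 2^(k+1)[. *)
Record cellTree d (T : measurableType d) := CellTree {
  tree_node :> nat -> T -> nat ;
  measurable_node : forall k, measurable_fun setT (tree_node k) ;
  tree_node0 : forall z, tree_node 0 z = 1%N ;
  tree_nodeS : forall k z, (tree_node k.+1 z)./2 = tree_node k z }.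

Section cell_tree.
Context d (T : measurableType d).
Variable node : cellTree T.
Local Notation mnode := (measurable_node node).
Local Notation node0 := (tree_node0 node).
Local Notation nodeS := (tree_nodeS node).

Lemma node_itv k z : (2 ^ k <= node k z < 2 ^ k.+1)%N.
Proof.
elim: k => [|k /andP[IH1 IH2]]; first by rewrite node0.
have := odd_double_half (node k.+1 z); rewrite nodeS => <-.
by rewrite !expnS !mul2n in IH1 IH2 *; apply/andP; split; case: (odd _); lia.
Qed.

Definition depth (i : nat) := trunc_log 2 i.

Lemma depthE k i : (2 ^ k <= i < 2 ^ k.+1)%N -> depth i = k.
Proof. by move=> h; rewrite /depth; apply: trunc_log_eq. Qed.

Lemma depth_itv i : (0 < i)%N -> (2 ^ depth i <= i < 2 ^ (depth i).+1)%N.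
Proof. by move=> i0; rewrite /depth trunc_logP//= trunc_log_ltn. Qed.

Lemma depth_half i : (1 < i)%N -> depth i = (depth i./2).+1.
Proof.
move=> i1; have i20 : (0 < i./2)%N by rewrite half_gt0.
apply: depthE; have /andP[h1 h2] := depth_itv i20.
have e := odd_double_half i.
move: h1 h2; rewrite !expnS; move: (2 ^ _)%N => D h1 h2.
by apply/andP; split; lia.
Qed.

Lemma depth_double i (b : bool) : (0 < i)%N -> depth (b + i.*2) = (depth i).+1.
Proof.
move=> i0; rewrite depth_half ?half_bit_double//.
by case: b; rewrite ?add1n ?add0n; lia.
Qed.

(** The number of a node determines its depth, so a cell needs a single index. *)
Definition cell i : set T := node (depth i) @^-1` [set i].

Lemma cell_fiber k i : (2 ^ k <= i < 2 ^ k.+1)%N -> cell i = node k @^-1` [set i].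
Proof. by move=> /depthE h; rewrite /cell h. Qed.

Lemma measurable_cell i : measurable (cell i).
Proof. exact: (measurable_fiber (mnode (depth i))). Qed.

Lemma cell_parent i z : (0 < i)%N -> cell i z <-> (node (depth i).+1 z)./2 = i.
Proof. by rewrite nodeS. Qed.

Lemma cell_child (b : bool) i z : (0 < i)%N ->
  cell (b + i.*2) z <-> node (depth i).+1 z = (b + i.*2)%N.
Proof. by move=> i0; rewrite /cell depth_double. Qed.

Lemma cell_split i : (0 < i)%N -> cell i = cell i.*2 `|` cell i.*2.+1.
Proof.
move=> i0; apply/seteqP; split => z.
  move=> /cell_parent-/(_ i0) h.
  have e := odd_double_half (node (depth i).+1 z).
  case: (boolP (odd (node (depth i).+1 z))) => o.
  - by right; apply/(cell_child true) => //; rewrite -e o h.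
  - by left; apply/(cell_child false) => //; rewrite -e (negbTE o) h.
move=> [/(cell_child false)|/(cell_child true)] => /(_ i0) h;
  by apply/cell_parent => //; rewrite h half_bit_double.
Qed.

Lemma cell_disj i : (0 < i)%N -> cell i.*2 `&` cell i.*2.+1 = set0.
Proof.
move=> i0; apply/seteqP; split => // z [/(cell_child false) h0 /(cell_child true) h1].
by have := h0 i0; rewrite (h1 i0) add0n add1n; lia.
Qed.

End cell_tree.

Section cell_mass.
Context d (T : measurableType d) (R : realType).
Variables (mu : {finite_measure set T -> \bar R}) (node : cellTree T).
Local Notation cell := (cell node).

Definition mass i : R := fine (mu (cell i)).

Lemma mass_ge0 i : 0 <= mass i.
Proof. by rewrite fine_ge0. Qed.

Lemma massE i : ((mass i)%:E = mu (cell i))%E.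
Proof. by rewrite fineK// fin_num_measure//; exact: measurable_cell. Qed.

Lemma mass_split i : (0 < i)%N -> mass i = mass i.*2 + mass i.*2.+1.
Proof.
move=> i0; apply: EFin_inj; rewrite EFinD !massE (cell_split node i0) measureU//.
- exact: measurable_cell.
- exact: measurable_cell.
- exact: cell_disj.
Qed.

End cell_mass.

Section cell_step.
Context d (T : measurableType d) (R : realType).
Variables (mu : {finite_measure set T -> \bar R}) (p : R) (p1 : 1 <= p).
Local Notation Lp := (LpC mu p1).
Variable node : cellTree T.
Local Notation mnode := (measurable_node node).
Local Notation nodeS := (tree_nodeS node).
Local Notation cell := (cell node).
Local Notation mass := (mass mu node).

Definition cell_ind i : Lp := toLp mu p1 (fun z => (node (depth i) z == i)%:R).
Local Notation e := cell_ind.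

Lemma cell_ind_LfunC i : (fun z => (node (depth i) z == i)%:R : R[i]) \in LfunC mu p.
Proof. exact: (fiber_LfunC mu p1 (mnode _) (node_itv node _)). Qed.

Definition step k (c : nat -> R[i]) : Lp := toLp mu p1 (c \o node k).

Lemma step_LfunC k (c : nat -> R[i]) : c \o node k \in LfunC mu p.
Proof. exact: (step_fun_LfunC mu p1 (mnode _) (node_itv node _)). Qed.

Lemma stepE k c : step k c = \sum_(2 ^ k <= i < 2 ^ k.+1) c i *: e i.
Proof.
rewrite /step (step_sum_fiber mu p1 (mnode _) (node_itv node _)).
by rewrite !big_nat; apply: eq_bigr => i hi; rewrite /e /fiber_ind (depthE hi).
Qed.

Lemma nrm_step k c :
  nrm (step k c) `^ p = \sum_(2 ^ k <= i < 2 ^ k.+1) mass i * normc (c i) `^ p.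
Proof.
rewrite /step (nrm_step_powR mu p1 (mnode _) (node_itv node _)).
by rewrite !big_nat; apply: eq_bigr => i hi; rewrite /mass (cell_fiber node hi).
Qed.

Lemma nrm_step_le k c c' : (forall i, normc (c i) <= normc (c' i)) ->
  nrm (step k c) <= nrm (step k c').
Proof.
move=> cc'; apply: nrm_le_powR; first exact: nrm_ge0.
rewrite !nrm_step; apply: ler_sum => i _; rewrite ler_wpM2l ?mass_ge0//.
apply: ge0_ler_powR => //; rewrite ?nnegrE ?normc_ge0//.
exact: le_trans p1.
Qed.

Lemma step_half k c : step k.+1 (fun i => c i./2) = step k c.
Proof. by rewrite /step; congr toLp; apply/funext => z; rewrite /= nodeS. Qed.

Lemma step_deeper k j c : step (j + k) (fun i => c (iter j half i)) = step k c.
Proof.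
elim: j c => [//|j IH] c; rewrite addSn -[RHS](IH c) -(step_half (j + k) (fun i => c (iter j half i))).
by congr step; apply/funext => i; rewrite iterSr.
Qed.

Lemma cell_ind_step i : (0 < i)%N -> e i = step (depth i) (fun j => (j == i)%:R).
Proof. by []. Qed.

Lemma cell_ind_split i : (0 < i)%N -> e i = e i.*2 + e i.*2.+1.
Proof.
move=> i0; have h0 : depth i.*2 = (depth i).+1 := depth_double false i0.
have h1 : depth i.*2.+1 = (depth i).+1 := depth_double true i0.
rewrite /e -toLpD; [|exact: cell_ind_LfunC..].
congr toLp; apply/funext => z.
rewrite h0 h1 -nodeS; set n := node _ _.
have -> : (n./2 == i) = (n == i.*2) || (n == i.*2.+1) by lia.
have : ~~ ((n == i.*2) && (n == i.*2.+1)) by lia.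
by case: (n == i.*2); case: (n == i.*2.+1) => //= _; rewrite ?addr0 ?add0r.
Qed.

Lemma cell_ind_eq0 i : (0 < i)%N -> mass i = 0 -> e i = 0.
Proof.
move=> i0 m0; apply: nrm0_eq0.
have p0 : p != 0 by rewrite gt_eqF// (lt_le_trans _ p1).
suff /eqP : nrm (e i) `^ p = 0 by rewrite powR_eq0 => /andP[/eqP].
rewrite cell_ind_step// nrm_step big1_seq// => j _.
have [->|] := eqVneq j i; first by rewrite m0 mul0r.
by move=> _; rewrite [normc _]normc0 powR0// mulr0.
Qed.

Section haar_basis.
Variable k0 : nat.
Local Notation M0 := (2 ^ k0)%N.

(* Indices n < 2^k0 stand for the cell indicators of depth k0, and n >= 2^k0 for
   the Haar function of the node n; the latter is 0 if a child of n is null. *)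
Definition haar_vec (n : nat) : Lp :=
  if (n < M0)%N then e (M0 + n)
  else (haar_coef mass n.*2)%:C *: e n.*2 + (haar_coef mass n.*2.+1)%:C *: e n.*2.+1.
Local Notation w := haar_vec.

(** The link with the discrete model: going from 2^(k0 + k) to 2^(k0 + k + 1) terms adds the Haar
    functions of the nodes of depth k0 + k, which is the recursion defining [node_val]. *)
Lemma haar_vec_sum_step (a : nat -> R) k :
  \sum_(0 <= n < 2 ^ (k0 + k)) (a n)%:C *: w n =
  step (k0 + k) (fun i => (node_val mass M0 a k i)%:C).
Proof.
rewrite stepE; elim: k => [|k IH].
  rewrite addn0 expnS mul2n -addnn.
  transitivity (\sum_(0 + M0 <= i < M0 + M0) (node_val mass M0 a 0 i)%:C *: e i); last by rewrite add0n.
  rewrite big_addn addnK.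
  by rewrite !big_nat; apply: eq_bigr => i /= hi; rewrite addnK /w hi addnC.
have M00 : (0 < M0)%N by rewrite expn_gt0.
have Mle : (M0 <= 2 ^ (k0 + k))%N by rewrite leq_exp2l// leq_addr.
rewrite addnS (@big_cat_nat _ _ _ (2 ^ (k0 + k)))//=; last by rewrite leq_exp2l.
rewrite {}IH -big_split/= !expnS !mul2n.
rewrite [in RHS]big_nat_double !big_nat; apply: eq_bigr => i /andP[hi _].
have i0 : (0 < i)%N by apply: leq_trans hi; rewrite expn_gt0.
rewrite /w ltnNge (leq_trans Mle hi)/= (cell_ind_split i0) doubleK uphalf_double.
rewrite !rmorphD !rmorphM/= !scalerDl !scalerDr !scalerA.
by rewrite addrACA.
Qed.

End haar_basis.

End cell_step.

(** * Multipliers on Haar sums, with a constant depending on p only *)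

Section unconditional.
Context d (T : measurableType d) (R : realType).
Variables (mu : {finite_measure set T -> \bar R}) (p : R) (p1 : 1 < p).
Local Notation Lp := (LpC mu (ltW p1)).
Variables (node : cellTree T) (k0 : nat).
Local Notation M0 := (2 ^ k0)%N.
Local Notation w := (haar_vec mu (ltW p1) node k0).
Local Notation mass := (mass mu node).

Section constant.
Variable C : R.
Hypothesis C0 : 0 < C.
Hypothesis HC : forall (m : nat -> R) (M : nat), (0 < M)%N ->
  (forall i, 0 <= m i) -> (forall i, (0 < i)%N -> m i = m i.*2 + m i.*2.+1) ->
  forall (a e : nat -> R) (k : nat), (forall n, `|e n| = 1) ->
  \sum_(M * 2 ^ k <= i < M * 2 ^ k.+1)
     m i * `|node_val m M (fun n => e n * a n) k i| `^ p <=
  C * \sum_(M * 2 ^ k <= i < M * 2 ^ k.+1) m i * `|node_val m M a k i| `^ p.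

Let B := C `^ p^-1.

Lemma haar_sign (a e : nat -> R) k : (forall n, `|e n| = 1) ->
  nrm (\sum_(0 <= n < 2 ^ (k0 + k)) (e n * a n)%:C *: w n) <=
  B * nrm (\sum_(0 <= n < 2 ^ (k0 + k)) (a n)%:C *: w n).
Proof.
move=> e1; have p0 : 0 < p by exact: lt_trans p1.
rewrite !haar_vec_sum_step.
apply: nrm_le_powR; first by rewrite mulr_ge0 ?powR_ge0 ?nrm_ge0.
rewrite powRM ?powR_ge0 ?nrm_ge0// -powRrM mulVf ?gt_eqF// powRr1 ?(ltW C0)//.
have nc (r : R) : normc r%:C = `|r| by rewrite /= expr0n addr0 sqrtr_sqr.
rewrite !nrm_step; under eq_bigr do rewrite nc.
under [X in _ <= C * X]eq_bigr do rewrite nc.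
rewrite -addnS !expnD; apply: HC => //.
- by rewrite expn_gt0.
- by move=> i; exact: mass_ge0.
- by move=> i; exact: mass_split.
Qed.

Lemma haar_real_mult_aux (a t : nat -> R) k j : (forall n, `|t n| <= 1) ->
  (forall n, (j <= n)%N -> `|t n| = 1) ->
  nrm (\sum_(0 <= n < 2 ^ (k0 + k)) (t n * a n)%:C *: w n) <=
  B * nrm (\sum_(0 <= n < 2 ^ (k0 + k)) (a n)%:C *: w n).
Proof.
elim: j t => [|j IH] t t1 tj; first by apply: haar_sign => n; exact: tj.
(* The multiplier t is a convex combination of the two obtained from it by
   replacing t j by 1 and by -1. *)
pose tt (s : R) n := if n == j then s else t n.
have tt1 s : `|s| = 1 -> (forall n, `|tt s n| <= 1) /\ (forall n, (j <= n)%N -> `|tt s n| = 1).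
  move=> s1; split => n; rewrite /tt; case: eqVneq => [_|nj]; rewrite ?s1//.
  by move=> jn; apply: tj; rewrite ltn_neqAle eq_sym nj.
have [p1a p1b] := tt1 1 (normr1 _).
have [m1a m1b] := tt1 (-1) (eq_trans (normrN _) (normr1 _)).
pose l := (1 + t j) / 2.
have := t1 j; rewrite ler_norml => /andP[tl tu].
have l0 : 0 <= l by rewrite /l; lra.
have l1 : 0 <= 1 - l by rewrite /l; lra.
have -> : \sum_(0 <= n < 2 ^ (k0 + k)) (t n * a n)%:C *: w n =
    l%:C *: (\sum_(0 <= n < 2 ^ (k0 + k)) (tt 1 n * a n)%:C *: w n) +
    (1 - l)%:C *: (\sum_(0 <= n < 2 ^ (k0 + k)) (tt (-1) n * a n)%:C *: w n).
  rewrite !scaler_sumr -big_split/=; apply: eq_bigr => n _.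
  rewrite !scalerA -scalerDl -!rmorphM -rmorphD/=; congr (_%:C *: _).
  by rewrite /tt; case: eqVneq => [->|_]; rewrite /l; field.
have nc (r : R) : 0 <= r -> normc r%:C = r.
  by move=> r0; rewrite /= expr0n addr0 sqrtr_sqr ger0_norm.
apply: (le_trans (nrmD _ _)); rewrite !nrmZ !nc//.
have := ler_wpM2l l0 (IH _ p1a p1b); have := ler_wpM2l l1 (IH _ m1a m1b).
by lra.
Qed.

Lemma haar_real_mult (a t : nat -> R) k : (forall n, `|t n| <= 1) ->
  nrm (\sum_(0 <= n < 2 ^ (k0 + k)) (t n * a n)%:C *: w n) <=
  B * nrm (\sum_(0 <= n < 2 ^ (k0 + k)) (a n)%:C *: w n).
Proof.
move=> t1; pose t' n := if (n < 2 ^ (k0 + k))%N then t n else 1.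
have -> : \sum_(0 <= n < 2 ^ (k0 + k)) (t n * a n)%:C *: w n =
    \sum_(0 <= n < 2 ^ (k0 + k)) (t' n * a n)%:C *: w n.
  by rewrite !big_nat; apply: eq_bigr => n /= hn; rewrite /t' hn.
apply: (@haar_real_mult_aux _ _ _ (2 ^ (k0 + k))).
- by move=> n; rewrite /t'; case: ifP; rewrite ?normr1.
- by move=> n hn; rewrite /t' ltnNge hn normr1.
Qed.

Lemma haar_sum_complex (a : nat -> R[i]) k :
  \sum_(0 <= n < 2 ^ (k0 + k)) a n *: w n =
  \sum_(0 <= n < 2 ^ (k0 + k)) (complex.Re (a n))%:C *: w n +
  'i%C *: \sum_(0 <= n < 2 ^ (k0 + k)) (complex.Im (a n))%:C *: w n.
Proof.
rewrite scaler_sumr -big_split/=; apply: eq_bigr => n _.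
by rewrite scalerA -scalerDl; congr (_ *: _); rewrite [LHS]complexE.
Qed.

(** The vectors [w n] are real-valued, so taking the real or imaginary part of the coefficients
    takes that part of the sum pointwise. *)
Lemma haar_sum_ReIm_le (a : nat -> R[i]) k :
  nrm (\sum_(0 <= n < 2 ^ (k0 + k)) (complex.Re (a n))%:C *: w n) <=
    nrm (\sum_(0 <= n < 2 ^ (k0 + k)) a n *: w n) /\
  nrm (\sum_(0 <= n < 2 ^ (k0 + k)) (complex.Im (a n))%:C *: w n) <=
    nrm (\sum_(0 <= n < 2 ^ (k0 + k)) a n *: w n).
Proof.
have nc (r : R) : normc r%:C = `|r| by rewrite /= expr0n addr0 sqrtr_sqr.
rewrite (haar_sum_complex a) !haar_vec_sum_step.
set x := fun i => _; set y := fun i => node_val mass M0 (fun n => complex.Im (a n)) k i.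
pose z i : R[i] := node_val mass M0 (fun n => complex.Re (a n)) k i +i* y i.
have -> : step mu (ltW p1) node (k0 + k) x +
   'i%C *: step mu (ltW p1) node (k0 + k) (fun i => (y i)%:C) =
   step mu (ltW p1) node (k0 + k) z.
  rewrite !stepE scaler_sumr -big_split/=; apply: eq_bigr => i _.
  by rewrite scalerA -scalerDl; congr (_ *: _); rewrite [RHS]complexE.
split; apply: nrm_step_le => i; rewrite nc.
- exact: (normc_Re (z i)).
- exact: (normc_Im (z i)).
Qed.

Lemma haar_real_mult_complex (a : nat -> R[i]) (t : nat -> R) k : (forall n, `|t n| <= 1) ->
  nrm (\sum_(0 <= n < 2 ^ (k0 + k)) ((t n)%:C * a n) *: w n) <=
  2 * B * nrm (\sum_(0 <= n < 2 ^ (k0 + k)) a n *: w n).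
Proof.
move=> t1; rewrite haar_sum_complex.
have ER n : complex.Re ((t n)%:C * a n) = t n * complex.Re (a n).
  by case: (a n) => u v /=; rewrite mul0r subr0.
have EI n : complex.Im ((t n)%:C * a n) = t n * complex.Im (a n).
  by case: (a n) => u v /=; rewrite mul0r addr0.
under eq_bigr do rewrite ER.
under [X in _ + _ *: X]eq_bigr do rewrite EI.
apply: (le_trans (nrmD _ _)); rewrite nrmZ.
have -> : normc 'i%C = 1 :> R by rewrite /= expr0n expr1n add0r sqrtr1.
rewrite mul1r -mulrA mulr_natl mulr2n.
have [hR hI] := haar_sum_ReIm_le a k.
have B0 : 0 <= B by exact: powR_ge0.
apply: lerD; (apply: (le_trans (haar_real_mult _ _ t1))); exact: ler_wpM2l.
Qed.

(** Real and imaginary parts are separated once in the coefficients and once in the multiplier, each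
    time at the cost of a factor 2. *)
Lemma haar_mult_dyadic (a t : nat -> R[i]) k : (forall n, normc (t n) <= 1) ->
  nrm (\sum_(0 <= n < 2 ^ (k0 + k)) (t n * a n) *: w n) <=
  4 * B * nrm (\sum_(0 <= n < 2 ^ (k0 + k)) a n *: w n).
Proof.
move=> t1.
have -> : \sum_(0 <= n < 2 ^ (k0 + k)) (t n * a n) *: w n =
  \sum_(0 <= n < 2 ^ (k0 + k)) ((complex.Re (t n))%:C * a n) *: w n +
  'i%C *: \sum_(0 <= n < 2 ^ (k0 + k)) ((complex.Im (t n))%:C * a n) *: w n.
  rewrite scaler_sumr -big_split/=; apply: eq_bigr => n _.
  rewrite scalerA -scalerDl mulrA -mulrDl; congr (_ * _ *: _); exact: complexE.
apply: (le_trans (nrmD _ _)); rewrite nrmZ.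
have -> : normc 'i%C = 1 :> R by rewrite /= expr0n expr1n add0r sqrtr1.
have tR n : `|complex.Re (t n)| <= 1 by apply: le_trans (t1 n); exact: normc_Re.
have tI n : `|complex.Im (t n)| <= 1 by apply: le_trans (t1 n); exact: normc_Im.
have := haar_real_mult_complex a k tR; have := haar_real_mult_complex a k tI.
lra.
Qed.

(** A sum of any length becomes one of dyadic length when its coefficients are padded with zeros. *)
Lemma haar_mult (a t : nat -> R[i]) m : (forall n, normc (t n) <= 1) ->
  nrm (\sum_(0 <= n < m) (t n * a n) *: w n) <=
  4 * B * nrm (\sum_(0 <= n < m) a n *: w n).
Proof.
move=> t1; pose a' n := if (n < m)%N then a n else 0.
have mk : (m <= 2 ^ (k0 + m))%N.
  by rewrite (leq_trans (ltnW (ltn_expl m (ltnSn 1))))// leq_exp2l// leq_addl.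
have E (c : nat -> R[i]) : \sum_(0 <= n < m) (c n * a n) *: w n =
    \sum_(0 <= n < 2 ^ (k0 + m)) (c n * a' n) *: w n.
  rewrite [RHS](@big_cat_nat _ _ _ m)//= [X in _ = _ + X]big1_seq ?addr0.
    by rewrite !big_nat; apply: eq_bigr => n /= hn; rewrite /a' hn.
  move=> n; rewrite mem_index_iota => /andP[_ /andP[mn _]].
  by rewrite /a' ltnNge mn/= mulr0 scale0r.
have E1 : \sum_(0 <= n < m) a n *: w n = \sum_(0 <= n < 2 ^ (k0 + m)) a' n *: w n.
  have := E (fun=> 1); under eq_bigr do rewrite mul1r.
  by under [RHS]eq_bigr do rewrite mul1r.
rewrite E E1; exact: haar_mult_dyadic.
Qed.

End constant.
End unconditional.

(** The measure, the tree and [k0] are quantified after C, so [k0] may be as large as eps demands at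
    no cost to the basis constant. *)
Lemma haar_unconditional (R : realType) (p : R) (p1 : 1 < p) :
  exists2 C : R, 0 < C & forall d (T : measurableType d)
    (mu : {finite_measure set T -> \bar R}) (node : cellTree T) (k0 : nat)
    (a t : nat -> R[i]) (m : nat), (forall n, normc (t n) <= 1) ->
  nrm (\sum_(0 <= n < m) (t n * a n) *: haar_vec mu (ltW p1) node k0 n) <=
  C * nrm (\sum_(0 <= n < m) a n *: haar_vec mu (ltW p1) node k0 n).
Proof.
have [C C0 HC] := discrete_burkholder_sign p1.
exists (4 * C `^ p^-1); first by rewrite mulr_gt0 ?powR_gt0.
by move=> d T mu node k0 a t m t1; exact: haar_mult.
Qed.

(** * Conditional expectations and Haar coordinates *)

Section conditional_expectation.
Context d (T : measurableType d) (R : realType).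
Variables (mu : {finite_measure set T -> \bar R}) (p : R) (p1 : 1 < p).
Local Notation Lp := (LpC mu (ltW p1)).
Variables (node : cellTree T).
Local Notation mass := (mass mu node).
Local Notation cell := (cell node).
Local Notation step := (step mu (ltW p1) node).
Local Notation e := (cell_ind mu (ltW p1) node).
Implicit Types x y : Lp.

Let mcell i : measurable (cell i). Proof. exact: measurable_cell. Qed.

Definition condE k x : Lp := step k (fun i => mean mu (cell i) x).

Lemma condED k x y : condE k (x + y) = condE k x + condE k y.
Proof.
rewrite /condE !stepE -big_split/=; apply: eq_bigr => i _.
by rewrite meanD// scalerDl.
Qed.

Lemma condEZ k (a : R[i]) x : condE k (a *: x) = a *: condE k x.
Proof.
rewrite /condE !stepE scaler_sumr; apply: eq_bigr => i _.
by rewrite meanZ// scalerA.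
Qed.

Lemma condEB k x y : condE k (x - y) = condE k x - condE k y.
Proof. by rewrite condED -scaleN1r condEZ scaleN1r. Qed.

Lemma nrm_condE k x : nrm (condE k x) <= 2 * nrm x.
Proof.
apply: nrm_le_powR; first by rewrite mulr_ge0 ?nrm_ge0.
rewrite nrm_step powRM ?nrm_ge0// -lee_fin -sumEFin EFinM nrm_powR.
rewrite -(@sum_integral_fiber _ _ _ mu (node k) (2 ^ k) (2 ^ k.+1)); last first.
- by move=> z; rewrite lee_fin powR_ge0.
- by apply: measurable_powR_normc; exact: LpC_fun_measurable.
- exact: node_itv.
- exact: measurable_node.
rewrite ge0_sume_distrr; last first.
  by move=> i _; apply: integral_ge0 => z _; rewrite lee_fin powR_ge0.
rewrite !big_nat; apply: lee_sum => i hi; rewrite -(cell_fiber node hi).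
exact: mean_powR.
Qed.

Lemma cint_split i x : (0 < i)%N ->
  cint mu (cell i) x = cint mu (cell i.*2) x + cint mu (cell i.*2.+1) x.
Proof.
move=> i0; rewrite (cell_split node i0) /cint !Rintegral_setU//.
- by apply: LpC_Im_integrable; exact: measurableU.
- by apply/eqP; exact: cell_disj.
- by apply: LpC_Re_integrable; exact: measurableU.
- by apply/eqP; exact: cell_disj.
Qed.

Lemma cint_null i x : mass i = 0 -> cint mu (cell i) x = 0.
Proof.
move=> m0; have mu0 : mu (cell i) = 0%E by rewrite -massE m0.
have N (f : T -> R) : mu.-integrable (cell i) (EFin \o f) -> (\int[mu]_(z in cell i) f z)%R = 0.
  move=> fi; rewrite /Rintegral null_set_integral//.
  by case/integrableP: fi.
by rewrite /cint !N//; [exact: LpC_Im_integrable|exact: LpC_Re_integrable].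
Qed.

Lemma cint_step k (c : nat -> R[i]) i : (2 ^ k <= i < 2 ^ k.+1)%N ->
  cint mu (cell i) (step k c) = (mass i)%:C * c i.
Proof.
move=> hi; have cL := step_LfunC mu (ltW p1) node k c.
rewrite (@cint_ae_eq _ _ _ mu (cell i) _ (c \o node k)) //.
- rewrite /cint (@eq_Rintegral _ _ _ _ _ (fun=> complex.Re (c i))); last first.
    by move=> z; rewrite inE (cell_fiber node hi) /= => ->.
  rewrite [X in _ +i* X](@eq_Rintegral _ _ _ _ _ (fun=> complex.Im (c i))); last first.
    by move=> z; rewrite inE (cell_fiber node hi) /= => ->.
  rewrite !Rintegral_cst//; case: (c i) => u v /=.
  by congr (_ +i* _); rewrite /mass; ring.
- exact: LpC_fun_measurable.
- by have /LfunCP[] := cL.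
- exact: toLp_ae.
Qed.

Lemma mean_step k (c : nat -> R[i]) i : (2 ^ k <= i < 2 ^ k.+1)%N -> mass i != 0 ->
  mean mu (cell i) (step k c) = c i.
Proof.
move=> hi m0; rewrite /mean cint_step// mulrA -rmorphM/= mulVf//.
by rewrite rmorph1 mul1r.
Qed.

Lemma condE_step k (c : nat -> R[i]) : condE k (step k c) = step k c.
Proof.
rewrite {1}/condE [LHS]stepE [RHS]stepE !big_nat; apply: eq_bigr => i hi.
have i0 : (0 < i)%N by case/andP: hi => + _; apply: leq_trans; rewrite expn_gt0.
have [m0|m0] := eqVneq (mass i) 0; first by rewrite cell_ind_eq0// !scaler0.
by rewrite mean_step.
Qed.

Lemma condE_step_le k j (c : nat -> R[i]) : (j <= k)%N -> condE k (step j c) = step j c.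
Proof. by move=> jk; rewrite -(step_deeper mu (ltW p1) node j (k - j) c) subnK// condE_step. Qed.

Section haar_coordinates.
Variable k0 : nat.
Local Notation M0 := (2 ^ k0)%N.
Local Notation w := (haar_vec mu (ltW p1) node k0).

(** For n >= 2^k0 this is m0 m1 / (m0 + m1) times the difference of the means over the two children,
    of masses m0 and m1, written without dividing by m0 or m1, which may vanish. The factor matches
    the values 1 / m0 and - 1 / m1 of the Haar function. *)
Definition haar_coord n x : R[i] :=
  if (n < M0)%N then mean mu (cell (M0 + n)) x
  else (cint mu (cell n.*2) x * (mass n.*2.+1)%:C -
        cint mu (cell n.*2.+1) x * (mass n.*2)%:C) / (mass n)%:C.

Lemma haar_coordD n x y : haar_coord n (x + y) = haar_coord n x + haar_coord n y.
Proof.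
rewrite /haar_coord; case: ifP => _; first by rewrite meanD.
by rewrite !cintD//; ring.
Qed.

Lemma haar_coordZ n (a : R[i]) x : haar_coord n (a *: x) = a * haar_coord n x.
Proof.
rewrite /haar_coord; case: ifP => _; first by rewrite meanZ.
by rewrite !cintZ//; ring.
Qed.

(** The Haar term of a node is the increment from the mean over its cell to the means over its
    children. When a child is null, the other one has the mean of the parent, and both sides
    vanish. *)
Lemma haar_coord_split n x : (M0 <= n)%N ->
  haar_coord n x *: w n =
  (mean mu (cell n.*2) x - mean mu (cell n) x) *: e n.*2 +
  (mean mu (cell n.*2.+1) x - mean mu (cell n) x) *: e n.*2.+1.
Proof.
move=> Mn; have n0 : (0 < n)%N by apply: leq_trans Mn; rewrite expn_gt0.
rewrite /haar_coord /haar_vec ltnNge Mn/= scalerDr !scalerA.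
have h1 : (n.*2.+1)./2 = n by rewrite /= uphalf_double.
rewrite /haar_coef h1 doubleK /mean (cint_split x n0) -/(mass n) -/(mass n.*2) -/(mass n.*2.+1).
rewrite (mass_split mu node n0).
case: eqVneq => [m0|m0].
  rewrite /= mulr0 !scale0r cell_ind_eq0 ?double_gt0// scaler0 !add0r (cint_null x m0) m0 !add0r.
  by rewrite subrr scale0r.
case: eqVneq => [m1|m1].
  rewrite /= mulr0 !scale0r (@cell_ind_eq0 _ _ _ _ _ _ _ n.*2.+1)// scaler0 !addr0.
  rewrite (cint_null x m1) m1 !addr0.
  by rewrite subrr scale0r.
have m00 : (mass n.*2)%:C != 0 :> R[i] by rewrite fmorph_eq0.
have m11 : (mass n.*2.+1)%:C != 0 :> R[i] by rewrite fmorph_eq0.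
have m01 : (mass n.*2)%:C + (mass n.*2.+1)%:C != 0 :> R[i].
  by rewrite -rmorphD/= fmorph_eq0 paddr_eq0 ?mass_ge0// (negbTE m0).
rewrite /= odd_double /= expr0 expr1 !(rmorphM, rmorphN, rmorphD, rmorph1, fmorphV)/=.
move: m00 m11 m01; move: (mass n.*2)%:C (mass n.*2.+1)%:C => u v u0 v0 uv0.
move: (cint mu (cell n.*2) x) (cint mu (cell n.*2.+1) x) => A0 A1.
by congr (_ *: _ + _ *: _); field; rewrite uv0.
Qed.

(** By [haar_coord_split] the Haar terms of one depth add up to the difference of two consecutive
    conditional expectations, and these differences telescope. *)
Lemma condE_haar k x :
  condE (k0 + k) x = \sum_(0 <= n < 2 ^ (k0 + k)) haar_coord n x *: w n.
Proof.
elim: k => [|k IH].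
  rewrite addn0 /condE stepE expnS mul2n -addnn.
  transitivity (\sum_(0 + M0 <= i < M0 + M0) mean mu (cell i) x *: e i); first by rewrite add0n.
  rewrite big_addn addnK !big_nat; apply: eq_bigr => i /= hi.
  by rewrite /haar_coord /haar_vec hi addnC.
have Mle : (M0 <= 2 ^ (k0 + k))%N by rewrite leq_exp2l// leq_addr.
rewrite addnS (@big_cat_nat _ _ _ (2 ^ (k0 + k)))//=; last by rewrite leq_exp2l.
rewrite -{}IH /condE !stepE -big_split/= [(2 ^ (k0 + k).+1)%N]expnS.
rewrite [(2 ^ (k0 + k).+2)%N]expnS [(2 ^ (k0 + k).+1)%N]expnS !mul2n.
rewrite [in LHS]big_nat_double !big_nat; apply: eq_bigr => i /andP[hi _].
have i0 : (0 < i)%N by apply: leq_trans hi; rewrite expn_gt0.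
rewrite haar_coord_split ?(leq_trans Mle hi)// (cell_ind_split _ _ _ i0).
by rewrite scalerDr addrACA -!scalerDl ![mean _ (cell i) x + _]addrC !subrK.
Qed.

Lemma condE_haar_vec n k : (n < 2 ^ (k0 + k))%N -> condE (k0 + k) (w n) = w n.
Proof.
move=> nk; pose a m : R := (m == n)%:R.
have <- : \sum_(0 <= m < 2 ^ (k0 + k)) (a m)%:C *: w m = w n.
  rewrite (bigD1_seq n) ?mem_index_iota ?iota_uniq//= /a eqxx scale1r big1 ?addr0//.
  by move=> m /negbTE->; rewrite scale0r.
by rewrite haar_vec_sum_step condE_step.
Qed.

Section coefficients.
Variable C : R.
Hypothesis HC : forall (a t : nat -> R[i]) (m : nat), (forall n, normc (t n) <= 1) ->
  nrm (\sum_(0 <= n < m) (t n * a n) *: w n) <= C * nrm (\sum_(0 <= n < m) a n *: w n).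

(** The multiplier equal to 1 at [n] and 0 elsewhere isolates one term. *)
Lemma haar_term_le (a : nat -> R[i]) m n : (n < m)%N ->
  nrm (a n *: w n) <= C * nrm (\sum_(0 <= j < m) a j *: w j).
Proof.
move=> nm; have := @HC a (fun j => (j == n)%:R) m.
rewrite (bigD1_seq n) ?mem_index_iota ?iota_uniq//= eqxx mul1r big1 ?addr0.
  apply=> j; case: (j == n); first by rewrite [normc _]normc1.
  by rewrite [normc _]normc0.
by move=> j /negbTE->; rewrite mul0r scale0r.
Qed.

Lemma haar_term_eq0 (a : nat -> R[i]) m n : (n < m)%N ->
  \sum_(0 <= j < m) a j *: w j = 0 -> a n *: w n = 0.
Proof.
move=> nm s0; apply: nrm0_eq0; apply/eqP; rewrite eq_le nrm_ge0 andbT.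
by have := haar_term_le a nm; rewrite s0 nrm0 mulr0.
Qed.

(** Biorthogonality, obtained by comparing the expansion of [w m] in [condE_haar] with the trivial
    one. Both sides carry the factor [w n] because [w n] may be 0, and then its coefficient is not
    determined. *)
Lemma haar_coord_vec n m : haar_coord n (w m) *: w n = (n == m)%:R *: w n.
Proof.
apply/eqP; rewrite -subr_eq0 -scalerBl; apply/eqP.
pose k := maxn n m.
have lt2 j : (j <= k)%N -> (j < 2 ^ (k0 + k))%N.
  by move=> jk; apply: (leq_ltn_trans (leq_trans jk (leq_addl k0 k))); exact: ltn_expl.
have nk := lt2 n (leq_maxl n m); have mk := lt2 m (leq_maxr n m).
apply: (@haar_term_eq0 (fun n => haar_coord n (w m) - (n == m)%:R) _ _ nk).
under eq_bigr do rewrite scalerBl.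
rewrite sumrB -condE_haar condE_haar_vec//.
rewrite (bigD1_seq m) ?mem_index_iota ?iota_uniq//= eqxx scale1r big1 ?addr0 ?subrr//.
by move=> j /negbTE->; rewrite scale0r.
Qed.

End coefficients.
End haar_coordinates.
End conditional_expectation.

(** * Convergence in L^p and density *)

Lemma max0B {R : realDomainType} (x : R) : Num.max x 0 - Num.max (- x) 0 = x.
Proof. by case: (leP x 0) => h; case: (leP (- x) 0) => h'; lra. Qed.

Section dominated.
Context d (T : measurableType d) (R : realType).
Variables (mu : {finite_measure set T -> \bar R}) (p : R) (p1 : 1 < p).
Local Notation Lp := (LpC mu (ltW p1)).
Local Notation L := (LfunC mu p).
Local Notation inLp := (toLp mu (ltW p1)).

Lemma Lp_dominated (f_ : nat -> T -> R[i]) (f : T -> R[i]) (g : Lp) :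
  (forall n, f_ n \in L) -> f \in L ->
  {ae mu, forall z, forall e : R, 0 < e ->
     exists N, forall n, (N <= n)%N -> normc (f_ n z - f z) < e} ->
  {ae mu, forall z, forall n, normc (f_ n z - f z) <= normc (g z)} ->
  forall e : R, 0 < e -> exists N, forall n, (N <= n)%N -> nrm (inLp (f_ n) - inLp f) < e.
Proof.
move=> fL f0L cf fg e e0.
have p0 : 0 < p by exact: lt_trans p1.
have dL n : (fun z => f_ n z - f z) \in L.
  rewrite (_ : (fun _ => _) = fun z => f_ n z + -1 * f z).
    by apply: (LfunCD (ltW p1)) => //; exact: (LfunCZ (ltW p1)).
  by apply/funext => z; rewrite mulN1r.
have E n : inLp (f_ n) - inLp f = inLp (fun z => f_ n z - f z).
  rewrite -scaleN1r -toLpZ// -toLpD//; last exact: (LfunCZ (ltW p1)).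
  by congr toLp; apply/funext => z; rewrite mulN1r.
pose F n z := ((normc (f_ n z - f z)) `^ p)%:E.
have mF n : measurable_fun setT (F n).
  by apply: measurable_powR_normc; have /LfunCP[] := dL n.
have [] := @dominated_convergence _ _ _ mu setT measurableT F (cst 0%E)
  (fun z => ((normc (g z)) `^ p)%:E) mF (measurable_cst _).
- apply: filterS cf => z cz _; apply: cvg_EFin; first exact: nearW.
  apply/cvgrPdist_lt => eps eps0.
  (* For t <= 1 one has t^p <= t, so a bound by min 1 eps on t bounds t^p by eps. *)
  have [N HN] := cz (Num.min 1 eps) ltac:(by rewrite lt_min ltr01 eps0).
  exists N => // n /= Nn; have := HN n Nn; rewrite lt_min => /andP[h1 he].
  rewrite sub0r normrN ger0_norm ?powR_ge0//.
  have := normc_ge0 (f_ n z - f z); rewrite le_eqVlt => /predU1P[<-|t0].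
    by rewrite powR0 ?gt_eqF.
  by apply: le_lt_trans he; apply: ge1r_powR; rewrite ?(ltW p1)// t0 ltW.
- exact: LpC_powR_integrable.
- apply: filterS fg => z hz n _; rewrite /F /= lee_fin ger0_norm ?powR_ge0//.
  by apply: ge0_ler_powR => //; rewrite ?nnegrE ?normc_ge0// ltW.
move=> _ _ cI.
have {}cI : (fun n => \int[mu]_z F n z)%E @ \oo --> 0%E.
  by move: cI; rewrite integral0.
have ep : 0 < e `^ p by exact: powR_gt0.
have /fine_cvgP[_ /cvgrPdist_lt /(_ _ ep) [N _ HN]] := cI.
exists N => n Nn; rewrite E ltNge; apply/negP => ne.
have EQ : fine (\int[mu]_z F n z)%E = nrm (inLp (fun z => f_ n z - f z)) `^ p.
  by rewrite -(nrm_toLp_powR (ltW p1) (dL n)).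
have := HN n Nn; rewrite /= EQ sub0r normrN (ger0_norm (powR_ge0 _ _)).
rewrite ltNge => /negP; apply; apply: ge0_ler_powR => //; rewrite ?nnegrE ?nrm_ge0// ltW//.
Qed.

Definition indC (A : set T) (z : T) : R[i] := (z \in A)%:R.

Lemma indC_LfunC A : measurable A -> indC A \in L.
Proof.
move=> mA; apply: (@LfunC_bounded _ _ _ _ _ (ltW p1) _ 1).
  apply/measurable_complexP; split.
    rewrite (_ : _ \o _ = \1_A); first exact: measurable_indic.
    by apply/funext => z; rewrite /indC /= indicE; case: (z \in A).
  rewrite (_ : _ \o _ = cst 0); first exact: measurable_cst.
  by apply/funext => z; rewrite /indC /=; case: (z \in A).
by move=> z; rewrite /indC; case: (z \in A); rewrite ?[normc _]normc1 ?[normc _]normc0.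
Qed.

(** Density is used as an induction principle: a property with these closure rules that holds for
    enough indicators holds everywhere. *)
Definition closed_subspace (P : Lp -> Prop) :=
  [/\ forall x y, P x -> P y -> P (x + y),
      forall (a : R[i]) x, P x -> P (a *: x) &
      forall x, (forall e : R, 0 < e -> exists2 y, P y & nrm (y - x) < e) -> P x].

Variable P : Lp -> Prop.
Hypothesis cP : closed_subspace P.

Lemma closed_subspaceB x y : P x -> P y -> P (x - y).
Proof. by case: cP => PD PZ _ Px Py; rewrite -scaleN1r; apply: PD => //; exact: PZ. Qed.

Lemma closed_subspace_sum (I : Type) (r : seq I) (F : I -> Lp) x : P x ->
  (forall i, P (F i)) -> P (\sum_(i <- r) F i).
Proof.
case: cP => PD PZ _ Px PF; elim: r => [|i r IH]; last by rewrite big_cons; exact: PD.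
by rewrite big_nil -(scale0r x); exact: PZ.
Qed.

Lemma closed_subspace_indic_nd (B : nat -> set T) : (forall n, measurable (B n)) ->
  (forall m n, (m <= n)%N -> B m `<=` B n) -> (forall n, P (inLp (indC (B n)))) ->
  P (inLp (indC (\bigcup_n B n))).
Proof.
move=> mB ndB PB; have mU : measurable (\bigcup_n B n) by exact: bigcup_measurable.
case: cP => _ _; apply => e e0.
have n01 (b : bool) : normc (b%:R : R[i]) <= 1 by case: b; rewrite ?[normc _]normc1 ?[normc _]normc0.
have [||N HN] := @Lp_dominated (fun n => indC (B n)) (indC (\bigcup_n B n)) (inLp (cst 1))
  (fun n => indC_LfunC (mB n)) (indC_LfunC mU) _ _ e e0.
- apply: aeW => z eps eps0; have [[N _ BN]|nU] := pselect ((\bigcup_n B n) z).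
    exists N => n Nn; rewrite /indC !mem_set ?subrr ?[normc _]normc0//; first by exists N.
    exact: ndB Nn _ _.
  exists 0%N => n _; rewrite /indC !memNset ?subrr ?[normc _]normc0// => Bn.
  by apply: nU; exists n.
- have cL : cst 1 \in L.
    by apply: (@LfunC_bounded _ _ _ _ _ (ltW p1) _ 1) => // z; rewrite [normc _]normc1.
  apply: filterS (toLp_ae (ltW p1) cL) => z -> n; rewrite [leRHS]normc1 /indC.
  have [Bn|nB] := pselect (B n z).
    by rewrite !mem_set// ?subrr ?[normc _]normc0//; exists n.
  by rewrite (memNset nB) sub0r normcN.
- by exists (inLp (indC (B N))) => //; exact: HN.
Qed.

Hypothesis Pindic : forall A, measurable A -> P (inLp (indC A)).

Import HBNNSimple.

Lemma closed_subspace_nnsfun (g : {nnsfun T >-> R}) : P (inLp (fun z => (g z)%:C)).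
Proof.
case: cP => PD PZ _.
have mpre (y : R) : measurable (g @^-1` [set y]) by exact: measurable_sfunP.
have -> : (fun z => (g z)%:C) =
    (fun z => \sum_(y <- fset_set (range g)) y%:C * indC (g @^-1` [set y]) z).
  apply/funext => z; rewrite {1}fimfunE fsbig_finite//= rmorph_sum/=.
  apply: eq_bigr => y _; rewrite rmorphM/=; congr (_ * _).
  by rewrite indicE /indC; case: (_ \in _).
rewrite toLp_sum; last by move=> y; apply: (LfunCZ (ltW p1)); exact: indC_LfunC.
apply: (@closed_subspace_sum _ _ _ (inLp (indC setT))); first exact: Pindic.
by move=> y; rewrite toLpZ; [apply: PZ; exact: Pindic|exact: indC_LfunC].
Qed.

Lemma closed_subspace_ge0 (r : T -> R) : (forall z, 0 <= r z) ->
  measurable_fun setT r -> (fun z => (r z)%:C) \in L -> P (inLp (fun z => (r z)%:C)).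
Proof.
move=> r0 mr rL; have nc (s : R) : normc s%:C = `|s|.
  by rewrite /= expr0n addr0 sqrtr_sqr.
have mrE : measurable_fun setT (EFin \o r) by exact/measurable_EFinP.
have [g [ndg cg]] := @approximation _ _ _ setT measurableT _ mrE (fun z _ => r0 z).
have {}cg z : (g ^~ z : nat -> R) @ \oo --> r z.
  by have /fine_cvgP[_] := cg z I.
have gr n z : g n z <= r z.
  have nd : nondecreasing_seq (g ^~ z : nat -> R) by move=> i j ij; have /lefP := ndg i j ij.
  by have := nondecreasing_cvgn_le nd (cvgP _ (cg z)) n; rewrite (cvg_lim _ (cg z)).
have gL n : (fun z => (g n z)%:C) \in L.
  have mg : measurable_fun setT (fun z => (g n z)%:C : R[i]).
    apply/measurable_complexP; split; first exact: (measurable_funP (g n)).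
    exact: measurable_cst.
  apply/LfunCP; split => //; have /LfunCP[mrC] := rL; apply: le_lt_trans.
  apply: LnormC_ae_le => //; first exact: ltW.
  by apply: aeW => z; rewrite !nc !ger0_norm ?gr// ?r0//.
case: cP => _ _; apply => e e0.
have [||N HN] := @Lp_dominated (fun n z => (g n z)%:C) _ (inLp (fun z => (r z)%:C)) gL rL _ _ e e0.
- apply: aeW => z eps eps0; have /cvgrPdist_lt/(_ _ eps0)[N _ HN] := cg z.
  by exists N => n Nn; rewrite -rmorphB nc distrC; exact: HN.
- apply: filterS (toLp_ae (ltW p1) rL) => z -> n.
  rewrite -rmorphB !nc distrC !ger0_norm ?subr_ge0 ?r0 ?gr// gerBl.
  exact: fun_ge0.
- by exists (inLp (fun z => (g N z)%:C)); [exact: closed_subspace_nnsfun|exact: HN].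
Qed.

(** Real and imaginary parts, then positive and negative parts, reduce this to nonnegative
    functions, which are increasing limits of simple ones. *)
Lemma closed_subspace_full x : P x.
Proof.
case: cP => PD PZ _.
have nc (s : R) : normc s%:C = `|s| by rewrite /= expr0n addr0 sqrtr_sqr.
have /LfunCP[mx xfin] := LpC_funL x; have /measurable_complexP[mRe mIm] := mx.
have real_part (r : T -> R) : measurable_fun setT r ->
    (forall z, `|r z| <= normc (x z)) ->
    (fun z => (r z)%:C) \in L /\ P (inLp (fun z => (r z)%:C)).
  move=> mr rx.
  have rL (s : T -> R) : measurable_fun setT s -> (forall z, `|s z| <= `|r z|) ->
      (fun z => (s z)%:C) \in L.
    move=> ms sr; have msC : measurable_fun setT (fun z => (s z)%:C : R[i]).
      by apply/measurable_complexP; split => //; exact: measurable_cst.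
    apply/LfunCP; split => //; apply: le_lt_trans xfin.
    apply: LnormC_ae_le => //; first exact: ltW.
    by apply: aeW => z; rewrite nc (le_trans (sr z)).
  have mP : measurable_fun setT (fun z => Num.max (r z) 0) by exact: measurable_maxr.
  have mN : measurable_fun setT (fun z => Num.max (- r z) 0).
    by apply: measurable_maxr => //; exact: measurableT_comp.
  have LP : (fun z => (Num.max (r z) 0)%:C) \in L.
    apply: rL => // z; rewrite ger0_norm ?le_max ?lexx ?orbT// ge_max normr_ge0 andbT.
    exact: ler_norm.
  have LN : (fun z => (Num.max (- r z) 0)%:C) \in L.
    apply: rL => // z; rewrite ger0_norm ?le_max ?lexx ?orbT// ge_max normr_ge0 andbT.
    by rewrite -normrN ler_norm.
  split; first exact: rL.
  have -> : (fun z => (r z)%:C) =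
      (fun z => (Num.max (r z) 0)%:C + -1 * (Num.max (- r z) 0)%:C) :> (T -> R[i]).
    apply/funext => z; rewrite mulN1r -rmorphB/=; congr (_%:C).
    exact/esym/max0B.
  rewrite toLpD// ?toLpZ//; last exact: (LfunCZ (ltW p1)).
  apply: PD; last apply: PZ; apply: closed_subspace_ge0 => //.
  - by move=> z; rewrite le_max lexx orbT.
  - by move=> z; rewrite le_max lexx orbT.
have [RL PR] := real_part _ mRe (fun z => normc_Re (x z)).
have [IL PI] := real_part _ mIm (fun z => normc_Im (x z)).
have -> : x = inLp (fun z => (complex.Re (x z))%:C) +
    'i%C *: inLp (fun z => (complex.Im (x z))%:C).
  rewrite -toLpZ// -toLpD//; last exact: (LfunCZ (ltW p1)).
  rewrite -[LHS]toLpK; congr toLp; apply/funext => z; exact: complexE.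
by apply: PD => //; exact: PZ.
Qed.

End dominated.

(** * Completeness of L^p *)

Section riesz_fischer.
Context d (T : measurableType d) (R : realType).
Variables (mu : {finite_measure set T -> \bar R}) (p : R) (p1 : 1 < p).
Local Notation Lp := (LpC mu (ltW p1)).
Local Notation L := (LfunC mu p).
Local Notation inLp := (toLp mu (ltW p1)).

Lemma LfunC_powR (f : T -> R[i]) : measurable_fun setT f ->
  (\int[mu]_z ((normc (f z)) `^ p)%:E < +oo)%E -> f \in L.
Proof.
move=> mf fi; apply/LfunCP; split => //; rewrite /LnormC unlock /=.
apply: poweR_lty; apply: le_lt_trans fi.
rewrite (@eq_integral _ _ _ mu setT (fun z => ((normc (f z)) `^ p)%:E))// => z _ /=.
by rewrite ger0_norm ?normc_ge0.
Qed.

Variables (v : nat -> Lp) (b : nat -> R) (B : R).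
Hypothesis vb : forall n, nrm (v n) <= b n.
Hypothesis bB : forall N, \sum_(0 <= n < N) b n <= B.

Let h N z := \sum_(0 <= n < N) normc (v n z).

Let h0 N z : 0 <= h N z.
Proof. by apply: sumr_ge0 => n _; exact: normc_ge0. Qed.

Let mh N : measurable_fun setT (h N).
Proof.
apply: measurable_sum => n; apply: measurable_normcT; exact: LpC_fun_measurable.
Qed.

Let h_nd z N N' : (N <= N')%N -> h N z <= h N' z.
Proof.
move=> NN; rewrite /h (@big_cat_nat _ _ _ N 0 N')//= lerDl.
by apply: sumr_ge0 => n _; exact: normc_ge0.
Qed.

Let p0 : 0 < p. Proof. exact: lt_trans p1. Qed.

Let hL N : (fun z => (h N z)%:C) \in L.
Proof.
rewrite (_ : (fun _ => _) = (fun z => \sum_(0 <= n < N) (normc (v n z))%:C)).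
  apply: (LfunC_sum (ltW p1)) => n; have /LfunCP[mv vf] := LpC_funL (v n).
  apply/LfunCP; split.
    by apply/measurable_complexP; split; [exact: measurable_normcT|exact: measurable_cst].
  apply: le_lt_trans vf; apply: LnormC_ae_le => //; first exact: ltW.
    by apply/measurable_complexP; split; [exact: measurable_normcT|exact: measurable_cst].
  by apply: aeW => z; rewrite /= expr0n addr0 sqrtr_sqr ger0_norm ?normc_ge0.
by apply/funext => z; rewrite rmorph_sum.
Qed.

Let h_int N : (\int[mu]_z ((h N z) `^ p)%:E <= (B `^ p)%:E)%E.
Proof.
have -> : (\int[mu]_z ((h N z) `^ p)%:E = (nrm (inLp (fun z => (h N z)%:C)) `^ p)%:E)%E.
  rewrite (nrm_toLp_powR (ltW p1) (hL N)); apply: eq_integral => z _.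
  by rewrite [normc _](_ : _ = h N z)//= expr0n addr0 sqrtr_sqr ger0_norm.
have hB : nrm (inLp (fun z => (h N z)%:C)) <= B.
  apply: le_trans (bB N).
  have mv n : measurable_fun setT (fun z => (normc (v n z))%:C : R[i]).
    apply/measurable_complexP; split; last exact: measurable_cst.
    by apply: measurable_normcT; exact: LpC_fun_measurable.
  have nc n z : normc ((normc (v n z))%:C : R[i]) = normc (v n z).
    by rewrite /= expr0n addr0 sqrtr_sqr ger0_norm ?normc_ge0.
  have vL n : (fun z => (normc (v n z))%:C) \in L.
    have /LfunCP[mvn vf] := LpC_funL (v n); apply/LfunCP; split => //.
    apply: le_lt_trans vf; apply: LnormC_ae_le => //; first exact: ltW.
    by apply: aeW => z; rewrite nc.
  have -> : (fun z => (h N z)%:C) = (fun z => \sum_(0 <= n < N) (normc (v n z))%:C) :> (T -> R[i]).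
    by apply/funext => z; rewrite rmorph_sum.
  rewrite toLp_sum//; apply: (le_trans (nrm_sum _ _ _)); apply: ler_sum => n _.
  apply: le_trans (vb n); apply: nrm_ae_le.
  by apply: filterS (toLp_ae (ltW p1) (vL n)) => z ->; rewrite nc.
rewrite lee_fin; apply: ge0_ler_powR; rewrite ?nnegrE ?nrm_ge0// ?(ltW p0)//.
exact: le_trans (nrm_ge0 _) hB.
Qed.

(* G is the p-th power of the sum of all normc (v n z). It is integrable, hence
   finite on a set A of full measure, on which g dominates the partial sums. *)
Let hp z N := ((h N z) `^ p)%:E.
Let G z := ereal_sup (range (hp z)).

Let G_nd z : nondecreasing_seq (hp z).
Proof.
move=> N N' NN; rewrite lee_fin; apply: ge0_ler_powR; rewrite ?nnegrE ?h0 ?(ltW p0)//.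
exact: h_nd.
Qed.

Let cG z : hp z @ \oo --> G z.
Proof. exact: ereal_nondecreasing_cvgn (@G_nd z). Qed.

Let hG z N : (((h N z) `^ p)%:E <= G z)%E.
Proof. by apply: ereal_sup_ubound; exists N. Qed.

Let mhp N : measurable_fun setT (fun z => hp z N).
Proof.
by apply/measurable_EFinP; apply: (measurableT_comp (measurable_powR p)).
Qed.

Let mG : measurable_fun setT G.
Proof. by apply: (emeasurable_fun_cvg (fun N z => hp z N) _ mhp) => z _; exact: cG. Qed.

Let G0 z : (0 <= G z)%E.
Proof. by apply: le_trans (hG z 0); rewrite lee_fin powR_ge0. Qed.

Let G_int : (\int[mu]_z G z < +oo)%E.
Proof.
have hp0 N z : (0 <= hp z N)%E by rewrite lee_fin powR_ge0.
have -> : G = (fun z : T => limn (fun N => hp z N)).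
  by apply/funext => z; rewrite (cvg_lim _ (@cG z)).
rewrite (@monotone_convergence _ _ _ mu setT measurableT (fun N z => hp z N))//.
  apply: (@le_lt_trans _ _ (B `^ p)%:E); last exact: ltry.
  apply: lime_le; last by apply: nearW => N; exact: h_int.
  apply: ereal_nondecreasing_is_cvgn => N N' NN.
  by apply: ge0_le_integral => // z _; exact: G_nd.
Qed.

Let A := [set z | (G z < +oo)%E].

Let mA : measurable A.
Proof. by rewrite -[A]setTI; exact: emeasurable_fun_infty_o. Qed.

Let A_ae : {ae mu, forall z, A z}.
Proof.
have iG : mu.-integrable setT G.
  apply/integrableP; split => //.
  by rewrite (eq_integral G)// => z _; rewrite gee0_abs.
by apply: filterS (integrable_ae measurableT iG) => z /(_ I); rewrite ge0_fin_numE.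
Qed.

Let g z := (fine (G z)) `^ p^-1.

Let gp z : g z `^ p = fine (G z).
Proof. by rewrite /g -powRrM mulVf ?gt_eqF// powRr1// fine_ge0. Qed.

Let mg : measurable_fun setT g.
Proof.
apply: (measurableT_comp (measurable_powR _)).
exact: (measurableT_comp (fine_measurable measurableT)).
Qed.

Let nc (r : R) : 0 <= r -> normc (r%:C : R[i]) = r.
Proof. by move=> r0; rewrite /= expr0n addr0 sqrtr_sqr ger0_norm. Qed.

Let gL : (fun z => (g z)%:C) \in L.
Proof.
apply: LfunC_powR.
  by apply/measurable_complexP; split; [exact: mg|exact: measurable_cst].
apply: le_lt_trans G_int; apply: ge0_le_integral => //.
- by move=> z _; rewrite lee_fin powR_ge0.
- apply: measurable_powR_normc.
  by apply/measurable_complexP; split; [exact: mg|exact: measurable_cst].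
- move=> z _; rewrite nc ?powR_ge0// gp; have := G0 z.
  by case: (G z) => //= _; rewrite leey.
Qed.

Let hg z N : A z -> h N z <= g z.
Proof.
move=> Az; rewrite leNgt; apply/negP => gh.
have : g z `^ p < h N z `^ p by rewrite gt0_ltr_powR// ?nnegrE ?powR_ge0.
rewrite ltNge gp -lee_fin fineK; first by rewrite hG.
by rewrite ge0_fin_numE.
Qed.

(** Partial sums cut off outside [A], so that they converge at every point and their limit is
    measurable. *)
Let s N (z : T) : R[i] := indC R A z * \sum_(0 <= n < N) v n z.

Let sA N z : A z -> s N z = \sum_(0 <= n < N) v n z.
Proof. by move=> Az; rewrite /s /indC mem_set// mul1r. Qed.

Let sNA N z : ~ A z -> s N z = 0.
Proof. by move=> Az; rewrite /s /indC memNset// mul0r. Qed.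

Let s_g N z : normc (s N z) <= g z.
Proof.
have [Az|nAz] := pselect (A z); last by rewrite sNA// [normc _]normc0 powR_ge0.
rewrite sA//; apply: le_trans (hg N Az); rewrite /h.
elim: N => [|N IH]; first by rewrite !big_geq// [normc _]normc0.
by rewrite !big_nat_recr//= (le_trans (le_normcD _ _))// lerD.
Qed.

(** For [c] the real or the imaginary part: constant off [A], and on [A] an absolutely convergent
    series dominated by [g]. *)
Let cvg_part (c : R[i] -> R) : (forall x y, c (x + y) = c x + c y) -> c 0 = 0 ->
  (forall x, `|c x| <= normc x) -> forall z, cvgn (fun N => c (s N z)).
Proof.
move=> cD c0 cn z; have [Az|nAz] := pselect (A z); last first.
  rewrite (_ : (fun _ => _) = cst 0); first exact: is_cvg_cst.
  by apply/funext => N; rewrite sNA.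
rewrite (_ : (fun _ => _) = series (fun n => c (v n z))).
  apply: normed_cvg; apply: nondecreasing_is_cvgn.
    by apply: nondecreasing_series => n _ _; exact: normr_ge0.
  exists (g z) => _ [N _ <-]; apply: le_trans (hg N Az).
  change (\sum_(0 <= n < N) `|c (v n z)| <= h N z).
  by apply: ler_sum => n _.
apply/funext => N; rewrite sA// /series /=.
by elim: N => [|N IH]; [rewrite !big_geq|rewrite !big_nat_recr//= cD IH].
Qed.

Let cRe z : cvgn (fun N => complex.Re (s N z)).
Proof. by apply: cvg_part => //; [case=> ? ? []|exact: normc_Re]. Qed.

Let cIm z : cvgn (fun N => complex.Im (s N z)).
Proof. by apply: cvg_part => //; [case=> ? ? []|exact: normc_Im]. Qed.

Let f z : R[i] := limn (fun N => complex.Re (s N z)) +i* limn (fun N => complex.Im (s N z)).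

Let sf z (e : R) : 0 < e -> exists N, forall n, (N <= n)%N -> normc (s n z - f z) < e.
Proof.
move=> e0; have e20 : 0 < e / 2 by rewrite divr_gt0.
have /cvgrPdist_lt/(_ _ e20)[N1 _ H1] := @cRe z.
have /cvgrPdist_lt/(_ _ e20)[N2 _ H2] := @cIm z.
exists (maxn N1 N2) => n; rewrite geq_max => /andP[n1 n2].
apply: (le_lt_trans (normc_leD _)); rewrite [e]splitr.
have := H1 n n1; have := H2 n n2; rewrite /= distrC [in X in _ -> X -> _]distrC => h2 h1.
by apply: ltrD; [move: h1|move: h2]; rewrite /f; case: (s n z).
Qed.

Let sL N : s N \in L.
Proof.
apply: LfunC_powR; last first.
  have /LfunCP[mgC _] := gL.
  apply: (@le_lt_trans _ _ (\int[mu]_z ((normc ((g z)%:C : R[i])) `^ p)%:E)%E).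
    apply: ge0_le_integral => //.
    + by move=> z _; rewrite lee_fin powR_ge0.
    + apply: measurable_powR_normc; apply: measurable_complexM.
        by have /LfunCP[] := indC_LfunC mu p1 mA.
      have /LfunCP[] : (fun z => \sum_(0 <= n < N) v n z) \in L.
        by apply: (LfunC_sum (ltW p1)) => n; exact: LpC_funL.
      by [].
    + exact: measurable_powR_normc.
    + move=> z _; rewrite lee_fin; apply: ge0_ler_powR; rewrite ?nnegrE ?normc_ge0 ?(ltW p0)//.
      by rewrite nc ?powR_ge0.
  by rewrite -(nrm_toLp_powR (ltW p1) gL) ltry.
apply: measurable_complexM; first by have /LfunCP[] := indC_LfunC mu p1 mA.
have /LfunCP[] : (fun z => \sum_(0 <= n < N) v n z) \in L.
  by apply: (LfunC_sum (ltW p1)) => n; exact: LpC_funL.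
by [].
Qed.

Let f_g z : normc (f z) <= g z.
Proof.
apply/ler_addgt0Pr => e e0; have [N HN] := sf z e0.
have := HN N (leqnn N) => h1.
have -> : f z = s N z - (s N z - f z) by rewrite opprB addrCA subrr addr0.
apply: (le_trans (le_normcD _ _)); rewrite [normc (- _)]normcN lerD ?s_g//.
exact: ltW.
Qed.

Let fL : f \in L.
Proof.
have mf : measurable_fun setT f.
  apply/measurable_complexP; split.
    apply: (measurable_fun_cvg (h := fun N z => complex.Re (s N z))) => [N|z _]; last exact: cRe.
    by have /LfunCP[/measurable_complexP[]] := sL N.
  apply: (measurable_fun_cvg (h := fun N z => complex.Im (s N z))) => [N|z _]; last exact: cIm.
  by have /LfunCP[/measurable_complexP[]] := sL N.
have /LfunCP[mgC gfin] := gL.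
apply/LfunCP; split => //; apply: le_lt_trans gfin.
apply: LnormC_ae_le => //; first exact: ltW.
by apply: aeW => z; rewrite nc ?powR_ge0.
Qed.

(** Completeness in the form of absolutely summable series; it provides the limit point in
    [totally_bounded_precompact] and the operator in [operator_series]. *)
Lemma Lp_series_cvg : exists x : Lp, forall e : R, 0 < e ->
  exists N, forall n, (N <= n)%N -> nrm (\sum_(0 <= i < n) v i - x) < e.
Proof.
exists (inLp f) => e e0.
have [||N HN] := @Lp_dominated _ _ _ mu p p1 s f (2 *: inLp (fun z => (g z)%:C)) sL fL _ _ e e0.
- by apply: aeW => z eps eps0; exact: sf.
- apply: filterS2 (LpC_scaleE 2 (inLp (fun z => (g z)%:C))) (toLp_ae (ltW p1) gL) => z -> -> n.
  rewrite (_ : 2 * (g z)%:C = (2 * g z)%:C); last by rewrite rmorphM rmorph_nat.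
  rewrite nc; last by rewrite mulr_ge0 ?powR_ge0.
  rewrite mulr_natl mulr2n.
  by apply: (le_trans (le_normcD _ _)); rewrite [normc (- _)]normcN lerD.
- exists N => n /HN; congr (nrm (_ - _) < _).
  rewrite -[RHS](eq_bigr _ (fun i _ => toLpK (v i))) -toLp_sum; last by move=> i; exact: LpC_funL.
  apply: toLp_eq => //; first by apply: (LfunC_sum (ltW p1)) => i; exact: LpC_funL.
  by apply: filterS A_ae => z Az; rewrite sA.
Qed.

End riesz_fischer.

(** * Open sets suffice for density; convergence of conditional expectations *)

Section borel_density.
Context (R : realType).
Variables (mu : {finite_measure set R[i] -> \bar R}) (p : R) (p1 : 1 < p).
Local Notation Lp := (LpC mu (ltW p1)).
Local Notation inLp := (toLp mu (ltW p1)).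

(** Dynkin's theorem: the sets whose indicator satisfies P form a Dynkin class, and open sets are
    stable under intersection. A disjoint union is treated as the increasing union of its finite
    partial unions. *)
Lemma closed_subspace_borel (P : Lp -> Prop) : closed_subspace P ->
  (forall U : set R[i], open U -> P (inLp (indC R U))) -> forall x, P x.
Proof.
move=> cP PU; apply: (closed_subspace_full cP) => A mA.
apply: (@dynkin_induction _ R[i] (@open R[i]) (fun A => P (inLp (indC R A)))) => //.
- by move=> U V oU oV; exact: openI.
- exact/PU/openT.
- move=> S mS PS.
  have -> : inLp (indC R (~` S)) = inLp (indC R setT) - inLp (indC R S).
    rewrite -scaleN1r -toLpZ ?indC_LfunC// -toLpD ?indC_LfunC//; last first.
      by apply: (LfunCZ (ltW p1)); exact: indC_LfunC.
    congr toLp; apply/funext => z; rewrite /indC in_setT in_setC.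
    by case: (z \in S); rewrite /= ?mulr0 ?mulr1 ?subrr ?addr0.
  by apply: (closed_subspaceB cP) => //; exact/PU/openT.
- move=> F mF tF PF.
  have -> : \bigcup_k F k = \bigcup_n \big[setU/set0]_(k < n) F k.
    apply/seteqP; split => z [k _ Fz].
      by exists k.+1 => //; rewrite -bigcup_mkord; exists k => /=.
    by move: Fz; rewrite -bigcup_mkord => -[j _ Fz]; exists j.
  apply: (closed_subspace_indic_nd cP).
  + by move=> n; exact: bigsetU_measurable.
  + by move=> m n mn; exact: subset_bigsetU.
  + case: cP => PD PZ _; elim=> [|n IH].
      rewrite big_ord0 (_ : indC R set0 = fun=> 0).
        by rewrite toLp0 -(scale0r (inLp (indC R setT))); apply: PZ; exact/PU/openT.
      by apply/funext => z; rewrite /indC in_set0.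
    rewrite big_ord_recr/=.
    have dj z : z \in \big[setU/set0]_(k < n) F k -> z \notin F n.
      rewrite inE -bigcup_mkord => -[k /= kn Fk]; apply/negP; rewrite inE => Fn.
      have := tF k n I I; rewrite /setI; move=> /(_ (ex_intro _ z (conj Fk Fn))) e.
      by move: kn; rewrite e ltnn.
    have -> : indC R (\big[setU/set0]_(k < n) F k `|` F n) =
       (fun z => indC R (\big[setU/set0]_(k < n) F k) z + indC R (F n) z).
      apply/funext => z; rewrite /indC in_setU.
      by have := dj z; case: (z \in _) => [/(_ isT)/negbTE->|_]; rewrite ?addr0 ?add0r.
    rewrite toLpD ?indC_LfunC//; last exact: bigsetU_measurable.
    exact: PD.
Qed.

Variables (node : cellTree R[i]) (S : set R[i]) (delta : nat -> R).
Hypothesis S_ae : {ae mu, forall z, S z}.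
Hypothesis diam : forall k z z', S z -> S z' -> node k z = node k z' -> normc (z - z') <= delta k.
Hypothesis delta_small : forall e : R, 0 < e -> exists k, delta k < e.
Local Notation condE := (condE node).

(** The uniform bound [nrm_condE] makes the set of good x a closed subspace. Up to a null set, an
    open set is the increasing union of unions [V k] of cells of depth k, whose indicators are fixed
    by [condE] from depth k on. *)
Lemma condE_cvg (x : Lp) (e : R) : 0 < e ->
  exists K, forall k, (K <= k)%N -> nrm (condE k x - x) < e.
Proof.
pose P (x : Lp) := forall e : R, 0 < e -> exists K, forall k, (K <= k)%N -> nrm (condE k x - x) < e.
suff : P x by exact.
have cP : closed_subspace P.
  split.
  - move=> y y' Py Py' eps eps0.
    have [K HK] := Py _ ltac:(exact: divr_gt0 eps0 (ltr0n _ 2)).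
    have [K' HK'] := Py' _ ltac:(exact: divr_gt0 eps0 (ltr0n _ 2)).
    exists (maxn K K') => k; rewrite geq_max => /andP[/HK h /HK' h'].
    rewrite condED opprD addrACA (le_lt_trans (nrmD _ _))// [eps]splitr; exact: ltrD.
  - move=> a y Py eps eps0; have a0 : 0 < normc a + 1 by rewrite ltr_wpDl ?normc_ge0.
    have [K HK] := Py _ (divr_gt0 eps0 a0).
    exists K => k /HK; rewrite condEZ -scalerBr nrmZ ltr_pdivlMr// mulrC.
    by apply: le_lt_trans; rewrite ler_wpM2r ?nrm_ge0// lerDl.
  - move=> y Py eps eps0; have e4 : 0 < eps / 4 by rewrite divr_gt0.
    have [y' Py' yy'] := Py _ e4; have [K HK] := Py' _ e4.
    exists K => k /HK h.
    have -> : condE k y - y = condE k (y - y') + (condE k y' - y') + (y' - y).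
      by rewrite condEB !addrA !subrK.
    have h2 := nrm_condE node k (y - y').
    have yy : nrm (y - y') < eps / 4 by rewrite -nrmN opprB.
    have := nrmD (condE k (y - y') + (condE k y' - y')) (y' - y).
    have := nrmD (condE k (y - y')) (condE k y' - y').
    lra.
apply: (closed_subspace_borel cP) => U oU.
(* Only points of [S] are tested, since [diam] controls a cell only within [S]. *)
pose good k i : bool := `[< forall z, S z -> node k z = i -> U z >].
pose V k := [set z | good k (node k z)].
have VE k : indC R (V k) = (fun i => (good k i)%:R) \o node k.
  apply/funext => z; rewrite /indC /V /=; congr (nat_of_bool _)%:R.
  by apply/idP/idP; rewrite inE.
have mV k : measurable (V k).
  rewrite (_ : V k = node k @^-1` [set i | good k i])//.
  by rewrite -[X in measurable X]setTI; apply: measurable_node.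
have VS k z : V k z -> V k.+1 z.
  move=> /asboolP h; apply/asboolP => z' Sz' nE; apply: h => //.
  by rewrite -(tree_nodeS node k z') nE tree_nodeS.
have Vnd m n : (m <= n)%N -> V m `<=` V n.
  move=> /subnK<-; elim: (n - m)%N => [//|j IH] z /IH; rewrite addSn; exact: VS.
have UV z : S z -> U z <-> (\bigcup_k V k) z.
  move=> Sz; split => [Uz|[k _ /asboolP]]; last exact.
  have /nbhsCP[r r0 rU] : nbhs z U by exact: open_nbhs_nbhs.
  have [k kr] := delta_small r0; exists k => //; apply/asboolP => z' Sz' nE.
  by apply: rU; apply: le_lt_trans kr; apply: diam.
have -> : inLp (indC R U) = inLp (indC R (\bigcup_k V k)).
  apply: toLp_eq.
  - exact: (indC_LfunC mu p1 (openC_measurable oU)).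
  - by apply: (indC_LfunC mu p1); exact: bigcup_measurable.
  - apply: filterS S_ae => z /UV [h1 h2]; rewrite /indC; congr (nat_of_bool _)%:R.
    by apply/idP/idP; rewrite !inE.
apply: (closed_subspace_indic_nd cP) => // n eps eps0.
exists n => k nk; rewrite VE -[X in condE k X]/(step _ _ node n _).
by rewrite condE_step_le// subrr nrm0.
Qed.

End borel_density.

(** * The tree of dyadic squares *)

Section binary_digits.
Context {R : realType}.

(** The binary digit of weight 2^-(j+1). An integer and its absolute value have the same parity, so
    negative x are covered. *)
Definition digit (x : R) (j : nat) : bool := odd `|Num.floor (2 ^+ j.+1 * x)|%N.

Lemma floor_digit (x : R) j :
  Num.floor (2 ^+ j.+1 * x) = 2 * Num.floor (2 ^+ j * x) + (digit x j)%:Z.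
Proof.
rewrite /digit exprS -mulrA; set y := 2 ^+ j * x.
have /andP[h1 h2] := floor_itv y; have /andP[h3 h4] := floor_itv (2 * y).
have : ((2 * Num.floor y)%:~R <= 2 * y :> R) by rewrite intrM ler_pM2l.
rewrite -floor_ge_int => h5.
have : (2 * y < (2 * (Num.floor y + 1))%:~R :> R) by rewrite intrM ltr_pM2l.
rewrite -floor_lt_int => h6.
by move: h5 h6; move: (Num.floor (2 * y)) (Num.floor y) => a b; lia.
Qed.

Lemma digit_close (x x' : R) k : Num.floor x = Num.floor x' ->
  (forall j, (j < k)%N -> digit x j = digit x' j) -> `|x - x'| <= 2 ^- k.
Proof.
move=> e0 ej.
have e : Num.floor (2 ^+ k * x) = Num.floor (2 ^+ k * x').
  elim: k ej => [|k IH] ej; first by rewrite expr0 !mul1r.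
  by rewrite !floor_digit IH ?ej// => j jk; apply: ej; rewrite ltnS ltnW.
have /andP[h1 h2] := floor_itv (2 ^+ k * x).
have /andP[h3 h4] := floor_itv (2 ^+ k * x').
have k0 : 0 < 2 ^+ k :> R by rewrite exprn_gt0.
rewrite -[2 ^- k]mul1r ler_pdivlMr// -[X in _ * X](gtr0_norm k0) -normrM mulrC mulrBr.
move: h1 h2 h3 h4; rewrite e intrD; move: (Num.floor _)%:~R => f h1 h2 h3 h4.
by rewrite ler_norml; apply/andP; split; lra.
Qed.

Lemma measurable_digit d (T : measurableType d) (f : T -> R) j :
  measurable_fun setT f -> measurable_fun setT (fun z => digit (f z) j).
Proof.
move=> mf; apply: (measurable_fun_bool true); rewrite setTI.
pose g z := 2 ^+ j.+1 * f z.
have mg : measurable_fun setT g by exact: measurable_funM.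
rewrite (_ : _ @^-1` _ = \bigcup_(m : int)
   (if odd `|m|%N then g @^-1` [set` `[m%:~R, (m + 1)%:~R[] else set0)).
  apply: countable_bigcupT_measurable => // m; case: ifP => // _.
  by rewrite -[X in measurable X]setTI; apply: mg => //; exact: measurable_itv.
apply/seteqP; split => z /=.
  rewrite /digit -/(g z) => h; exists (Num.floor (g z)) => //; rewrite h /=.
  by rewrite in_itv/= floor_itv.
move=> [m _]; case: ifP => // om; rewrite /= in_itv/= => h.
by rewrite /digit -/(g z) (floor_def h).
Qed.

End binary_digits.

Section dyadic_tree.
Context (R : realType) (s : R).
Hypothesis s0 : 0 < s.

(* The square ]-s, s[^2 is rescaled to ]0, 1[^2; digits of the real part are read
   at even depths and digits of the imaginary part at odd depths. *)
Definition square_coord (k : nat) (z : R[i]) : R :=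
  ((if odd k then complex.Im z else complex.Re z) + s) / (2 * s).

Definition square_bit k (z : R[i]) : bool := digit (square_coord k z) k./2.

Fixpoint square_node k (z : R[i]) : nat :=
  if k is k'.+1 then (square_bit k' z + (square_node k' z).*2)%N else 1%N.

Lemma square_node_half k z : (square_node k.+1 z)./2 = square_node k z.
Proof. by rewrite /= half_bit_double. Qed.

Lemma measurable_square_node k : measurable_fun setT (square_node k).
Proof.
elim: k => [|k IH]; first exact: measurable_cst.
rewrite (_ : square_node k.+1 = fun z => if square_bit k z then (square_node k z).*2.+1
   else (square_node k z).*2).
  apply: measurable_fun_ifT.
  - apply: measurable_digit; rewrite /square_coord.
    apply: measurable_funM => //; apply: measurable_funD => //.
    have [mR mI] := (iffLR (measurable_complexP (@id R[i]))) (@measurable_id _ _ _).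
    by case: (odd k); [exact: mI|exact: mR].
  - exact: (measurableT_comp (f := fun n => n.*2.+1)).
  - exact: (measurableT_comp (f := double)).
by apply/funext => z /=; case: square_bit.
Qed.

Definition square_tree : cellTree R[i] :=
  CellTree measurable_square_node (fun=> erefl) square_node_half.

Lemma square_node_bits k z z' : square_node k z = square_node k z' ->
  forall j, (j < k)%N -> square_bit j z = square_bit j z'.
Proof.
elim: k => [//|k IH] e j; rewrite ltnS leq_eqVlt => /predU1P[->|jk].
  by have := congr1 odd e; rewrite /= !oddD !odd_double !addbF !oddb.
by apply: IH jk; rewrite -(square_node_half k z) e square_node_half.
Qed.

(** A node of depth k fixes at least k./2 digits of each coordinate, hence each coordinate up to 2 s
    2^-(k./2); the two are added. The strict bounds put the rescaled coordinates in ]0, 1[, where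
    the integer part is 0. *)
Lemma square_node_close k z z' : normc z < s -> normc z' < s ->
  square_tree k z = square_tree k z' -> normc (z - z') <= 4 * s * 2 ^- k./2.
Proof.
move=> zs zs' /square_node_bits H.
have s20 : 0 < 2 * s by rewrite mulr_gt0.
have fl0 (u : R) : `|u| < s -> Num.floor ((u + s) / (2 * s)) = 0.
  rewrite ltr_norml => /andP[h1 h2]; apply: floor_def.
  rewrite divr_ge0/=; [|lra..].
  by rewrite add0r ltr_pdivrMr// mul1r; lra.
have close (u u' : R) : `|u| < s -> `|u'| < s ->
    (forall j, (j < k./2)%N -> digit ((u + s) / (2 * s)) j = digit ((u' + s) / (2 * s)) j) ->
    `|u - u'| <= 2 * s * 2 ^- k./2.
  move=> hu hu' hd; have := digit_close (etrans (fl0 _ hu) (esym (fl0 _ hu'))) hd.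
  have -> : (u + s) / (2 * s) - (u' + s) / (2 * s) = (u - u') / (2 * s).
    by rewrite -mulrBl; congr (_ / _); ring.
  by rewrite normrM normfV (gtr0_norm s20) ler_pdivrMr// [X in _ <= X -> _]mulrC.
have jk j : (j < k./2)%N -> (j.*2.+1 < k)%N by lia.
have cR : `|complex.Re z - complex.Re z'| <= 2 * s * 2 ^- k./2.
  apply: close; [exact: le_lt_trans (normc_Re _) zs|exact: le_lt_trans (normc_Re _) zs'|].
  move=> j /jk hj; have := H j.*2 (ltnW hj).
  by rewrite /square_bit /square_coord odd_double doubleK.
have cI : `|complex.Im z - complex.Im z'| <= 2 * s * 2 ^- k./2.
  apply: close; [exact: le_lt_trans (normc_Im _) zs|exact: le_lt_trans (normc_Im _) zs'|].
  move=> j /jk hj; have := H j.*2.+1 hj.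
  by rewrite /square_bit /square_coord /= odd_double uphalf_double.
apply: (le_trans (normc_leD _)).
have -> : 4 * s * 2 ^- k./2 = 2 * s * 2 ^- k./2 + 2 * s * 2 ^- k./2 by ring.
by apply: lerD; rewrite raddfB; [exact: cR|exact: cI].
Qed.

(** Each exponent k./2 occurs twice, so the bound is twice the geometric sum 2. *)
Lemma sum_half_pow N : \sum_(0 <= k < N) 2 ^- k./2 <= 4 :> R.
Proof.
have geo n : \sum_(0 <= k < n) 2 ^- k = 2 - 2 * 2 ^- n :> R.
  elim: n => [|n IH]; first by rewrite big_geq// expr0 invr1 mulr1 subrr.
  by rewrite big_nat_recr//= IH exprS invfM; field; rewrite expf_neq0.
have pos k : 0 <= 2 ^- k :> R by rewrite invr_ge0 exprn_ge0.
apply: (@le_trans _ _ (\sum_(0 <= k < N.*2) 2 ^- k./2)).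
  rewrite (@big_cat_nat _ _ _ N 0 N.*2)//= -?addnn ?leq_addr// lerDl.
  by apply: sumr_ge0 => k _; exact: pos.
rewrite -{1}[0%N]/(0.*2) big_nat_double (eq_bigr (fun k => 2 * 2 ^- k)).
  by rewrite -mulr_sumr geo; have := pos N; lra.
by move=> k _; rewrite doubleK /= uphalf_double mulr_natl mulr2n.
Qed.

End dyadic_tree.

(** * Compact operators as norm convergent series *)

Section compactness.
Context d (T : measurableType d) (R : realType).
Variables (mu : {finite_measure set T -> \bar R}) (p : R) (p1 : 1 < p).
Local Notation Lp := (LpC mu (ltW p1)).

Lemma nbhs_LpP (x : Lp) (U : set Lp) : nbhs x U <->
  exists2 r : R, 0 < r & forall y, nrm (x - y) < r -> U y.
Proof.
split.
- move=> /nbhs_ballP[e /= e0 xeU].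
  have eE : e = (complex.Re e)%:C.
    by case: e e0 {xeU} => a b; rewrite ltcE /= => /andP[/eqP -> _].
  exists (complex.Re e); first by move: e0; rewrite ltcE => /andP[].
  by move=> y xy; apply: xeU; rewrite -ball_normE /ball_ /= normE eE ltcR.
- move=> [r r0 H]; apply/nbhs_ballP; exists r%:C => /=; first by rewrite ltcR.
  by move=> y; rewrite -ball_normE /ball_ /= normE ltcR => /H.
Qed.

Definition totally_bounded (A : set Lp) := forall e : R, 0 < e ->
  exists s : seq Lp, forall x, A x -> exists2 y, y \in s & nrm (x - y) < e.

Lemma ultra_seq (I : eqType) (X : Type) (F : set_system X) (s : seq I) (B : I -> set X) :
  UltraFilter F -> F [set x | exists2 y, y \in s & B y x] -> exists y, F (B y).
Proof.
move=> UF; elim: s => [|y s IH] Fs.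
  have /filter_ex[x [y //]] := Fs.
have [FB|FB] := in_ultra_setVsetC (B y) UF; first by exists y.
apply: IH; apply: filterS2 Fs FB => x [y' + By'] nB.
by rewrite inE => /predU1P[e|y's]; [move: nB; rewrite -e|exists y'].
Qed.

(** An ultrafilter containing the closure of A contains, for every n, a ball of radius 2^-n. Balls
    of the same filter meet, so their centres form a Cauchy sequence, to whose limit the ultrafilter
    converges. *)
Lemma totally_bounded_precompact (A : set Lp) : totally_bounded A -> precompact A.
Proof.
move=> tA; rewrite precompactE compact_ultra => F UF FA.
pose e n : R := 2 ^- n.
have e0 n : 0 < e n by rewrite invr_gt0 exprn_gt0.
have exy n : exists y : Lp, F [set x | nrm (x - y) < e n].
  have en2 : 0 < e n / 2 by rewrite divr_gt0.
  have [s Hs] := tA _ en2.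
  apply: (@ultra_seq _ _ F s (fun y => [set x | nrm (x - y) < e n])) => //.
  apply: filterS FA => x /= cAx.
  have [x' [Ax' xx']] : (A `&` [set x' | nrm (x - x') < e n / 2]) !=set0.
    by apply: cAx; apply/nbhs_LpP; exists (e n / 2).
  have [y ys x'y] := Hs _ Ax'; exists y => //=.
  have -> : x - y = (x - x') + (x' - y) by rewrite addrA subrK.
  by rewrite (le_lt_trans (nrmD _ _))// [e n]splitr ltrD.
have [y Fy] := choice exy.
have yy n : nrm (y n.+1 - y n) <= 2 * e n.
  have [x [x1 x2]] := filter_ex (filterI (Fy n.+1) (Fy n)).
  have -> : y n.+1 - y n = (x - y n) - (x - y n.+1) by rewrite opprB [RHS]addrC addrA subrK.
  have en : e n = 2 * e n.+1 by rewrite /e exprS; field; rewrite expf_neq0.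
  have := e0 n.+1.
  by move: x1 x2 => /= x1 x2 ? ; have := nrmB (x - y n) (x - y n.+1); lra.
have sume N : \sum_(0 <= n < N) 2 * e n <= 4.
  suff -> : \sum_(0 <= n < N) 2 * e n = 4 - 4 * e N by have := e0 N; lra.
  elim: N => [|N IH]; first by rewrite big_geq// /e expr0 invr1 mulr1 subrr.
  by rewrite big_nat_recr//= IH /e exprS invfM; field; rewrite expf_neq0.
have [x0 Hx0] := Lp_series_cvg yy sume.
pose x := x0 + y 0%N.
have yx r : 0 < r -> exists N, forall n, (N <= n)%N -> nrm (y n - x) < r.
  move=> /Hx0[N HN]; exists N => n /HN; rewrite telescope_sumr//.
  by rewrite /x [x0 + _]addrC opprD addrA.
have Fx : F --> x.
  move=> U /nbhs_LpP[r r0 rU]; have r2 : 0 < r / 2 by rewrite divr_gt0.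
  have [N HN] := yx _ r2.
  have [N' HN'] : exists N', forall n, (N' <= n)%N -> e n < r / 2.
    exists (Num.truncn (2 / r)).+1 => n hn.
    rewrite /e -[ltRHS]invrK ltf_pV2 ?posrE ?invr_gt0 ?exprn_gt0// invf_div.
    apply: (lt_trans (truncnS_gt _)); rewrite -natrX ltr_nat.
    by rewrite (leq_ltn_trans hn)// ltn_expl.
  have := Fy (maxn N N'); apply: filterS => z /= hz; apply: rU.
  have -> : x - z = - ((z - y (maxn N N')) + (y (maxn N N') - x)).
    by rewrite addrA subrK opprB.
  rewrite nrmN (le_lt_trans (nrmD _ _))// [r]splitr ltrD//.
    by rewrite (lt_trans hz)// HN'// leq_maxr.
  by rewrite HN// leq_maxl.
exists x; split => //.
have /closure_id -> : closed (closure A) by exact: closed_closure.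
by move=> U /Fx FU; have [z [Uz Az]] := filter_ex (filterI FU FA); exists z.
Qed.

Lemma totally_bounded_add (A B : set Lp) : totally_bounded A -> totally_bounded B ->
  totally_bounded [set x | exists2 a, A a & exists2 b, B b & x = a + b].
Proof.
move=> tA tB e e0; have e2 : 0 < e / 2 by rewrite divr_gt0.
have [s Hs] := tA _ e2; have [t Ht] := tB _ e2.
exists [seq x + y | x <- s, y <- t] => _ [a Aa [b Bb ->]].
have [x xs ax] := Hs _ Aa; have [y yt bY] := Ht _ Bb.
exists (x + y); first exact: allpairs_f.
by rewrite opprD addrACA (le_lt_trans (nrmD _ _))// [e]splitr ltrD.
Qed.

Lemma totally_bounded_segment (c : R) (v : Lp) :
  totally_bounded [set x | exists2 t : R, `|t| <= c & x = t%:C *: v].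
Proof.
move=> e e0; pose h := e / (nrm v + 1).
have v1 : 0 < nrm v + 1 by rewrite ltr_wpDl ?nrm_ge0.
have h0 : 0 < h by rewrite divr_gt0.
pose s := [seq (j%:R * h - c)%:C *: v | j <- iota 0 (Num.truncn (2 * c / h)).+1].
exists s => _ [t tc ->]; move: tc; rewrite ler_norml => /andP[ct tc].
pose j := Num.truncn ((t + c) / h).
have tch : 0 <= (t + c) / h by rewrite divr_ge0 ?(ltW h0)//; lra.
have /andP[j1 j2] := truncn_itv tch.
exists ((j%:R * h - c)%:C *: v).
  apply/mapP; exists j => //; rewrite mem_iota add0n ltnS /j.
  apply: le_truncn; rewrite ler_pM2r ?invr_gt0//; lra.
rewrite -scalerBl nrmZ -rmorphB/= expr0n addr0 sqrtr_sqr.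
move: j1 j2; rewrite -/j ler_pdivlMr// ltr_pdivrMr// -natr1 => j1 j2.
have jh : `|t - (j%:R * h - c)| <= h by rewrite ler_norml; apply/andP; split; lra.
apply: (@le_lt_trans _ _ (h * nrm v)); first by rewrite ler_wpM2r ?nrm_ge0.
rewrite /h mulrAC ltr_pdivrMr//; have := nrm_ge0 v; nra.
Qed.

Lemma totally_boundedS (A B : set Lp) : A `<=` B -> totally_bounded B -> totally_bounded A.
Proof. by move=> AB tB e /tB[s Hs]; exists s => x /AB/Hs. Qed.

(** Each complex coefficient contributes two real segments, in the directions of [v n] and of i
    times [v n]. *)
Lemma totally_bounded_span (c : nat -> R) (v : nat -> Lp) m n :
  totally_bounded [set x | exists2 t : nat -> R[i], (forall j, normc (t j) <= c j) &
                                  x = \sum_(m <= j < n) t j *: v j].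
Proof.
elim: n => [|n IH].
  move=> e e0; exists [:: 0] => _ [t _ ->]; exists 0; first by rewrite inE.
  by rewrite big_geq// subrr nrm0.
have [nm|mn] := ltnP n m.
  move=> e e0; exists [:: 0] => _ [t _ ->]; exists 0; first by rewrite inE.
  by rewrite big_geq// subrr nrm0.
apply: totally_boundedS (totally_bounded_add IH
  (totally_bounded_add (totally_bounded_segment (c n) (v n))
     (totally_bounded_segment (c n) ('i%C *: v n)))) => _ [t tc ->].
exists (\sum_(m <= j < n) t j *: v j); first by exists t.
exists (t n *: v n); last by rewrite big_nat_recr.
exists ((complex.Re (t n))%:C *: v n).
  by exists (complex.Re (t n)) => //; apply: le_trans (tc n); exact: normc_Re.
exists ((complex.Im (t n))%:C *: ('i%C *: v n)).
  by exists (complex.Im (t n)) => //; apply: le_trans (tc n); exact: normc_Im.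
by rewrite scalerA -scalerDl; congr (_ *: _); rewrite {1}[t n]complexE mulrC.
Qed.

Lemma totally_bounded_approx (A : set Lp) :
  (forall e : R, 0 < e -> exists2 B, totally_bounded B &
     forall x, A x -> exists2 y, B y & nrm (x - y) < e) -> totally_bounded A.
Proof.
move=> H e e0; have e2 : 0 < e / 2 by rewrite divr_gt0.
have [B tB AB] := H _ e2; have [s Hs] := tB _ e2.
exists s => x /AB[y /Hs[z zs yz] xy]; exists z => //.
have -> : x - z = (x - y) + (y - z) by rewrite addrA subrK.
by rewrite (le_lt_trans (nrmD _ _))// [e]splitr ltrD.
Qed.

End compactness.

(** * Norm convergent series of operators *)

Section operator_series.
Context d (T : measurableType d) (R : realType).
Variables (mu : {finite_measure set T -> \bar R}) (p : R) (p1 : 1 < p).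
Local Notation Lp := (LpC mu (ltW p1)).

Definition nrm_cvg (s : nat -> Lp) (x : Lp) := forall e : R, 0 < e ->
  exists N, forall n, (N <= n)%N -> nrm (s n - x) < e.

Lemma nrm_cvg_unique s x y : nrm_cvg s x -> nrm_cvg s y -> x = y.
Proof.
move=> sx sy; apply/eqP; rewrite -subr_eq0; apply/eqP/nrm0_eq0/eqP.
rewrite eq_le nrm_ge0 andbT; apply/ler_addgt0Pr => e e0; rewrite add0r.
have e2 : 0 < e / 2 by rewrite divr_gt0.
have [N HN] := sx _ e2; have [N' HN'] := sy _ e2.
have -> : x - y = (s (maxn N N') - y) - (s (maxn N N') - x).
  by rewrite opprB [RHS]addrC addrA subrK.
rewrite (le_trans (nrmB _ _))// [e]splitr lerD// ltW//.
  by rewrite HN'// leq_maxr.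
by rewrite HN// leq_maxl.
Qed.

Lemma nrm_cvgD s s' x x' : nrm_cvg s x -> nrm_cvg s' x' ->
  nrm_cvg (fun n => s n + s' n) (x + x').
Proof.
move=> sx sx' e e0; have e2 : 0 < e / 2 by rewrite divr_gt0.
have [N HN] := sx _ e2; have [N' HN'] := sx' _ e2.
exists (maxn N N') => n; rewrite geq_max => /andP[/HN h /HN' h'].
by rewrite opprD addrACA (le_lt_trans (nrmD _ _))// [e]splitr ltrD.
Qed.

Lemma nrm_cvgZ (a : R[i]) s x : nrm_cvg s x -> nrm_cvg (fun n => a *: s n) (a *: x).
Proof.
move=> sx e e0; have a0 : 0 < normc a + 1 by rewrite ltr_wpDl ?normc_ge0.
have [N HN] := sx _ (divr_gt0 e0 a0).
exists N => k /HN; rewrite -scalerBr nrmZ ltr_pdivlMr// mulrC.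
by apply: le_lt_trans; rewrite ler_wpM2r ?nrm_ge0// lerDl.
Qed.

Lemma series_tail (b : nat -> R) (B : R) : (forall n, 0 <= b n) ->
  (forall N, \sum_(0 <= n < N) b n <= B) ->
  forall e : R, 0 < e -> exists n, forall N, \sum_(n <= k < N) b k <= e.
Proof.
move=> b0 bB e e0; pose s N := \sum_(0 <= n < N) b n.
have nd : nondecreasing_seq s.
  by apply/nondecreasing_seqP => n; rewrite /s big_nat_recr//= lerDl.
have cs : cvgn s.
  by apply: nondecreasing_is_cvgn => //; exists B => _ [N _ <-]; exact: bB.
have /cvgrPdist_lt/(_ _ e0)[n _ Hn] := cs.
exists n => N; have [nN|/ltnW Nn] := leqP n N; last by rewrite big_geq// ltW.
have -> : \sum_(n <= k < N) b k = s N - s n.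
  by rewrite /s (@big_cat_nat _ _ _ n 0 N)//= addrAC subrr add0r.
have := nondecreasing_cvgn_le nd cs N; have := Hn n (leqnn n) => /= h1 h2.
by have := ltr_normlW h1; lra.
Qed.

Variables (A : nat -> Lp -> Lp) (b : nat -> R) (B : R).
Hypothesis AD : forall k x y, A k (x + y) = A k x + A k y.
Hypothesis AZ : forall k (a : R[i]) x, A k (a *: x) = a *: A k x.
Hypothesis Ab : forall k x, nrm (A k x) <= b k * nrm x.
Hypothesis b0 : forall n, 0 <= b n.
Hypothesis bB : forall N, \sum_(0 <= n < N) b n <= B.

(** The series converges in L^p at each x, and its partial sums approximate K uniformly on the unit
    ball, so total boundedness passes to K. *)
Lemma operator_series : exists K : {linear Lp -> Lp},
  [/\ forall x, nrm (K x) <= B * nrm x,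
      forall x, nrm_cvg (fun n => \sum_(0 <= k < n) A k x) (K x) &
      (forall k, totally_bounded [set A k x | x in [set x | nrm x <= 1]]) ->
      totally_bounded [set K x | x in [set x | nrm x <= 1]]].
Proof.
have exK x : exists y, nrm_cvg (fun n => \sum_(0 <= k < n) A k x) y.
  apply: (Lp_series_cvg (b := fun k => b k * nrm x) (B := B * nrm x)) => [k|N].
    exact: Ab.
  by rewrite -mulr_suml ler_wpM2r ?nrm_ge0.
have [K HK] := choice exK.
have Klin : linear K.
  move=> a x y; apply: nrm_cvg_unique (HK (a *: x + y)) _.
  have := nrm_cvgD (nrm_cvgZ a (HK x)) (HK y).
  congr (nrm_cvg _ _); apply/funext => n.
  by rewrite scaler_sumr -big_split/=; apply: eq_bigr => k _; rewrite AD AZ.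
pose KL : {linear Lp -> Lp} := HB.pack K (GRing.isLinear.Build R[i] Lp Lp *:%R K Klin).
(* With n = 0 this is the norm bound on K; with n large it is the uniform approximation. *)
have tail n e x : (forall N, \sum_(n <= k < N) b k <= e) ->
    nrm (K x - \sum_(0 <= k < n) A k x) <= e * nrm x.
  move=> He; apply/ler_addgt0Pr => eta eta0; have [N HN] := HK x _ eta0.
  have := HN (maxn n N) (leq_maxr _ _); set S := \sum_(0 <= k < maxn n N) _ => hS.
  have -> : K x - \sum_(0 <= k < n) A k x = (S - \sum_(0 <= k < n) A k x) - (S - K x).
    by rewrite opprB [RHS]addrC addrA subrK.
  rewrite (le_trans (nrmB _ _))// lerD//; last exact: ltW.
  rewrite /S (@big_cat_nat _ _ _ n 0 (maxn n N))//= ?leq_maxl// addrAC subrr add0r.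
  rewrite (le_trans (nrm_sum _ _ _))//; apply: le_trans (ler_wpM2r (nrm_ge0 x) (He (maxn n N))).
  by rewrite mulr_suml; apply: ler_sum => k _; exact: Ab.
exists KL; split.
- by move=> x; have := tail 0%N B x bB; rewrite big_geq// subr0.
- exact: HK.
- move=> tA; apply: totally_bounded_approx => e e0.
  have e2 : 0 < e / 2 by rewrite divr_gt0.
  have [n Hn] := series_tail b0 bB e2.
  exists [set \sum_(0 <= k < n) A k x | x in [set x | nrm x <= 1]].
    elim: (n) => [|j IH].
      move=> r r0; exists [:: 0] => _ [x _ <-]; exists 0; first by rewrite inE.
      by rewrite big_geq// subrr nrm0.
    apply: totally_boundedS (totally_bounded_add IH (tA j)) => _ [x x1 <-].
    exists (\sum_(0 <= k < j) A k x); first by exists x.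
    by exists (A j x); [exists x|rewrite big_nat_recr].
  move=> _ [x x1 <-]; exists (\sum_(0 <= k < n) A k x); first by exists x.
  apply: le_lt_trans (tail n _ x Hn) _.
  apply: (@le_lt_trans _ _ (e / 2)); last by lra.
  by rewrite ler_piMr// ltW.
Qed.

End operator_series.

(** * Perturbing multiplication to a diagonal operator *)

Section multiplication.
Context (R : realType).
Variables (mu : {finite_measure set R[i] -> \bar R}) (p : R) (p1 : 1 < p).
Local Notation Lp := (LpC mu (ltW p1)).
Hypothesis cS : compact (msupport mu).

Let mae (x : Lp) := mulop_ae x cS.

Lemma mulopD (x y : Lp) : mulop (x + y) = mulop x + mulop y.
Proof.
apply: LpC_ext.
have h : {ae mu, forall z, (mulop x + mulop y : Lp) z = z * x z + z * y z}.
  by apply: filterS3 (LpC_addE (mulop x) (mulop y)) (mae x) (mae y) => z -> -> ->.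
apply: filterS3 h (mae (x + y)) (LpC_addE x y) => z -> -> ->.
by rewrite mulrDr.
Qed.

Lemma mulopZ (a : R[i]) (x : Lp) : mulop (a *: x) = a *: mulop x.
Proof.
apply: LpC_ext.
have h : {ae mu, forall z, (a *: mulop x : Lp) z = a * (z * x z)}.
  by apply: filterS2 (LpC_scaleE a (mulop x)) (mae x) => z -> ->.
apply: filterS3 h (mae (a *: x)) (LpC_scaleE a x) => z -> -> ->.
by rewrite mulrCA.
Qed.

Lemma mulop0 : mulop (0 : Lp) = 0.
Proof. by rewrite -[X in mulop X](scale0r (0 : Lp)) mulopZ scale0r. Qed.

Lemma msupport_bounded : exists2 r : R, 0 < r & forall z, msupport mu z -> normc z < r.
Proof.
have cn : {within msupport mu, continuous (@normc R)}.
  by apply: continuous_subspaceT; exact: continuous_normc.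
have [M [_ Mb]] := compact_bounded (continuous_compact cn cS).
exists (`|M| + 2) => [|z Sz]; first by rewrite ltr_wpDl.
rewrite -[ltLHS]ger0_norm ?normc_ge0//.
apply: (@le_lt_trans _ _ (`|M| + 1)); last by rewrite ltrD2l ltr1n.
apply: (Mb (`|M| + 1)); last by exists z.
by rewrite ltr_pwDr// ler_norm.
Qed.

Lemma nrm_mulop_le (r : R) (x : Lp) : 0 <= r -> (forall z, msupport mu z -> normc z <= r) ->
  nrm (mulop x) <= r * nrm x.
Proof.
move=> r0 Sr; have nr : normc r%:C = r by rewrite /= expr0n addr0 sqrtr_sqr ger0_norm.
rewrite -[X in _ <= X * _]nr -nrmZ; apply: nrm_ae_le.
apply: filterS3 (mae x) (LpC_scaleE r%:C x) (msupport_ae mu) => z -> -> /Sr zr.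
by rewrite !normcM nr ler_wpM2r ?normc_ge0.
Qed.

(** On a step function the difference acts as multiplication by z - zeta (node k z), which is at
    most [delta] on the support. *)
Lemma mulop_step_le (node : cellTree R[i]) k (c zeta : nat -> R[i]) (delta : R) :
  0 <= delta ->
  (forall z, msupport mu z -> normc (z - zeta (node k z)) <= delta) ->
  nrm (mulop (step mu (ltW p1) node k c) - step mu (ltW p1) node k (fun i => zeta i * c i))
  <= delta * nrm (step mu (ltW p1) node k c).
Proof.
move=> d0 Sd; have nr : normc delta%:C = delta by rewrite /= expr0n addr0 sqrtr_sqr ger0_norm.
rewrite -nr -nrmZ; apply: nrm_ae_le; rewrite -scaleN1r.
set x := step mu (ltW p1) node k c; set y := step mu (ltW p1) node k _.
have hx : {ae mu, forall z, x z = c (node k z)}.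
  by have := toLp_ae (ltW p1) (step_LfunC mu (ltW p1) node k c); apply: filterS => z ->.
have hy : {ae mu, forall z, y z = zeta (node k z) * c (node k z)}.
  have := toLp_ae (ltW p1) (step_LfunC mu (ltW p1) node k (fun i => zeta i * c i)).
  by apply: filterS => z ->.
have h1 : {ae mu, forall z, (mulop x + -1 *: y : Lp) z = (z - zeta (node k z)) * c (node k z)}.
  have h2 : {ae mu, forall z, (mulop x + -1 *: y : Lp) z = z * x z - y z}.
    apply: filterS3 (LpC_addE (mulop x) (-1 *: y)) (mae x) (LpC_scaleE (-1) y) => z -> -> ->.
    by rewrite mulN1r.
  by apply: filterS3 h2 hx hy => z -> -> ->; rewrite mulrBl.
have h3 : {ae mu, forall z, (delta%:C *: x : Lp) z = delta%:C * c (node k z)}.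
  by apply: filterS2 (LpC_scaleE delta%:C x) hx => z -> ->.
apply: filterS3 h1 h3 (msupport_ae mu) => z -> -> Sz.
by rewrite !normcM nr ler_wpM2r ?normc_ge0// Sd.
Qed.

End multiplication.

(** * Construction of K and D *)

Section haar_perturbation.
Context (R : realType).
Variables (mu : {finite_measure set R[i] -> \bar R}) (p : R) (p1 : 1 < p).
Local Notation Lp := (LpC mu (ltW p1)).
Variables (node : cellTree R[i]) (k0 : nat) (delta : nat -> R) (B C : R).
Local Notation M0 := (2 ^ k0)%N.
Local Notation w := (haar_vec mu (ltW p1) node k0).
Local Notation step := (step mu (ltW p1) node).
Local Notation mass := (mass mu node).
Local Notation coord := (haar_coord node k0).
Local Notation e := (cell_ind mu (ltW p1) node).
Local Notation S := (msupport mu).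
Hypothesis cS : compact S.
Hypothesis d0 : forall k, 0 <= delta k.
Hypothesis diam : forall k z z', S z -> S z' -> node k z = node k z' ->
  normc (z - z') <= delta k.
Hypothesis dB : forall N, \sum_(0 <= k < N) delta (k0 + k) <= B.
Hypothesis C0 : 0 <= C.
Hypothesis HC : forall (a t : nat -> R[i]) (m : nat), (forall n, normc (t n) <= 1) ->
  nrm (\sum_(0 <= n < m) (t n * a n) *: w n) <= C * nrm (\sum_(0 <= n < m) a n *: w n).

(* Junk value 0 when the cell of i does not meet the support. *)
Definition cell_point i : R[i] := xget 0 [set z | S z /\ cell node i z].

Lemma cell_point_close k z : S z -> normc (z - cell_point (node k z)) <= delta k.
Proof.
move=> Sz; have dk : depth (node k z) = k by apply: depthE; exact: node_itv.
have [Sp cp] : S (cell_point (node k z)) /\ cell node (node k z) (cell_point (node k z)).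
  by rewrite /cell_point; case: xgetP => [//|/(_ z)] []; split => //; rewrite /cell dk.
by apply: diam => //; move: cp; rewrite /cell dk.
Qed.

Definition haar_eigenvalue n : R[i] := cell_point (if (n < M0)%N then (M0 + n)%N else n).
Local Notation lam := haar_eigenvalue.

(** The value K must take at [w n] for [w n] to be an eigenvector of M - K with eigenvalue
    [lam n]. *)
Definition haar_defect n : Lp := mulop (w n) - lam n *: w n.

Lemma haar_defectZ (a : R[i]) n : a *: haar_defect n = mulop (a *: w n) - lam n *: (a *: w n).
Proof. by rewrite /haar_defect scalerBr mulopZ// !scalerA mulrC. Qed.

Lemma mulop_sum (I : Type) (r : seq I) (F : I -> Lp) :
  mulop (\sum_(i <- r) F i) = \sum_(i <- r) mulop (F i).
Proof.
elim: r => [|i r IH]; last by rewrite !big_cons mulopD// IH.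
by rewrite !big_nil mulop0.
Qed.

Lemma haar_defect_sum (c : nat -> R[i]) m n :
  \sum_(m <= j < n) c j *: haar_defect j =
  mulop (\sum_(m <= j < n) c j *: w j) - \sum_(m <= j < n) (lam j * c j) *: w j.
Proof.
rewrite mulop_sum -sumrB; apply: eq_bigr => j _.
by rewrite haar_defectZ scalerA.
Qed.

Lemma step_ext k (c c' : nat -> R[i]) :
  (forall i, (2 ^ k <= i < 2 ^ k.+1)%N -> c i = c' i) -> step k c = step k c'.
Proof.
by move=> cc'; rewrite !stepE !big_nat; apply: eq_bigr => i /cc' ->.
Qed.

Lemma haar_block0 (c : nat -> R[i]) :
  \sum_(0 <= n < M0) c n *: w n = step k0 (fun i => c (i - M0)%N).
Proof.
rewrite stepE expnS mul2n -addnn.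
transitivity (\sum_(0 + M0 <= i < M0 + M0) c (i - M0)%N *: e i); last by rewrite add0n.
rewrite big_addn addnK !big_nat; apply: eq_bigr => i /= hi.
by rewrite addnK /haar_vec hi addnC.
Qed.

Lemma haar_blockS k (c : nat -> R[i]) : (k0 <= k)%N ->
  \sum_(2 ^ k <= n < 2 ^ k.+1) c n *: w n =
  step k.+1 (fun i => c i./2 * (haar_coef mass i)%:C).
Proof.
move=> kk; have Mle : (M0 <= 2 ^ k)%N by rewrite leq_exp2l.
rewrite stepE [(2 ^ k.+2)%N]expnS [(2 ^ k.+1)%N]expnS !mul2n big_nat_double !big_nat.
apply: eq_bigr => i /andP[hi _].
by rewrite /haar_vec ltnNge (leq_trans Mle hi)/= scalerDr !scalerA doubleK uphalf_double.
Qed.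

(* Block 0 consists of the indicators of depth k0, and block j + 1 of the Haar
   functions of depth k0 + j. *)
Definition block_bound j := if j is j'.+1 then (2 ^ (k0 + j'))%N else 0%N.

Definition haar_block j (x : Lp) : Lp :=
  \sum_(block_bound j <= n < block_bound j.+1) coord n x *: haar_defect n.

(** Conditional expectations have norm at most 2: block 0 involves one of them, every other block a
    difference of two. *)
Definition block_norm j : R := if j is j'.+1 then 4 * delta (k0 + j') else 2 * delta k0.

(** Within a block the terms are not estimated one by one: their sum is a step function expressed by
    conditional expectations, to which [mulop_step_le] applies. *)
Lemma haar_block_le j x : nrm (haar_block j x) <= block_norm j * nrm x.
Proof.
rewrite /haar_block haar_defect_sum; case: j => [|j] /=.
  rewrite addn0 !haar_block0.
  have -> : step k0 (fun i => lam (i - M0)%N * coord (i - M0)%N x) =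
      step k0 (fun i => cell_point i * coord (i - M0)%N x).
    apply: step_ext => i /andP[h1 h2]; rewrite /lam subnKC//.
    by rewrite ltn_subLR// addnn -mul2n -expnS h2.
  have sE : step k0 (fun i => coord (i - M0)%N x) = condE node k0 x.
    have := condE_haar node k0 0 x; rewrite addn0 => ->.
    exact/esym/(haar_block0 (fun n => coord n x)).
  apply: le_trans (mulop_step_le p1 cS _ (d0 k0) (fun z => @cell_point_close k0 z)) _.
  rewrite sE [2 * _]mulrC -mulrA ler_wpM2l ?d0//; exact: nrm_condE.
rewrite addnS; have kk : (k0 <= k0 + j)%N by exact: leq_addr.
have cE : \sum_(2 ^ (k0 + j) <= n < 2 ^ (k0 + j).+1) coord n x *: w n =
    condE node (k0 + j).+1 x - condE node (k0 + j) x.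
  rewrite -addnS !condE_haar addnS (@big_cat_nat _ _ _ (2 ^ (k0 + j)) 0 (2 ^ (k0 + j).+1))//=.
    by rewrite addrAC subrr add0r.
  by rewrite leq_exp2l.
rewrite (haar_blockS (fun n => lam n * coord n x) kk).
have -> : step (k0 + j).+1 (fun i => lam i./2 * coord i./2 x * (haar_coef mass i)%:C) =
    step (k0 + j).+1 (fun i => cell_point i./2 * (coord i./2 x * (haar_coef mass i)%:C)).
  apply: step_ext => i /andP[h1 _]; rewrite -mulrA /lam ifF//.
  apply/negbTE; rewrite -leqNgt; apply: (@leq_trans (2 ^ (k0 + j))); first by rewrite leq_exp2l.
  by move: h1; rewrite expnS; move: (2 ^ _)%N => D; lia.
(* The block is a step function of depth k0 + j + 1, but the eigenvalue belongs to the parent cell,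
   of depth k0 + j. *)
have cl z : S z -> normc (z - cell_point (node (k0 + j).+1 z)./2) <= delta (k0 + j).
  by move=> Sz; rewrite tree_nodeS cell_point_close.
have h := @mulop_step_le _ mu p p1 cS node (k0 + j).+1
  (fun i => coord i./2 x * (haar_coef mass i)%:C) (fun i => cell_point i./2) _
  (d0 (k0 + j)) cl.
rewrite (haar_blockS _ kk).
apply: (le_trans h); rewrite -(haar_blockS (fun n => coord n x) kk) cE.
have := nrm_condE node (k0 + j).+1 x; have := nrm_condE node (k0 + j) x.
have := nrmB (condE node (k0 + j).+1 x) (condE node (k0 + j) x).
move=> h1 h2 h3; rewrite [4 * _]mulrC -mulrA ler_wpM2l ?d0//; lra.
Qed.

Lemma block_norm_sum N : \sum_(0 <= j < N) block_norm j <= 6 * B.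
Proof.
have B0 : 0 <= B by have := dB 0; rewrite big_geq.
case: N => [|N]; first by rewrite big_geq// mulr_ge0.
rewrite big_nat_recl//= -mulr_sumr.
by have := dB N; have := dB 1; rewrite big_nat1 addn0; lra.
Qed.

Lemma haar_block_sum x J : \sum_(0 <= j < J) haar_block j x =
  \sum_(0 <= n < block_bound J) coord n x *: haar_defect n.
Proof.
elim: J => [|J IH]; first by rewrite !big_geq.
rewrite big_nat_recr//= IH /haar_block -(@big_cat_nat _ _ _ (block_bound J))//.
by case: J {IH} => [//|J] /=; rewrite leq_exp2l// leq_add2l.
Qed.

Lemma haar_block_vec J m : (m < block_bound J)%N ->
  \sum_(0 <= j < J) haar_block j (w m) = haar_defect m.
Proof.
move=> mJ; rewrite haar_block_sum (bigD1_seq m) ?mem_index_iota ?iota_uniq//=.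
have E n : coord n (w m) *: haar_defect n = (n == m)%:R *: haar_defect n.
  by rewrite haar_defectZ (haar_coord_vec HC) -haar_defectZ.
rewrite E eqxx scale1r big1 ?addr0// => n /negbTE nm.
by rewrite E nm scale0r.
Qed.

Lemma haar_block_totally_bounded j :
  totally_bounded [set haar_block j x | x in [set x | nrm x <= 1]].
Proof.
(* On the unit ball a single Haar term is at most C times a conditional expectation, of norm at most
   2. Coefficients of zero vectors are replaced by 0. *)
pose c n : R := C * 2 / nrm (w n).
apply: totally_boundedS (totally_bounded_span c haar_defect (block_bound j) (block_bound j.+1)).
move=> _ [x x1 <-]; exists (fun n => if w n == 0 then 0 else coord n x).
  move=> n; case: eqVneq => [wn|wn]; first by rewrite [normc _]normc0 /c wn nrm0 invr0 mulr0.
  have nw : 0 < nrm (w n).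
    by rewrite lt_neqAle nrm_ge0 andbT eq_sym; apply: contra_neq wn; exact: nrm0_eq0.
  rewrite /c ler_pdivlMr// -nrmZ.
  have nm : (n < 2 ^ (k0 + n))%N.
    by apply: (leq_ltn_trans (leq_addl k0 n)); exact: ltn_expl.
  apply: le_trans (haar_term_le HC (fun n => coord n x) nm) _.
  rewrite -condE_haar ler_wpM2l//; apply: le_trans (nrm_condE _ _ _) _.
  by rewrite ler_piMr.
apply: eq_bigr => n _; case: eqVneq => [wn|//].
by rewrite /haar_defect wn mulop0// !scaler0 subr0 !scaler0.
Qed.

Lemma haar_diagonalization : exists K D : {linear Lp -> Lp},
  [/\ bounded_near K (nbhs 0) /\ bounded_near D (nbhs 0),
      compact_operator K /\ opnorm K <= 6 * B,
      forall n, D (w n) = lam n *: w n &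
      forall f : Lp, mulop f = D f + K f].
Proof.
have AD j x y : haar_block j (x + y) = haar_block j x + haar_block j y.
  rewrite /haar_block -big_split/=; apply: eq_bigr => n _.
  by rewrite haar_coordD scalerDl.
have AZ j (a : R[i]) x : haar_block j (a *: x) = a *: haar_block j x.
  rewrite /haar_block scaler_sumr; apply: eq_bigr => n _.
  by rewrite haar_coordZ scalerA.
have b0 j : 0 <= block_norm j by case: j => [|j] /=; rewrite mulr_ge0.
have [K [Kn Kc Kt]] := operator_series AD AZ haar_block_le b0 block_norm_sum.
have B0 : 0 <= B by have := dB 0; rewrite big_geq.
have [r r0 Sr] := msupport_bounded cS.
(* D is obtained by subtraction, so that its boundedness follows from those of M and K; the
   eigenvectors are checked afterwards. *)
have Dlin : linear (fun f : Lp => mulop f - K f).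
  move=> a f g; rewrite mulopD// mulopZ// linearP opprD addrACA.
  by rewrite scalerBr.
pose D : {linear Lp -> Lp} :=
  HB.pack (fun f : Lp => mulop f - K f) (GRing.isLinear.Build R[i] Lp Lp *:%R _ Dlin).
have Dn f : nrm (D f) <= (r + 6 * B) * nrm f.
  rewrite [nrm _](_ : _ = nrm (mulop f - K f))// (le_trans (nrmB _ _))// mulrDl lerD//.
  by apply: nrm_mulop_le => // [|z /Sr/ltW//]; exact: ltW.
have bnd (f : {linear Lp -> Lp}) (b : R) : 0 <= b -> (forall x, nrm (f x) <= b * nrm x) ->
    bounded_near f (nbhs 0).
  move=> b00 fb; apply/linear_boundedP; exists b%:C; split.
    by rewrite realE lecR b00.
  move=> s bs x; rewrite !normE; apply: (@le_trans _ _ (b%:C * (nrm x)%:C)).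
    by rewrite -rmorphM lecR.
  by rewrite ler_wpM2r ?lecR ?nrm_ge0// ltW.
have unit_ball : [set x : Lp | `|x| <= 1] = [set x : Lp | nrm x <= 1].
  by apply/seteqP; split => x /=; rewrite normE -(rmorph1 (real_complex R)) lecR.
exists K, D; split.
- split; first by apply: (bnd K (6 * B)) => //; rewrite mulr_ge0.
  by apply: (bnd D (r + 6 * B)) => //; rewrite addr_ge0 ?mulr_ge0 ?(ltW r0).
- split.
    rewrite /compact_operator unit_ball; apply: totally_bounded_precompact.
    by apply: Kt; exact: haar_block_totally_bounded.
  apply: ge_sup; first by exists (complex.Re `|K 0|); exists 0 => //=; rewrite normr0.
  move=> _ [x + <-]; rewrite unit_ball /= => x1.
  apply: (le_trans (Kn x)).
  by rewrite ler_piMr// mulr_ge0.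
- move=> n; suff Kw : K (w n) = haar_defect n.
    by rewrite [LHS](_ : _ = mulop (w n) - K (w n))// Kw /haar_defect opprB addrC subrK.
  (* At [w n] the series defining K is stationary: its partial sums equal [haar_defect n] from n + 1
     blocks on. *)
  apply: nrm_cvg_unique (Kc (w n)) _ => eps eps0.
  exists n.+1 => J nJ; rewrite haar_block_vec ?subrr ?nrm0//.
  case: J nJ => [//|J]; rewrite ltnS => nJ; apply: (leq_ltn_trans nJ).
  by apply: (leq_ltn_trans (leq_addl k0 J)); exact: ltn_expl.
- by move=> f; rewrite [D f](_ : _ = mulop f - K f)// subrK.
Qed.

End haar_perturbation.

(** * Bases from Haar systems with zero vectors dropped *)

Section compress.
Context d (T : measurableType d) (R : realType).
Variables (mu : {finite_measure set T -> \bar R}) (p : R) (p1 : 1 < p).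
Local Notation Lp := (LpC mu (ltW p1)).
Variables (w : nat -> Lp) (C : R).
Hypothesis C0 : 0 < C.
Hypothesis HC : forall (a t : nat -> R[i]) (m : nat), (forall n, normc (t n) <= 1) ->
  nrm (\sum_(0 <= n < m) (t n * a n) *: w n) <= C * nrm (\sum_(0 <= n < m) a n *: w n).
Hypothesis Hexp : forall x, exists c : nat -> R[i],
  nrm_cvg (fun m => \sum_(0 <= n < m) c n *: w n) x.

Definition nz_count n : nat := \sum_(0 <= k < n) (w k != 0)%R.
Local Notation cnt := nz_count.

Lemma nz_countS n : cnt n.+1 = (cnt n + (w n != 0)%R)%N.
Proof. by rewrite /cnt big_nat_recr. Qed.

Lemma nz_count_homo m n : (m <= n)%N -> (cnt m <= cnt n)%N.
Proof. by move=> mn; rewrite /cnt (@big_cat_nat _ _ _ m 0 n)//= leq_addr. Qed.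

Lemma nz_count_le n : (cnt n <= n)%N.
Proof.
elim: n => [|n IH]; first by rewrite /cnt big_geq.
by rewrite nz_countS; case: (w n != 0); rewrite ?addn1 ?addn0 ?ltnS// leqW.
Qed.

Lemma nz_count_surj j m : (j <= cnt m)%N -> exists M, cnt M = j.
Proof.
elim: m => [|m IH] jm.
  by exists 0%N; move: jm; rewrite {1}/cnt big_geq// leqn0 => /eqP->; rewrite /cnt big_geq.
have [/IH//|mj] := leqP j (cnt m); exists m.+1.
by move: jm; rewrite nz_countS; case: (w m != 0); rewrite ?addn1 ?addn0; lia.
Qed.

Lemma nz_count_prev j M : cnt M = j.+1 -> exists2 n, w n != 0 & cnt n = j.
Proof.
elim: M => [|M IH]; first by rewrite /cnt big_geq.
rewrite nz_countS; case: (boolP (w M != 0)) => wM; last by rewrite addn0.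
by rewrite addn1 => -[e]; exists M.
Qed.

Lemma nz_count_inj n n' : w n != 0 -> w n' != 0 -> cnt n = cnt n' -> n = n'.
Proof.
have aux m m' : w m != 0 -> (m < m')%N -> cnt m = cnt m' -> False.
  move=> wm mm'; have := nz_count_homo mm'; rewrite nz_countS wm addn1 => h e.
  by move: h; rewrite e ltnn.
by move=> wn wn' e; case: (ltngtP n n') => // h; exfalso; [exact: aux h e|exact: aux h (esym e)].
Qed.

(* The index of the (j+1)-st nonzero vector among the w n, or 0 if there is none. *)
Definition nz_index j : nat := xget 0%N [set n | w n != 0 /\ cnt n = j].
Definition nz_seq j : Lp := w (nz_index j).

Lemma nz_indexK n : w n != 0 -> nz_index (cnt n) = n.
Proof.
move=> wn; rewrite /nz_index; case: xgetP => [m _ [wm e]|/(_ n)[]//].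
exact: nz_count_inj.
Qed.

Lemma nz_seq_neq0 j M : cnt M = j.+1 -> nz_seq j != 0.
Proof. by move=> /nz_count_prev[n wn <-]; rewrite /nz_seq nz_indexK. Qed.

(** Initial sums of [w] and of the compressed sequence correspond, so estimates for initial segments
    carry over. *)
Lemma sum_nz_seq (a : nat -> R[i]) m :
  \sum_(0 <= n < m) a (cnt n) *: w n = \sum_(0 <= j < cnt m) a j *: nz_seq j.
Proof.
elim: m => [|m IH]; first by rewrite /cnt !big_geq// big_geq.
rewrite big_nat_recr//= IH nz_countS; case: eqVneq => [->|wm] /=.
  by rewrite scaler0 addr0 addn0.
by rewrite addn1 big_nat_recr//= /nz_seq nz_indexK.
Qed.

Lemma sum_nz_index (c : nat -> R[i]) m :
  \sum_(0 <= n < m) c n *: w n = \sum_(0 <= j < cnt m) c (nz_index j) *: nz_seq j.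
Proof.
rewrite -(sum_nz_seq (fun j => c (nz_index j))); apply: eq_bigr => n _.
by case: (eqVneq (w n) 0) => [->|wn]; rewrite ?scaler0// nz_indexK.
Qed.

Lemma nz_seq_mult (a t : nat -> R[i]) M : (forall n, normc (t n) <= 1) ->
  nrm (\sum_(0 <= j < cnt M) (t j * a j) *: nz_seq j) <=
  C * nrm (\sum_(0 <= j < cnt M) a j *: nz_seq j).
Proof.
move=> t1; rewrite -(sum_nz_seq (fun j => t j * a j)) -sum_nz_seq.
exact: (HC (fun n => a (cnt n)) (t := fun n => t (cnt n))).
Qed.

(** Coefficients are controlled by the sum; since the vectors are nonzero, this yields uniqueness of
    expansions. *)
Lemma nz_seq_coef_le (a : nat -> R[i]) M j : (j < cnt M)%N ->
  normc (a j) * nrm (nz_seq j) <= C * nrm (\sum_(0 <= i < cnt M) a i *: nz_seq i).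
Proof.
move=> jM; rewrite -nrmZ.
have := @nz_seq_mult a (fun i => (i == j)%:R) M.
rewrite (bigD1_seq j) ?mem_index_iota ?iota_uniq//= eqxx mul1r big1 ?addr0.
  by apply=> i; case: (i == j); rewrite ?[normc _]normc1 ?[normc _]normc0.
by move=> i /negbTE ->; rewrite mul0r scale0r.
Qed.

(** Together with [normc_abs_ge], this turns both inequalities of [unconditional_basis] into
    multiplier estimates. *)
Lemma normc_abs_le (a : R[i]) : exists2 t : R[i], normc t <= 1 & a = t * `|a|.
Proof.
have [->|a0] := eqVneq a 0; first by exists 0; rewrite ?[normc _]normc0// mul0r.
have na0 : `|a| != 0 by rewrite normr_eq0.
exists (a / `|a|); last by rewrite divfK.
by rewrite -lecR -normcEC normf_div normr_id divff// rmorph1.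
Qed.

Lemma normc_abs_ge (a : R[i]) : exists2 t : R[i], normc t <= 1 & `|a| = t * a.
Proof.
have [->|a0] := eqVneq a 0; first by exists 0; rewrite ?[normc _]normc0// normr0 mul0r.
exists (`|a| / a); last by rewrite divfK.
by rewrite -lecR -normcEC normf_div normr_id divff ?normr_eq0// rmorph1.
Qed.

Lemma nrm_cvgP (s : nat -> Lp) x : nrm_cvg s x <-> s @ \oo --> x.
Proof.
split=> [sx U /nbhs_LpP[r r0 rU]|sx e e0].
  by have [N HN] := sx _ r0; exists N => // n /HN h; apply: rU; rewrite -nrmN opprB.
have [|N _ HN] := sx [set y | nrm (y - x) < e].
  by apply/nbhs_LpP; exists e => // y; rewrite -nrmN opprB.
by exists N => n /HN.
Qed.

Lemma unconditional_nz_seq N :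
  (forall m, (forall n, (n < m)%N -> in_range N n) -> exists M, cnt M = m) ->
  schauder_basis N nz_seq -> unconditional_basis C N nz_seq.
Proof.
move=> NM sb; split => // m /NM[M <-] a.
have E (b : nat -> R[i]) : \sum_(n < cnt M) b n *: nz_seq n = \sum_(0 <= n < cnt M) b n *: nz_seq n.
  by rewrite big_mkord.
rewrite (E (fun n => `|a n|)) (E a) !normE -!rmorphM !lecR; split.
- rewrite ler_pdivrMl//.
  have Ha n : exists t : R[i], normc t <= 1 /\ `|a n| = t * a n.
    by have [t t1 ta] := normc_abs_ge (a n); exists t.
  have [t Ht] := choice Ha.
  rewrite (eq_bigr (fun n => (t n * a n) *: nz_seq n)); last by move=> n _; rewrite -(Ht n).2.
  by apply: nz_seq_mult => n; exact: (Ht n).1.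
- have Ha n : exists t : R[i], normc t <= 1 /\ a n = t * `|a n|.
    by have [t t1 ta] := normc_abs_le (a n); exists t.
  have [t Ht] := choice Ha.
  rewrite [X in nrm X <= _](eq_bigr (fun n => (t n * `|a n|) *: nz_seq n)); last first.
    by move=> n _; rewrite -(Ht n).2.
  by apply: nz_seq_mult => n; exact: (Ht n).1.
Qed.

(** Either [w] vanishes from some L on, so that every x is a finite sum of the [cnt L] remaining
    vectors, or infinitely many [w n] are nonzero and every length is a value of [cnt]. *)
Lemma compress_basis : exists N, unconditional_basis C N nz_seq.
Proof.
have [[L HL]|nL] := pselect (exists L, forall n, (L <= n)%N -> w n = 0).
  exists (Some (cnt L)); apply: unconditional_nz_seq.
    move=> m mL; apply: (@nz_count_surj m L); case: m mL => [//|m] mL.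
    by have := mL m (ltnSn m); rewrite /in_range.
  move=> x; have [c cx] := Hexp x.
  have xE : x = \sum_(0 <= n < L) c n *: w n.
    apply: nrm_cvg_unique cx _ => e e0; exists L => n Ln.
    rewrite (@big_cat_nat _ _ _ L 0 n)//= [X in _ + X - _]big1_seq ?addr0 ?subrr ?nrm0//.
    by move=> k; rewrite mem_index_iota => /andP[_ /andP[/HL -> _]]; rewrite scaler0.
  exists [ffun n : 'I_(cnt L) => c (nz_index n)]; split.
    rewrite {1}xE sum_nz_index big_mkord; apply: eq_bigr => n _.
    by rewrite ffunE.
  move=> b xb; apply/ffunP => i; rewrite ffunE; apply/eqP; rewrite -subr_eq0; apply/eqP.
  (* The finite family [b] is extended by 0 to all indices. *)
  pose a j := c (nz_index j) - (if insub j is Some k then b k else 0).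
  have s0 : \sum_(0 <= j < cnt L) a j *: nz_seq j = 0.
    have xE' : x = \sum_(j < cnt L) c (nz_index j) *: nz_seq j.
      by rewrite {1}xE sum_nz_index big_mkord.
    rewrite big_mkord; transitivity (\sum_(j < cnt L) c (nz_index j) *: nz_seq j -
        \sum_(j < cnt L) b j *: nz_seq j); last by rewrite -xE' -xb subrr.
    by rewrite -sumrB; apply: eq_bigr => n _; rewrite /a scalerBl valK.
  have := nz_seq_coef_le a (ltn_ord i); rewrite s0 nrm0 mulr0.
  have [M eM] := nz_count_surj (ltn_ord i).
  have u0 := nz_seq_neq0 eM.
  have nu : 0 < nrm (nz_seq i).
    by rewrite lt_neqAle nrm_ge0 andbT eq_sym; apply: contra_neq u0; exact: nrm0_eq0.
  rewrite pmulr_lle0// => ai; have : normc (a i) = 0 by apply/eqP; rewrite eq_le ai normc_ge0.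
  by move=> /eq0_normc; rewrite /a valK.
have unb j : exists M, (j <= cnt M)%N.
  elim: j => [|j [M jM]]; first by exists 0%N.
  have [n Mn wn] : exists2 n, (M <= n)%N & w n != 0.
    apply: contrapT => h; apply: nL; exists M => n Mn.
    by apply/eqP; apply: contrapT => /negP wn; apply: h; exists n.
  by exists n.+1; rewrite nz_countS wn addn1 ltnS (leq_trans jM)// nz_count_homo.
have surj j : exists M, cnt M = j by have [M /nz_count_surj] := unb j.
exists None; apply: unconditional_nz_seq; first by move=> m _; exact: surj.
move=> x; have [c cx] := Hexp x.
have cj : nrm_cvg (fun m => \sum_(0 <= j < m) c (nz_index j) *: nz_seq j) x.
  move=> e /cx[N HN]; exists N => m Nm; have [M eM] := surj m.
  by rewrite -eM -sum_nz_index; apply: HN; rewrite (leq_trans Nm)// -eM nz_count_le.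
exists (fun j => c (nz_index j)); split; first exact/nrm_cvgP.
move=> b /nrm_cvgP xb; apply/funext => j; apply/eqP; rewrite -subr_eq0; apply/eqP.
pose a j := c (nz_index j) - b j.
have a0 : nrm_cvg (fun m => \sum_(0 <= j < m) a j *: nz_seq j) 0.
  move=> e e0; have := nrm_cvgD cj (nrm_cvgZ (-1) xb) e0.
  move=> [N HN]; exists N => n /HN; rewrite !scaleN1r subrr.
  rewrite /series/= -sumrB; congr (nrm (_ - _) < _); apply: eq_bigr => k _.
  by rewrite /a scalerBl.
have [M eM] := surj j.+1; have u0 := nz_seq_neq0 eM.
have nu : 0 < nrm (nz_seq j).
  by rewrite lt_neqAle nrm_ge0 andbT eq_sym; apply: contra_neq u0; exact: nrm0_eq0.
(* The difference of two expansions of x sums to 0, and each of its terms is at most C times its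
   partial sums, which become arbitrarily small. *)
suff : normc (a j) * nrm (nz_seq j) <= 0.
  rewrite pmulr_lle0// => aj; have : normc (a j) = 0 by apply/eqP; rewrite eq_le aj normc_ge0.
  by move=> /eq0_normc.
apply/ler_addgt0Pr => e e0; rewrite add0r.
have [N HN] := a0 _ (divr_gt0 e0 C0).
have [M' eM'] := surj (maxn N j.+1).
have jM' : (j < cnt M')%N by rewrite eM' leq_max ltnSn orbT.
apply: le_trans (nz_seq_coef_le a jM') _.
have := HN (cnt M') ltac:(by rewrite eM' leq_maxl).
by rewrite subr0 ltr_pdivlMr// mulrC => /ltW.
Qed.

End compress.

Lemma exists_half_pow_lt {R : realType} (c e : R) : 0 < c -> 0 < e ->
  exists j, c * 2 ^- j < e.
Proof.
move=> c0 e0; exists (Num.truncn (c / e)).+1.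
rewrite ltr_pdivrMr ?exprn_gt0// mulrC -ltr_pdivrMr//.
by apply: (lt_trans (truncnS_gt _)); rewrite -natrX ltr_nat ltn_expl.
Qed.

(** * Convergence of the Haar expansion *)

Section haar_expansion.
Context (R : realType).
Variables (mu : {finite_measure set R[i] -> \bar R}) (p : R) (p1 : 1 < p).
Local Notation Lp := (LpC mu (ltW p1)).
Variables (node : cellTree R[i]) (k0 : nat) (S : set R[i]) (delta : nat -> R) (C : R).
Local Notation w := (haar_vec mu (ltW p1) node k0).
Hypothesis S_ae : {ae mu, forall z, S z}.
Hypothesis diam : forall k z z', S z -> S z' -> node k z = node k z' ->
  normc (z - z') <= delta k.
Hypothesis delta_small : forall e : R, 0 < e -> exists k, delta k < e.
Hypothesis C0 : 0 < C.
Hypothesis HC : forall (a t : nat -> R[i]) (m : nat), (forall n, normc (t n) <= 1) ->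
  nrm (\sum_(0 <= n < m) (t n * a n) *: w n) <= C * nrm (\sum_(0 <= n < m) a n *: w n).

(** Truncation at m is a multiplier with values 0 and 1, applied to coefficients set to 0 before the
    block. *)
Lemma haar_sum_block_le (c : nat -> R[i]) k m : (2 ^ k <= m < 2 ^ k.+1)%N ->
  nrm (\sum_(2 ^ k <= n < m) c n *: w n) <= C * nrm (\sum_(2 ^ k <= n < 2 ^ k.+1) c n *: w n).
Proof.
move=> /andP[km mk]; have h := @HC (fun n => if (n < 2 ^ k)%N then 0 else c n)
  (fun n => (n < m)%N%:R) (2 ^ k.+1).
have kk : (2 ^ k <= 2 ^ k.+1)%N by rewrite leq_exp2l.
have E1 : \sum_(2 ^ k <= n < m) c n *: w n =
  \sum_(0 <= n < 2 ^ k.+1) ((n < m)%N%:R * (if (n < 2 ^ k)%N then 0 else c n)) *: w n.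
  rewrite [RHS](@big_cat_nat _ _ _ (2 ^ k))//= [X in _ = X + _]big1_seq ?add0r; last first.
    by move=> n; rewrite mem_index_iota => /andP[_ /andP[_ ->]]; rewrite mulr0 scale0r.
  rewrite [RHS](@big_cat_nat _ _ _ m)//=; last exact: ltnW.
  rewrite [X in _ = _ + X]big1_seq ?addr0; last first.
    by move=> n; rewrite mem_index_iota => /andP[_ /andP[mn _]]; rewrite ltnNge mn mul0r scale0r.
  by rewrite !big_nat; apply: eq_bigr => n /andP[kn nm]; rewrite nm mul1r ltnNge kn.
have E2 : \sum_(2 ^ k <= n < 2 ^ k.+1) c n *: w n =
  \sum_(0 <= n < 2 ^ k.+1) (if (n < 2 ^ k)%N then 0 else c n) *: w n.
  rewrite [RHS](@big_cat_nat _ _ _ (2 ^ k))//= [X in _ = X + _]big1_seq ?add0r; last first.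
    by move=> n; rewrite mem_index_iota => /andP[_ /andP[_ ->]]; rewrite scale0r.
  by rewrite !big_nat; apply: eq_bigr => n /andP[kn nm]; rewrite ltnNge kn.
rewrite E1 E2; apply: h => n.
by case: (n < m)%N; rewrite ?[normc _]normc1 ?[normc _]normc0.
Qed.

Lemma haar_expansion (x : Lp) :
  nrm_cvg (fun m => \sum_(0 <= n < m) haar_coord node k0 n x *: w n) x.
Proof.
(* The conditional expectation contributes less than eta and the incomplete block at most 2 C eta,
   together less than e. *)
move=> e e0; pose eta := e / (2 * C + 2).
have c2 : 0 < 2 * C + 2 by rewrite addr_gt0// mulr_gt0.
have eta0 : 0 < eta by rewrite divr_gt0.
have [K HK] := condE_cvg S_ae diam delta_small x eta0.
exists (2 ^ maxn K k0)%N => m hm; pose k := trunc_log 2 m.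
have m0 : (0 < m)%N by apply: leq_trans hm; rewrite expn_gt0.
have /andP[km mk] : (2 ^ k <= m < 2 ^ k.+1)%N by rewrite trunc_logP//= trunc_log_ltn.
have /(leq_trans _) kk : (maxn K k0 <= k)%N by apply: trunc_log_max.
have Kk := kk _ (leq_maxl K k0); have k0k := kk _ (leq_maxr K k0).
rewrite (@big_cat_nat _ _ _ (2 ^ k) 0 m)//=.
have cE j : (k0 <= j)%N -> \sum_(0 <= n < 2 ^ j) haar_coord node k0 n x *: w n = condE node j x.
  by move=> /subnKC <-; rewrite condE_haar.
rewrite cE// addrAC (le_lt_trans (nrmD _ _))//.
have h1 := HK k Kk; have h2 := HK k.+1 (leqW Kk).
have h3 : nrm (\sum_(2 ^ k <= n < m) haar_coord node k0 n x *: w n) <=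
    C * nrm (condE node k.+1 x - condE node k x).
  have -> : condE node k.+1 x - condE node k x =
      \sum_(2 ^ k <= n < 2 ^ k.+1) haar_coord node k0 n x *: w n.
    rewrite -!cE ?leqW// (@big_cat_nat _ _ _ (2 ^ k) 0 (2 ^ k.+1))//= ?leq_exp2l//.
    by rewrite addrAC subrr add0r.
  by apply: haar_sum_block_le; rewrite km.
have h4 : nrm (condE node k.+1 x - condE node k x) <= 2 * eta.
  have -> : condE node k.+1 x - condE node k x =
      (condE node k.+1 x - x) - (condE node k x - x) by rewrite opprB addrA subrK.
  by have := nrmB (condE node k.+1 x - x) (condE node k x - x); lra.
have h5 : C * nrm (condE node k.+1 x - condE node k x) <= C * (2 * eta).
  by rewrite ler_wpM2l// ltW.
have -> : e = (2 * C + 2) * eta by rewrite /eta mulrC divfK// gt_eqF.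
by lra.
Qed.

End haar_expansion.

(** * Choice of the initial depth and conclusion *)

Theorem theorem1p1 (R : realType) (p : R) (p1 : 1 < p) :
  exists2 C : R, 0 < C &
  forall mu : {finite_measure set R[i] -> \bar R}, compact (msupport mu) ->
  forall eps : R, 0 < eps ->
  exists (K D : {linear LpC mu (ltW p1) -> LpC mu (ltW p1)})
         (N : option nat) (u : nat -> LpC mu (ltW p1)),
  [/\ bounded_near K (nbhs 0) /\ bounded_near D (nbhs 0),
      compact_operator K /\ opnorm K < eps,
      unconditional_basis C N u,
      diagonal_operator N u D &
      forall f : LpC mu (ltW p1), mulop f = D f + K f].
Proof.
have [C C0 HC] := haar_unconditional p1.
exists C => // mu cS eps eps0.
have [s s0 Ss] := msupport_bounded cS.
pose node := square_tree s.
(* 96 = 6 * 16: the norm of K is at most 6 B, with B = 16 s 2^-j for the depth k0 = 2 j. *)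
have [j hj] := exists_half_pow_lt (mulr_gt0 (ltr0n R 96) s0) eps0.
pose delta k : R := 4 * s * 2 ^- k./2.
have d0 k : 0 <= delta k by rewrite mulr_ge0 ?mulr_ge0 ?invr_ge0 ?exprn_ge0// ltW.
have diam k z z' : msupport mu z -> msupport mu z' -> node k z = node k z' ->
    normc (z - z') <= delta k.
  by move=> /Ss zs /Ss zs'; exact: square_node_close.
have dsmall (e : R) : 0 < e -> exists k, delta k < e.
  move=> e0; have [i hi] := exists_half_pow_lt (mulr_gt0 (ltr0n R 4) s0) e0.
  by exists i.*2; rewrite /delta doubleK.
(* As k0 = 2 j is even, half of 2 j + k is j + k./2, and a factor 2^-j comes out of the sum; 16 = 4
   * 4 by [sum_half_pow]. *)
have dB N : \sum_(0 <= k < N) delta (j.*2 + k)%N <= 16 * s * 2 ^- j.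
  rewrite (eq_bigr (fun k => 4 * s * 2 ^- j * 2 ^- k./2)); last first.
    move=> k _; rewrite /delta halfD odd_double doubleK add0n exprD invfM; ring.
  rewrite -mulr_sumr; have := sum_half_pow R N.
  have : 0 <= 4 * s * 2 ^- j by rewrite mulr_ge0 ?mulr_ge0 ?invr_ge0 ?exprn_ge0// ltW.
  by move: (\sum_(0 <= k < N) _) (2 ^- j) => S q; nra.
have HCw := HC _ _ mu node j.*2.
have [K [D [bKD [cK nK] Dw KD]]] :=
  haar_diagonalization cS d0 diam dB (ltW C0) HCw.
have Hexp x : exists c : nat -> R[i], nrm_cvg
    (fun m => \sum_(0 <= n < m) c n *: haar_vec mu (ltW p1) node j.*2 n) x.
  exists (haar_coord node j.*2 ^~ x).
  exact: (haar_expansion (msupport_ae mu) diam dsmall C0 HCw).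
have [N ub] := compress_basis C0 HCw Hexp.
set w := haar_vec mu (ltW p1) node j.*2 in Dw ub *.
exists K, D, N, (nz_seq w); split => //.
- split => //; apply: le_lt_trans nK _; apply: le_lt_trans hj.
  by rewrite mulrA mulrA -natrM.
- by move=> n _; exists (haar_eigenvalue mu node j.*2 (nz_index w n)); exact: Dw.
Qed.
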